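(* Let $c\in\mathbb{R}^n$ satisfy $\alpha(c)>\max_{x\in\mathbb{T}^n}V(x)$, let $u_c$ be a $\mathbb{Z}^n$-periodic viscosity solution of $H(x,c+Du(x))=\alpha(c)$, where $H(x,p)=\frac12\langle A(x)p,p\rangle+V(x)$, and let $v(x)=u_c(x)+\langle c,x\rangle$ for $x\in\mathbb{R}^n$. (i) Let $\mathbf{x}:[0,\tau]\to\mathbb{R}^n$ be a generalized characteristic of $H(x,Dv(x))=\alpha(c)$ such that $\dot{\mathbf{x}}^+(s)\neq 0$ for all $s\in[0,\tau)$. Then $$v(\mathbf{x}(s_1))<v(\mathbf{x}(s_2))\quad\text{for all } 0\leqslant s_1<s_2\leqslant\tau.$$ (ii) If $x\in\Sigma_v$ is not a local maximum point of $v$ and the level set $\Lambda_x=\{y\in\mathbb{R}^n:v(y)=v(x)\}$ is an $(n-1)$-dimensional Lipschitz manifold near $x$, then there exist $\tau'>0$ and a singular generalized characteristic $\mathbf{x}:[0,\tau']\to\mathbb{R}^n$ with $\mathbf{x}(0)=x$ and $\dot{\mathbf{x}}^+(s)\neq0$ for all $s\in[0,\tau')$. In particular, $\mathbf{x}$ is not constant.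
   Context: $A(x)$ is a symmetric positive definite $n\times n$ matrix, smooth and $\mathbb{Z}^n$-periodic in $x\in\mathbb{R}^n$; $V$ is a smooth $\mathbb{Z}^n$-periodic real function on $\mathbb{R}^n$; $\mathbb{T}^n=\mathbb{R}^n/\mathbb{Z}^n$ is the flat torus. For $c\in\mathbb{R}^n$, $\alpha(c)$ (Mather's $\alpha$-function) is the unique real number such that $H(x,c+Du(x))=\alpha(c)$ admits a $\mathbb{Z}^n$-periodic viscosity solution. Such solutions (also called weak KAM solutions) are locally semiconcave with linear modulus. For a continuous function $w$, $D^+w(x)=\{p\in\mathbb{R}^n:\limsup_{y\to x}\frac{w(y)-w(x)-\langle p,y-x\rangle}{|y-x|}\leqslant 0\}$ and $D^-w(x)=\{p\in\mathbb{R}^n:\liminf_{y\to x}\frac{w(y)-w(x)-\langle p,y-x\rangle}{|y-x|}\geqslant 0\}$. A continuous function $u$ is a viscosity solution of $H(x,c+Du(x))=\alpha(c)$ if for every $x$: $H(x,c+p)\leqslant\alpha(c)$ for all $p\in D^+u(x)$, and $H(x,c+p)\geqslant\alpha(c)$ for all $p\in D^-u(x)$. The singular set $\Sigma_v$ is the set of points $x$ at which $D^+v(x)$ is not a singleton. A generalized characteristic of $H(x,Dv(x))=\alpha(c)$ is a Lipschitz arc $\mathbf{x}:[0,\tau]\to\mathbb{R}^n$ with $\dot{\mathbf{x}}(s)\in\mathrm{co}\,H_p(\mathbf{x}(s),D^+v(\mathbf{x}(s)))=A(\mathbf{x}(s))D^+v(\mathbf{x}(s))$ for a.e. $s\in[0,\tau]$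 ($\mathrm{co}$ denotes the closed convex hull). It is known that for such an arc the right derivative $\dot{\mathbf{x}}^+(s)$ exists for every $s\in[0,\tau)$. A generalized characteristic is singular if $\mathbf{x}(s)\in\Sigma_v$ for all $s$ in its domain. ''$\Lambda_x$ is an $(n-1)$-dimensional Lipschitz manifold near $x$'' means that, in some neighborhood of $x$ and after an invertible linear change of coordinates $\mathbb{R}^n\to\mathbb{R}^{n-1}\times\mathbb{R}$, $\Lambda_x$ is the graph of a Lipschitz function $f:\mathbb{R}^{n-1}\to\mathbb{R}$. *)

(* Defs.v *)
From HB Require Import structures.
From mathcomp Require Import all_boot all_order all_algebra.
From mathcomp Require Import all_classical all_reals all_analysis.

Set Implicit Arguments.
Unset Strict Implicit.
Unset Printing Implicit Defensive.

Import Order.TTheory GRing.Theory Num.Theory.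
Import numFieldNormedType.Exports.

Local Open Scope classical_set_scope.
Local Open Scope ring_scope.

(* R^n is 'rV[R]_n. The library's topology on 'rV[R]_n is that of the sup norm,
   hence the usual one; the Euclidean norm is enorm. *)

Definition dotp (R : realType) (n : nat) (p q : 'rV[R]_n) : R :=
  (p *m q^T) 0 0.

Definition enorm (R : realType) (n : nat) (p : 'rV[R]_n) : R :=
  Num.sqrt (dotp p p).

Definition Zn_periodic (R : realType) (n : nat) (T : Type)
    (f : 'rV[R]_n -> T) : Prop :=
  forall (x : 'rV[R]_n) (z : 'rV[int]_n), f (x + map_mx intr z) = f x.

(* At order k.+1, continuity of f follows from that of its partial
   derivatives. *)
Fixpoint Ck (R : realType) (n k : nat) (f : 'rV[R]_n -> R) : Prop :=
  if k is k'.+1 then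
    forall i : 'I_n, (forall x, derivable f x (delta_mx 0 i)) /\
                     Ck k' (fun x => 'D_(delta_mx 0 i) f x)
  else continuous f.

Definition smooth (R : realType) (n : nat) (f : 'rV[R]_n -> R) : Prop :=
  forall k, Ck k f.

(* p *m A x is the row vector A(x)p, because A(x) is symmetric. *)
Definition hamiltonian (R : realType) (n : nat) (A : 'rV[R]_n -> 'M[R]_n)
    (V : 'rV[R]_n -> R) (x p : 'rV[R]_n) : R :=
  2^-1 * dotp (p *m A x) p + V x.

Definition grad_p (R : realType) (n : nat) (H : 'rV[R]_n -> 'rV[R]_n -> R)
    (x p : 'rV[R]_n) : 'rV[R]_n :=
  \row_i 'D_(delta_mx 0 i) (H x) p.

Definition superdiff (R : realType) (n : nat) (w : 'rV[R]_n -> R)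
    (x : 'rV[R]_n) : set 'rV[R]_n :=
  [set p | (limf_esup
     (fun y => ((w y - w x - dotp p (y - x)) / enorm (y - x))%:E) x^' <= 0)%E].

Definition subdiff (R : realType) (n : nat) (w : 'rV[R]_n -> R)
    (x : 'rV[R]_n) : set 'rV[R]_n :=
  [set p | (0 <= limf_einf
     (fun y => ((w y - w x - dotp p (y - x)) / enorm (y - x))%:E) x^')%E].

(* u solves H(x, c + Du(x)) = a in the viscosity sense. *)
Definition viscosity_solution (R : realType) (n : nat)
    (H : 'rV[R]_n -> 'rV[R]_n -> R) (c : 'rV[R]_n) (a : R)
    (u : 'rV[R]_n -> R) : Prop :=
  continuous u /\
  forall x, (forall p, superdiff u x p -> H x (c + p) <= a) /\
            (forall p, subdiff u x p -> a <= H x (c + p)).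

(* Such a number exists and is unique, so that get selects it. *)
Definition mather_alpha (R : realType) (n : nat)
    (H : 'rV[R]_n -> 'rV[R]_n -> R) (c : 'rV[R]_n) : R :=
  get [set a : R | exists u : 'rV[R]_n -> R,
                     Zn_periodic u /\ viscosity_solution H c a u].

Definition singular_set (R : realType) (n : nat) (v : 'rV[R]_n -> R) :
    set 'rV[R]_n :=
  [set x | ~ exists p, superdiff v x = [set p]].

Definition closed_convex_hull (R : realType) (n : nat) (S : set 'rV[R]_n) :
    set 'rV[R]_n :=
  smallest [set K : set 'rV[R]_n | closed K /\ convex_set K] S.

(* An arc on [0, tau] is represented by a function on R whose values outside
   [0, tau] are irrelevant (the endpoints are negligible for the inclusion). *)
Definition generalized_characteristic (R : realType) (n : nat)
    (H : 'rV[R]_n -> 'rV[R]_n -> R) (v : 'rV[R]_n -> R) (tau : R)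
    (X : R -> 'rV[R]_n) : Prop :=
  [/\ 0 < tau,
      exists k : R, k.-lipschitz_(`[0, tau]) X &
      {ae (@lebesgue_measure R), forall s, s \in `[0, tau] ->
         derivable X s 1 /\
         closed_convex_hull (grad_p H (X s) @` superdiff v (X s))
           (derive1 X s)}].

Definition singular_characteristic (R : realType) (n : nat)
    (H : 'rV[R]_n -> 'rV[R]_n -> R) (v : 'rV[R]_n -> R) (tau : R)
    (X : R -> 'rV[R]_n) : Prop :=
  generalized_characteristic H v tau X /\
  forall s, s \in `[0, tau] -> singular_set v (X s).

Definition right_derivative_neq0 (R : realType) (n : nat)
    (X : R -> 'rV[R]_n) (s : R) : Prop :=
  exists2 d : 'rV[R]_n,
    (t - s)^-1 *: (X t - X s) @[t --> s^'+] --> d & d != 0.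

(* Near x, L is the graph of a Lipschitz function R^(n-1) -> R after the
   linear change of coordinates Phi. *)
Definition lipschitz_hypersurface_near (R : realType) (n : nat)
    (L : set 'rV[R]_n) (x : 'rV[R]_n) : Prop :=
  exists (Phi : {linear 'rV[R]_n -> ('rV[R]_n.-1 * R^o)%type})
         (f : 'rV[R]_n.-1 -> R) (k : R),
    [/\ bijective Phi, k.-lipschitz f &
        \forall y \near x, L y <-> (Phi y).2 = f (Phi y).1].

(* Main.v *)
(** Since alpha(c) exceeds max V, the equation is a nondegenerate eikonal
    equation for a uniformly elliptic quadratic form <A(x)p, p>.

    Semiconcavity of v is obtained without calibrated curves, by doubling of
    variables: at a maximum of v x + v z - 2 v y minus a gauge of x - z and
    x + z - 2 y, strict convexity of p |-> <A(x)p, p> contradicts the sub- and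
    supersolution inequalities once the gauge is steep enough.

    (i) If x'(s) = A q with q in D+v(x(s)), then the left Dini derivative of v
    along the arc is at least <A q, q>, which is positive when x'(s) <> 0; a
    Lipschitz function with almost everywhere positive left Dini derivative is
    increasing.

    (ii) Above or below the level hypersurface v > v(x) on a cone with apex x;
    the supersolution property makes v grow linearly in that cone, so 0 is not
    in D+v(x).  The implicit Euler scheme x_{k+1} = x_k + h A(x_k) p_{k+1},
    p_{k+1} in D+v(x_{k+1}), almost decreases H(x_k, p_k), by monotonicity of
    D+v.  Starting from p_0 with H(x, p_0) < alpha(c), which exists because x
    is singular, every limit arc X carries elements of D+v(X(t)) of energy below
    alpha(c) for a short time, hence X(t) is singular.  An energy
    estimate shows that X has at every time the right derivative A q, where q
    minimizes <A q, q> on D+v(X(t)). *)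

Require Import Defs.
From HB Require Import structures.
From mathcomp Require Import all_boot all_order all_algebra.
From mathcomp Require Import all_classical all_reals all_analysis.
From mathcomp Require Import measurable_realfun.
From mathcomp Require Import ring lra.

Set Implicit Arguments.
Unset Strict Implicit.
Unset Printing Implicit Defensive.

Import Order.TTheory GRing.Theory Num.Theory.
Import numFieldNormedType.Exports.

Local Open Scope classical_set_scope.
Local Open Scope ring_scope.

(** * Euclidean structure on row vectors *)

(** Once semiconcavity is known, the work rests on one global inequality, v y <= v x + <p, y - x> +
    C |y - x|^2 for p in D+v(x). It bounds v from above only, so an increment of v along an arc is
    bounded below by testing, at the later point, the value at the earlier one. This is why the
    scheme is implicit and why (i) looks at left increments.

    The sum of h <A p, p> over the steps of the scheme need not converge to an expression in the
    limit arc. The gain of v is therefore recorded, for every fixed q, through 2 <q, dX> - dt <A q,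
    q>, which is linear in the displacement dX and passes to the limit. Choosing q afterwards from
    the mean velocity recovers the quadratic term. A second inequality, for the minimizing q, says
    that the arc advances in direction q at least at the minimal rate. The two combine into a
    perfect square, which forces the mean velocity towards A q.

    A characteristic must have a two-sided derivative almost everywhere, whereas the flow provides
    right derivatives everywhere. The gap closes because each coordinate is the primitive of its
    bounded right derivative. *)

Ltac nonneg := repeat first
  [ assumption | exact: sqr_ge0 | exact: normr_ge0 | exact: ler0n | exact: ltW
  | apply: addr_ge0 | apply: mulr_ge0 | apply: divr_ge0 | done ].

Section Vectors.
Context {R : realType} {n : nat}.
Implicit Types (p q x y : 'rV[R]_n) (M : 'M[R]_n).

Lemma dotpE p q : dotp p q = \sum_i p 0 i * q 0 i.
Proof. by rewrite /dotp mxE; apply: eq_bigr => i _; rewrite mxE. Qed.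

Lemma dotpC p q : dotp p q = dotp q p.
Proof. by rewrite !dotpE; apply: eq_bigr => i _; rewrite mulrC. Qed.

Lemma dotpDl p q x : dotp (p + q) x = dotp p x + dotp q x.
Proof. by rewrite /dotp mulmxDl mxE. Qed.

Lemma dotpDr p q x : dotp x (p + q) = dotp x p + dotp x q.
Proof. by rewrite !(dotpC x) dotpDl. Qed.

Lemma dotpZl k p x : dotp (k *: p) x = k * dotp p x.
Proof. by rewrite /dotp -scalemxAl mxE. Qed.

Lemma dotpZr k p x : dotp x (k *: p) = k * dotp x p.
Proof. by rewrite !(dotpC x) dotpZl. Qed.

Lemma dotpNl p x : dotp (- p) x = - dotp p x.
Proof. by rewrite -scaleN1r dotpZl mulN1r. Qed.

Lemma dotpNr p x : dotp x (- p) = - dotp x p.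
Proof. by rewrite !(dotpC x) dotpNl. Qed.

Lemma dotp0l x : dotp 0 x = 0.
Proof. by rewrite -(scale0r 0) dotpZl mul0r. Qed.

Lemma dotp0r x : dotp x 0 = 0.
Proof. by rewrite dotpC dotp0l. Qed.

Definition dotpL := (dotpDl, dotpDr, dotpZl, dotpZr, dotpNl, dotpNr).

Lemma dotp_mulmxl M p q : dotp (p *m M) q = dotp p (q *m M^T).
Proof. by rewrite /dotp trmx_mul trmxK mulmxA. Qed.

Lemma ler_coord p i : `|p 0 i| <= `|p|.
Proof.
rewrite [leRHS]/Num.norm /= mx_normrE.
by apply/bigmax_geP; right => /=; exists (0, i).
Qed.

Lemma norm_le_coord p r : 0 <= r -> (forall i, `|p 0 i| <= r) -> `|p| <= r.
Proof.
move=> r0 H; rewrite [leLHS]/Num.norm /= mx_normrE.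
by apply/bigmax_leP; split=> // -[i j] _ /=; rewrite (ord1 i).
Qed.

Lemma ler_mx_coord M i j : `|M i j| <= `|M|.
Proof.
rewrite [leRHS]/Num.norm /= mx_normrE.
by apply/bigmax_geP; right => /=; exists (i, j).
Qed.

Lemma mx_norm_le_coord M r : 0 <= r -> (forall i j, `|M i j| <= r) -> `|M| <= r.
Proof.
move=> r0 H; rewrite [leLHS]/Num.norm /= mx_normrE.
by apply/bigmax_leP; split=> // -[i j] _ /=.
Qed.

Lemma ler_dotp p q : `|dotp p q| <= n%:R * `|p| * `|q|.
Proof.
rewrite dotpE; apply: le_trans (ler_norm_sum _ _ _) _.
rewrite -mulrA mulr_natl -[X in _ *+ X]card_ord -sumr_const.
by apply: ler_sum => i _; rewrite normrM ler_pM// ler_coord.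
Qed.

Lemma ler_dotp_norm p q : dotp p q <= n%:R * `|p| * `|q|.
Proof. exact: le_trans (ler_norm _) (ler_dotp _ _). Qed.

Lemma sqr_norm_le_dotp p : `|p| ^+ 2 <= dotp p p.
Proof.
have dp0 : 0 <= dotp p p.
  by rewrite dotpE; apply: sumr_ge0 => i _; rewrite -expr2 sqr_ge0.
rewrite -[leRHS]sqr_sqrtr// lerXn2r ?nnegrE ?sqrtr_ge0//.
apply: norm_le_coord => [|i]; first exact: sqrtr_ge0.
rewrite -(@ler_pXn2r _ 2) ?nnegrE ?sqrtr_ge0// sqr_sqrtr//.
rewrite real_normK ?num_real// dotpE (bigD1 i)//= -expr2 lerDl.
by apply: sumr_ge0 => j _; rewrite -expr2 sqr_ge0.
Qed.

Lemma dotp_ge0 p : 0 <= dotp p p.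
Proof. exact: le_trans (sqr_ge0 _) (sqr_norm_le_dotp _). Qed.

Lemma dotp_eq0 p : dotp p p = 0 -> p = 0.
Proof.
move=> p0; have := sqr_norm_le_dotp p; rewrite p0 => h.
by apply/eqP; rewrite -normr_eq0 -sqrf_eq0 eq_le h sqr_ge0.
Qed.

Lemma dotp_le_sqr_norm p : dotp p p <= n%:R * `|p| ^+ 2.
Proof. by rewrite expr2 mulrA ler_dotp_norm. Qed.

Lemma enorm_ge0 p : 0 <= enorm p.
Proof. exact: sqrtr_ge0. Qed.

Lemma enorm_sqr p : enorm p ^+ 2 = dotp p p.
Proof. by rewrite sqr_sqrtr// dotp_ge0. Qed.

Lemma norm_le_enorm p : `|p| <= enorm p.
Proof.
by rewrite -(@ler_pXn2r _ 2) ?nnegrE ?enorm_ge0// enorm_sqr sqr_norm_le_dotp.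
Qed.

Lemma enorm_le_norm p : enorm p <= n%:R * `|p|.
Proof.
rewrite -(@ler_pXn2r _ 2) ?nnegrE ?enorm_ge0 ?mulr_ge0// enorm_sqr.
apply: le_trans (dotp_le_sqr_norm _) _; rewrite exprMn ler_wpM2r ?sqr_ge0//.
by rewrite -natrX ler_nat; case: (n) => // m; rewrite expnS expn1 leq_pmulr.
Qed.

Lemma ler_norm_mulmx p M : `|p *m M| <= n%:R * `|p| * `|M|.
Proof.
apply: norm_le_coord => [|i]; first by rewrite !mulr_ge0.
rewrite mxE; apply: le_trans (ler_norm_sum _ _ _) _.
rewrite -mulrA mulr_natl -[X in _ *+ X]card_ord -sumr_const.
by apply: ler_sum => j _; rewrite normrM ler_pM// ?ler_coord ?ler_mx_coord.
Qed.

Lemma sqr_dotp_le p q : dotp p q ^+ 2 <= dotp p p * dotp q q.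
Proof.
have [->|q0] := eqVneq q 0; first by rewrite !dotp0r expr0n/= mulr0.
have qq : 0 < dotp q q.
  rewrite lt_neqAle dotp_ge0 andbT eq_sym; apply/eqP => /dotp_eq0 q1.
  by rewrite q1 eqxx in q0.
have := dotp_ge0 (dotp q q *: p - dotp p q *: q).
rewrite !dotpL (dotpC q p) => h.
rewrite -subr_ge0 -(pmulr_rge0 _ qq).
by move: h; congr (0 <= _); ring.
Qed.

Lemma dotp_le_enorm p q : dotp p q <= enorm p * enorm q.
Proof.
apply: le_trans (ler_norm _) _.
rewrite -(@ler_pXn2r _ 2) ?nnegrE ?mulr_ge0 ?enorm_ge0//.
by rewrite real_normK ?num_real// exprMn !enorm_sqr sqr_dotp_le.
Qed.

Lemma near_norm x (P : 'rV[R]_n -> Prop) :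
  (\forall y \near x, P y) <->
  exists2 e, 0 < e & forall y, `|y - x| < e -> P y.
Proof.
split.
- move=> /nbhs_ballP[e /= e0 He]; exists e => // y yx; apply: He.
  by rewrite mx_norm_ball /ball_ /= distrC.
- move=> [e e0 He]; apply/nbhs_ballP; exists e => //= y yx; apply: He.
  by move: yx; rewrite mx_norm_ball /ball_ /= distrC.
Qed.

End Vectors.

(** * One-sided differentials and compactness in row vectors *)

Section Semidifferentials.
Context {R : realType} {n : nat}.
Implicit Types (p q x y : 'rV[R]_n) (w : 'rV[R]_n -> R).

(** The sup norm and the Euclidean norm differ by a factor at most n, which e absorbs ([n.+1] keeps
    the quotient meaningful for n = 0). The centre may be included because both sides vanish
    there. *)
Lemma superdiffP w x p :
  superdiff w x p <->
  forall e, 0 < e ->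
    \forall y \near x, w y - w x - dotp p (y - x) <= e * `|y - x|.
Proof.
have nz y : y != x -> 0 < enorm (y - x).
  by move=> yx; apply: lt_le_trans (norm_le_enorm _); rewrite normr_gt0 subr_eq0.
split=> [Hs e e0 | H].
- have e1 : 0 < e / n.+1%:R by rewrite divr_gt0.
  have /ereal_inf_lt[_ [W Wx <-] /= supW] :
      (limf_esup (fun y => ((w y - w x - dotp p (y - x)) / enorm (y - x))%:E)
        x^' < (e / n.+1%:R)%:E)%E by exact: le_lt_trans Hs _.
  move/near_norm : Wx => [d d0 Hd]; apply/near_norm; exists d => // y yd.
  have [->|yx] := eqVneq y x; first by rewrite !subrr dotp0r normr0 subrr mulr0.
  have : (((w y - w x - dotp p (y - x)) / enorm (y - x))%:E
          <= (e / n.+1%:R)%:E)%E.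
    apply: le_trans (ltW supW); apply: ereal_sup_ubound.
    by exists y => //; apply: Hd.
  rewrite lee_fin ler_pdivrMr ?nz// => /le_trans; apply.
  apply: le_trans (ler_wpM2l (ltW e1) (enorm_le_norm _)) _.
  rewrite mulrA ler_wpM2r// -mulrA ler_piMr ?(ltW e0)//.
  by rewrite mulrC ler_pdivrMr// mul1r ler_nat.
- apply/lee_addgt0Pr => e e0; rewrite add0e.
  have /near_norm[d d0 Hd] := H e e0.
  apply: (@le_trans _ _ (ereal_sup
    ((fun y => ((w y - w x - dotp p (y - x)) / enorm (y - x))%:E) @`
     [set y | `|y - x| < d /\ y != x]))).
    apply: ereal_inf_lbound; exists [set y | `|y - x| < d /\ y != x] => //.
    by apply/near_norm; exists d => // y yd yx; split.
  apply: ge_ereal_sup => _ [y [yd yx] <-].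
  rewrite lee_fin ler_pdivrMr ?nz//.
  by apply: le_trans (Hd y yd) _; rewrite ler_wpM2l ?(ltW e0)// norm_le_enorm.
Qed.

Lemma subdiff_superdiffN w x p :
  subdiff w x p <-> superdiff (\- w) x (- p).
Proof.
rewrite /subdiff /superdiff /= /limf_einf oppe_ge0.
set f := (F in limf_esup F _); set g := (G in _ <-> (limf_esup G _ <= 0)%E : Prop).
suff -> : f = g by [].
apply/funext => y; rewrite /f /g /= dotpNl -[LHS]EFinN; congr (_%:E).
by rewrite -mulNr; congr (_ / _); rewrite /=; ring.
Qed.

Lemma subdiffP w x p :
  subdiff w x p <->
  forall e, 0 < e ->
    \forall y \near x, - (e * `|y - x|) <= w y - w x - dotp p (y - x).
Proof.
rewrite subdiff_superdiffN superdiffP; split=> H e /H;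
  apply: filterS => y; rewrite dotpNl /=; lra.
Qed.

(** The entrance to D+w used below: every test function is replaced by a quadratic polynomial
    touching from above. C may have any sign, hence [|C| + 1] in the radius. *)
Lemma superdiff_quad w x p C d : 0 < d ->
  (forall y, `|y - x| < d -> w y <= w x + dotp p (y - x) + C * `|y - x| ^+ 2) ->
  superdiff w x p.
Proof.
move=> d0 H; apply/superdiffP => e e0; apply/near_norm.
exists (Num.min d (e / (`|C| + 1))).
  by rewrite lt_min d0 divr_gt0// ltr_wpDl.
move=> y; rewrite lt_min => /andP[/H Hy]; rewrite ltr_pdivlMr ?ltr_wpDl// => ye.
have : C * `|y - x| ^+ 2 <= e * `|y - x|.
  rewrite expr2 mulrA ler_wpM2r//; apply: le_trans (ltW ye).
  by rewrite mulrC ler_wpM2l// ler_wpDr// ler_norm.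
by lra.
Qed.

Lemma subdiff_quad w x p C d : 0 < d ->
  (forall y, `|y - x| < d -> w x + dotp p (y - x) - C * `|y - x| ^+ 2 <= w y) ->
  subdiff w x p.
Proof.
move=> d0 H; apply/subdiff_superdiffN; apply: (@superdiff_quad _ _ _ C d) => //.
by move=> y /H; rewrite dotpNl/=; lra.
Qed.

Lemma superdiffD_dotp w c x p :
  superdiff (fun y => w y + dotp c y) x (c + p) <-> superdiff w x p.
Proof.
rewrite !superdiffP; split=> H e /H; apply: filterS => y;
  rewrite dotpDl !dotpL; lra.
Qed.

Lemma subdiffD_dotp w c x p :
  subdiff (fun y => w y + dotp c y) x (c + p) <-> subdiff w x p.
Proof.
rewrite !subdiffP; split=> H e /H; apply: filterS => y;
  rewrite dotpDl !dotpL; lra.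
Qed.

Lemma compact_norm_le (r : R) : compact [set p : 'rV[R]_n | `|p| <= r].
Proof.
apply: bounded_closed_compact.
  by exists r; split; [exact: num_real|move=> t rt p /le_trans; apply; exact: ltW].
apply: (@preimage_closed _ _ (fun p : 'rV[R]_n => `|p|) [set s | s <= r]).
  by move=> z _; exact: norm_continuous.
exact: closed_le.
Qed.

Lemma lipschitz_rV_continuous w (L : R) : 0 <= L ->
  (forall x y, `|w x - w y| <= L * `|x - y|) -> continuous w.
Proof.
move=> L0 wL y; apply/(@cvgrPdist_le _ _ _ _ (nbhs_filter y)) => /= e e0.
apply/near_norm; have L1 : 0 < L + 1 by rewrite ltr_wpDl.
exists (e / (L + 1)); first by rewrite divr_gt0.
move=> z; rewrite ltr_pdivlMr// => ze; rewrite distrC; apply: le_trans (wL _ _) _.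
by have := normr_ge0 (z - y); lra.
Qed.

Lemma bounded_seq_cluster (u : nat -> 'rV[R]_n) M :
  (forall k, `|u k| <= M) ->
  exists p, forall e N, 0 < e -> exists2 k, (N <= k)%N & `|u k - p| < e.
Proof.
move=> uM; pose B := [set p : 'rV[R]_n | `|p| <= M].
have cB : compact B by exact: compact_norm_le.
have [|p [_ cp]] := @cB (u @ \oo) _; first by exists 0%N => // k _; exact: uM.
exists p => e N e0.
have [||_ [[k Nk <-] /= kp]] := cp (u @` [set k | (N <= k)%N]) [set q | `|q - p| < e].
- by exists N => // k Nk; exists k.
- by apply/near_norm; exists e.
- by exists k.
Qed.

Lemma coercive_max (f : 'rV[R]_n -> R) r x0 : continuous f ->
  (forall y, r < `|y - x0| -> f y <= f x0) ->
  exists x, forall y, f y <= f x.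
Proof.
move=> cf fr; pose B := [set p : 'rV[R]_n | `|p| <= `|r| + `|x0|].
have cB : compact B by exact: compact_norm_le.
have Bx0 : B x0 by rewrite /B /= lerDr.
have [||x _ xM] := @EVT_max_rV R n f B _ cB; first by exists x0.
  by apply: continuous_subspaceT.
exists x => y; have [By|/negP yB] := pselect (B y).
  by apply: xM; rewrite inE.
apply: (le_trans (fr y _)); last by apply: xM; rewrite inE.
move: yB; rewrite /B/= -ltNge => yB.
have := ler_normB y x0; have := ler_norm r; have := lerB_normD y (- x0).
by rewrite normrN; lra.
Qed.

End Semidifferentials.

(** * Periodic functions *)

Section Regularity.
Context {R : realType} {n : nat}.
Implicit Types (p q x y : 'rV[R]_n) (f : 'rV[R]_n -> R).

Lemma is_derive_line f s e t : derivable f (s + t *: e) e ->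
  is_derive t 1 (fun t : R => f (s + t *: e)) ('D_e f (s + t *: e)).
Proof.
move=> df.
have E : (fun h : R => h^-1 *: ((fun t : R => f (s + t *: e)) (h *: 1 + t)
            - f (s + t *: e))) =
         (fun h : R => h^-1 *: (f (h *: e + (s + t *: e)) - f (s + t *: e))).
  apply/funext => h; rewrite [h *: 1]mulr1 scalerDl.
  by rewrite (addrCA s (h *: e)).
by constructor; rewrite /derivable /derive /= E.
Qed.

Lemma line_mvt f s e h : (forall x, derivable f x e) ->
  exists2 t : R, `|t| <= `|h| & f (s + h *: e) - f s = h * 'D_e f (s + t *: e).
Proof.
move=> df.
have dl t := is_derive_line (df (s + t *: e)).
have cl : continuous (fun t : R => f (s + t *: e)).
  by move=> t; apply/differentiable_continuous/derivable1_diffP; have [] := dl t.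
have [h0|h0] := leP 0 h.
- have [|t] := MVT_segment h0 (fun t _ => dl t); first exact: continuous_subspaceT.
  rewrite in_itv/= => /andP[t0 th] /= E; exists t; first by rewrite !ger0_norm.
  by move: E; rewrite scale0r addr0 subr0 mulrC.
- have [|t] := MVT_segment (ltW h0) (fun t _ => dl t); first exact: continuous_subspaceT.
  rewrite in_itv/= => /andP[ht t0] /= E; exists t; first by rewrite !ler0_norm ?lerN2 ?(ltW h0).
  move: E; rewrite scale0r addr0 sub0r => E.
  by rewrite -opprB E; ring.
Qed.

(** The points x and x + y are joined by a path parallel to the axes; the one-variable mean value
    theorem on each edge involves a single partial derivative. *)
Lemma coord_mvt f x y : (forall i x, derivable f x (delta_mx 0 i)) ->
  exists2 z : 'I_n -> 'rV[R]_n, (forall i, `|z i - x| <= `|y|) &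
    f (x + y) - f x = \sum_i y 0 i * 'D_(delta_mx 0 i) f (z i).
Proof.
move=> df.
(* The k-th vertex agrees with x + y in the first k coordinates and with x in the others. *)
pose s (k : nat) : 'rV[R]_n := x + \row_i (if (i < k)%N then y 0 i else 0).
have sS (i : 'I_n) : s i.+1 = s i + y 0 i *: delta_mx 0 i.
  rewrite /s -addrA; congr (_ + _); apply/rowP => j; rewrite !mxE /=.
  rewrite ltnS leq_eqVlt; have [->|ij] /= := eqVneq j i.
    by rewrite eqxx/= ltnn add0r mulr1.
  by rewrite (inj_eq val_inj) (negbTE ij)/= mulr0 addr0.
have /fin_all_exists2[t tH tE] : forall i : 'I_n, exists2 t : R, `|t| <= `|y 0 i| &
    f (s i + y 0 i *: delta_mx 0 i) - f (s i) =
    y 0 i * 'D_(delta_mx 0 i) f (s i + t *: delta_mx 0 i).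
  by move=> i; apply: line_mvt; exact: df.
exists (fun i : 'I_n => s i + t i *: delta_mx 0 i) => [i|].
  rewrite /s addrC !addrA addNr add0r.
  apply: norm_le_coord => // j; rewrite !mxE /=.
  case: ifPn => [ji|_].
    have /negbTE -> : j != i by apply: contraTneq ji => ->; rewrite ltnn.
    by rewrite mulr0 addr0 ler_coord.
  rewrite add0r; case: (eqVneq j i) => [_|_]; last by rewrite mulr0 normr0.
  by rewrite mulr1 (le_trans (tH i))// ler_coord.
under eq_bigr do rewrite -tE -sS.
rewrite -(big_mkord xpredT (fun i => f (s i.+1) - f (s i))) telescope_sumr//.
congr (f _ - f _); rewrite /s; last first.
  by rewrite -[LHS]addr0; congr (_ + _); apply/rowP => j; rewrite !mxE.
by congr (_ + _); apply/rowP => j; rewrite !mxE ltn_ord.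
Qed.

Lemma lipschitz_of_partials f M : 0 <= M ->
  (forall i x, derivable f x (delta_mx 0 i)) ->
  (forall i x, `|'D_(delta_mx 0 i) f x| <= M) ->
  forall x y, `|f x - f y| <= n%:R * M * `|x - y|.
Proof.
move=> M0 df fM x y; have [z _] := coord_mvt y (x - y) df.
rewrite [y + _]addrC subrK => ->; apply: le_trans (ler_norm_sum _ _ _) _.
rewrite -mulrA mulr_natl -[X in _ *+ X]card_ord -sumr_const.
by apply: ler_sum => i _; rewrite normrM mulrC ler_pM// ler_coord.
Qed.

(** The mean value formula for y and for -y evaluates the partial derivatives at points within |y|
    of x, hence at most 2 |y| apart; this is the 2 in the constant. *)
Lemma second_difference_bound f M : 0 <= M ->
  (forall i x, derivable f x (delta_mx 0 i)) ->
  (forall i x y, `|'D_(delta_mx 0 i) f x - 'D_(delta_mx 0 i) f y| <= M * `|x - y|) ->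
  forall x y, `|f (x + y) + f (x - y) - 2 * f x| <= n%:R * (2 * M) * `|y| ^+ 2.
Proof.
move=> M0 df fM x y; have [z zx E] := coord_mvt x y df.
have [z' zx'] := coord_mvt x (- y) df; rewrite normrN in zx' * => E'.
have -> : f (x + y) + f (x - y) - 2 * f x =
  \sum_i y 0 i * ('D_(delta_mx 0 i) f (z i) - 'D_(delta_mx 0 i) f (z' i)).
  under eq_bigr do rewrite mulrBr.
  rewrite sumrB -E; have -> : f (x + y) + f (x - y) - 2 * f x =
    (f (x + y) - f x) + (f (x - y) - f x) by ring.
  rewrite E' -sumrN; congr (_ + _); apply: eq_bigr => i _.
  by rewrite !mxE mulNr.
apply: le_trans (ler_norm_sum _ _ _) _.
rewrite -mulrA mulr_natl -[X in _ *+ X]card_ord -sumr_const.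
apply: ler_sum => i _; rewrite normrM.
apply: (@le_trans _ _ (`|y| * (M * (2 * `|y|)))); last by rewrite expr2; lra.
rewrite ler_pM ?ler_coord//; apply: le_trans (fM _ _ _) _.
rewrite ler_wpM2l//; have := ler_normB (z i - x) (z' i - x).
have -> : z i - x - (z' i - x) = z i - z' i by rewrite opprB addrA subrK.
by have := zx i; have := zx' i; lra.
Qed.

Definition unit_cube : set 'rV[R]_n := [set y | forall i, y 0 i \in `[0, 1]].

Lemma compact_unit_cube : compact unit_cube.
Proof.
have := @rV_compact _ n (fun=> [set` `[(0 : R), 1]]) (fun=> @segment_compact _ 0 1).
by congr compact; apply/seteqP; split => y H i; have := H i.
Qed.

Lemma unit_cube_shift x : exists z : 'rV[int]_n, unit_cube (x + map_mx intr z).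
Proof.
exists (\row_i (- Num.floor (x 0 i))) => i; rewrite in_itv/= !mxE rmorphN/=.
have := floor_le_tmp (x 0 i); have := lt_succ_floor (x 0 i).
by rewrite rmorphD/=; lra.
Qed.

Lemma periodic_bounded f : continuous f -> Zn_periodic f ->
  exists2 M, 0 < M & forall x, `|f x| <= M.
Proof.
move=> cf pf.
have [M [_ HM]] : bounded_set (f @` unit_cube).
  by apply/compact_bounded/continuous_compact;
    [exact: continuous_subspaceT|exact: compact_unit_cube].
exists (`|M| + 1) => [|x]; first by rewrite ltr_wpDl.
have [z xz] := unit_cube_shift x.
have MM : M < `|M| + 1 by apply: le_lt_trans (ler_norm _) _; rewrite ltrDl.
rewrite -(pf x z); exact: (HM _ MM _ (imageP f xz)).
Qed.

Lemma periodic_derive f e : Zn_periodic f -> Zn_periodic (fun x => 'D_e f x).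
Proof.
move=> pf x z; rewrite /derive.
have -> // : (fun h : R => h^-1 *: ((f \o shift (x + map_mx intr z)) (h *: e)
    - f (x + map_mx intr z))) =
  (fun h : R => h^-1 *: ((f \o shift x) (h *: e) - f x)).
by apply/funext => h; rewrite /= addrA !pf.
Qed.

(** Unfolding [Ck] at orders 0, 1 and 2 makes f and its first and second partial derivatives
    continuous. They are periodic, so compactness of the unit cube bounds them. *)
Lemma smooth_periodic_bounds f : smooth f -> Zn_periodic f ->
  exists2 M, 0 < M & [/\ forall x, `|f x| <= M,
    forall x y, `|f x - f y| <= M * `|x - y| &
    forall x y, `|f (x + y) + f (x - y) - 2 * f x| <= M * `|y| ^+ 2].
Proof.
move=> sf pf; have [M0 M0p fM] := periodic_bounded (sf 0%N) pf.
pose D i := fun x => 'D_(delta_mx 0 i) f x.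
have df i x : derivable f x (delta_mx 0 i) by have [] := sf 1%N i.
have /fin_all_exists2[M1 M1p fM1] : forall i, exists2 M, 0 < M &
    forall x, `|D i x| <= M.
  move=> i; apply: periodic_bounded; last exact: periodic_derive.
  by have [_] := sf 1%N i.
have ddf i j x : derivable (D i) x (delta_mx 0 j).
  by have [_ /(_ j)[]] := sf 2%N i.
have /fin_all_exists2[M2 M2p fM2] : forall ij : 'I_n * 'I_n, exists2 M, 0 < M &
    forall x, `|'D_(delta_mx 0 ij.2) (D ij.1) x| <= M.
  move=> [i j] /=; apply: periodic_bounded; last exact/periodic_derive/periodic_derive.
  by have [_ /(_ j)[]] := sf 2%N i.
pose N1 := \sum_i M1 i; pose N2 := \sum_ij M2 ij.
have N10 : 0 <= N1 by apply: sumr_ge0 => i _; exact: ltW.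
have N20 : 0 <= N2 by apply: sumr_ge0 => i _; exact: ltW.
have DN1 i x : `|D i x| <= N1.
  apply: le_trans (fM1 i x) _; rewrite /N1 (bigD1 i)//= lerDl.
  by apply: sumr_ge0 => j _; exact: ltW.
have DN2 i j x : `|'D_(delta_mx 0 j) (D i) x| <= N2.
  apply: le_trans (fM2 (i, j) x) _; rewrite /N2 (bigD1 (i, j))//= lerDl.
  by apply: sumr_ge0 => k _; exact: ltW.
have L1 := lipschitz_of_partials N10 df DN1.
have L2 i := lipschitz_of_partials N20 (ddf i) (DN2 i).
have L3 := second_difference_bound (mulr_ge0 (ler0n _ n) N20) df L2.
exists (M0 + n%:R * N1 + n%:R * (2 * (n%:R * N2))).
  by rewrite ltr_wpDr// ?ltr_wpDr// !mulr_ge0.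
have P1 : 0 <= n%:R * N1 by rewrite mulr_ge0.
have P2 : 0 <= n%:R * (2 * (n%:R * N2)) by rewrite !mulr_ge0.
split=> [x|x y|x y].
- by apply: le_trans (fM x) _; lra.
- by apply: le_trans (L1 x y) _; rewrite ler_wpM2r//; lra.
- by apply: le_trans (L3 x y) _; rewrite ler_wpM2r ?sqr_ge0//; lra.
Qed.

End Regularity.

(** * Uniform ellipticity *)

Definition quad (R : realType) (n : nat) (A : 'rV[R]_n -> 'M[R]_n)
  (x p : 'rV[R]_n) : R := dotp (p *m A x) p.

Section Ellipticity.
Context {R : realType} {n : nat}.
Implicit Types (p q x y : 'rV[R]_n) (A : 'rV[R]_n -> 'M[R]_n).

Lemma continuous_dotp (T : topologicalType) (f g : T -> 'rV[R]_n) :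
  continuous f -> continuous g -> continuous (fun t => dotp (f t) (g t)).
Proof.
move=> cf cg; under eq_fun do rewrite dotpE.
apply: (continuous_big add_continuous) => i _ t; apply: cvgM.
  exact: (cvg_comp _ _ (cf t) (@coord_continuous _ _ _ 0 i _)).
exact: (cvg_comp _ _ (cg t) (@coord_continuous _ _ _ 0 i _)).
Qed.

Lemma continuous_enorm : continuous (@enorm R n).
Proof.
move=> x; apply: (@continuous_comp _ _ _ (fun p : 'rV[R]_n => dotp p p) Num.sqrt).
  by apply: continuous_dotp => t; exact: cvg_id.
exact: sqrt_continuous.
Qed.

(** The form attains a positive minimum on the unit cube times the unit sphere of the sup norm,
    which is nonempty because n > 0. Periodicity in x and homogeneity in p extend the bound. *)
Lemma quad_elliptic A : (0 < n)%N ->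
  (forall i j, continuous (fun x => A x i j)) -> Zn_periodic A ->
  (forall x p, p != 0 -> 0 < quad A x p) ->
  exists2 lam, 0 < lam & forall x p, lam * `|p| ^+ 2 <= quad A x p.
Proof.
move=> n0 cA pA posA.
pose S := [set p : 'rV[R]_n | `|p| = 1].
have cS : compact S.
  apply: bounded_closed_compact.
    by exists 1; split; [exact: num_real|move=> r r1 p /= ->; exact: ltW].
  apply: (@preimage_closed _ _ (fun p : 'rV[R]_n => `|p|) [set 1]).
    by move=> z _; exact: norm_continuous.
  exact: closed_eq.
pose K := @unit_cube R n `*` S.
have K0 : K !=set0.
  exists (0, const_mx 1); split => /=.
    by move=> i; rewrite mxE in_itv/= lexx ler01.
  apply/eqP; rewrite eq_le; apply/andP; split.
    by apply: norm_le_coord => // i; rewrite mxE normr1.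
  have := ler_coord (const_mx 1 : 'rV[R]_n) (Ordinal n0).
  by rewrite mxE normr1.
have c2 i : continuous (fun z : 'rV[R]_n * 'rV[R]_n => z.2 0 i).
  move=> z; apply: (@continuous_comp _ _ _ snd (fun p : 'rV[R]_n => p 0 i)).
    exact: cvg_snd.
  exact: coord_continuous.
have c1 i j : continuous (fun z : 'rV[R]_n * 'rV[R]_n => A z.1 i j).
  move=> z; apply: (@continuous_comp _ _ _ fst (fun x : 'rV[R]_n => A x i j)).
    exact: cvg_fst.
  exact: cA.
have cq : continuous (fun z : 'rV[R]_n * 'rV[R]_n => quad A z.1 z.2).
  move=> z; rewrite /quad.
  under eq_fun => w do (rewrite dotpE; under eq_bigr do rewrite mxE).
  apply: (continuous_big add_continuous) => i _ {}z; apply: cvgM; last exact: c2.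
  apply: (continuous_big add_continuous) => j _ {}z; apply: cvgM.
    exact: c2.
  exact: c1.
have [[x0 p0]] := compact_EVT_min K0 (compact_setX (@compact_unit_cube R n) cS)
  (continuous_subspaceT cq).
rewrite inE => -[/= _ Sp0] Hmin.
exists (quad A x0 p0) => [|x p].
  by apply: posA; rewrite -normr_gt0 Sp0.
have [->|p1] := eqVneq p 0.
  by rewrite normr0 expr0n/= mulr0 /quad dotp0r.
have np : 0 < `|p| by rewrite normr_gt0.
have [z xz] := unit_cube_shift x.
have : quad A x0 p0 <= quad A (x + map_mx intr z) (`|p|^-1 *: p).
  apply: (Hmin (_, _)); rewrite inE; split => //=.
  by rewrite /S/= normrZ normfV normr_id mulVf ?gt_eqF.
rewrite /quad pA -scalemxAl !dotpL mulrA -invrM ?unitfE ?gt_eqF// -expr2.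
by rewrite mulrC ler_pdivlMr ?exprn_gt0.
Qed.

End Ellipticity.

(** * Lipschitz continuity and semiconcavity of solutions *)

Section LipschitzSolution.
Context {R : realType} {n : nat}.
Implicit Types (p q x y : 'rV[R]_n).

(** The right-hand side is the tangent to the square root at e^2: it replaces the Euclidean norm by
    a quadratic polynomial that touches it from above where the norm equals e. *)
Lemma enorm_le_quad p (e : R) : 0 < e -> enorm p <= (dotp p p + e ^+ 2) / (2 * e).
Proof.
move=> e0; rewrite ler_pdivlMr ?mulr_gt0// -enorm_sqr -subr_ge0.
by have := sqr_ge0 (enorm p - e); congr (_ <= _); ring.
Qed.

(** A maximum y0 of v y - L |y - x| other than x would put a vector of Euclidean length exactly L,
    along y0 - x, into D+v(y0). So the maximum is at x, which is the claim. *)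
Lemma le_of_superdiff_bound (u : 'rV[R]_n -> R) (c : 'rV[R]_n) (U L : R) :
  continuous u -> (forall x, `|u x| <= U) -> enorm c + 1 <= L ->
  (forall x p, superdiff (fun y => u y + dotp c y) x p -> dotp p p < L ^+ 2) ->
  forall x y, u y + dotp c y <= u x + dotp c x + L * enorm (y - x).
Proof.
move=> cu uU cL bd x y.
set v := fun y => u y + dotp c y.
pose f y := v y - L * enorm (y - x).
have L0 : 0 < L by have := enorm_ge0 c; lra.
have cf : continuous f.
  have cv : continuous v.
    move=> t; apply: (@continuousD _ _ _ u (dotp c)); first exact: cu.
    by apply: (@continuous_dotp _ _ _ (fun=> c) id) ; [exact: cst_continuous|move=> s; exact: cvg_id].
  have ce : continuous (fun y => L * enorm (y - x)).
    move=> t; apply: (@continuousM _ _ (fun=> L) (fun y : 'rV[R]_n => enorm (y - x))).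
      exact: cst_continuous.
    apply: (@continuous_comp _ _ _ (fun y : 'rV[R]_n => y - x) (@enorm R n)).
      by apply: (@continuousB _ _ _ id (fun=> x)) => //; exact: cst_continuous.
    exact: continuous_enorm.
  move=> t; apply: (@continuousB _ _ _ v (fun y => L * enorm (y - x))).
    exact: cv.
  exact: ce.
(* Between x and y the periodic part changes by at most 2 U, while the penalty beats the linear part
   by at least |y - x|. *)
have [|y0 Hy0] := @coercive_max _ _ f (2 * U) x cf.
  move=> {}y yU; rewrite /f /v subrr.
  have -> : enorm (0 : 'rV[R]_n) = 0 by rewrite /enorm dotp0l sqrtr0.
  have := dotp_le_enorm c (y - x); rewrite dotpDr dotpNr.
  have := norm_le_enorm (y - x); have := uU x; have := uU y; rewrite !ler_norml.
  set E := enorm (y - x) in yU *; set C := enorm c in cL *.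
  move=> /andP[_ h1] /andP[h2 _] h3 h4.
  have : 0 <= (L - C - 1) * E.
    by rewrite mulr_ge0//; [lra|exact: enorm_ge0].
  by lra.
have [E|y0x] := eqVneq y0 x.
  have := Hy0 y; rewrite E /f /v subrr.
  have -> : enorm (0 : 'rV[R]_n) = 0 by rewrite /enorm dotp0l sqrtr0.
  by lra.
have [z zE] : exists z, z = y0 - x by exists (y0 - x).
set e := enorm (y0 - x).
have e0 : 0 < e.
  by apply: lt_le_trans (norm_le_enorm _); rewrite normr_gt0 subr_eq0.
suff /bd : superdiff v y0 ((L / e) *: z).
  rewrite dotpZl dotpZr zE -enorm_sqr -/e mulrA -expr2 -exprMn divfK ?gt_eqF//.
  by rewrite ltxx.
apply: (@superdiff_quad _ _ _ _ _ (L / (2 * e) * n%:R) 1) => // {}y _.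
have := Hy0 y; rewrite /f -/e.
have := enorm_le_quad (y - x) e0.
have := dotp_le_sqr_norm (y - y0).
have -> : y - x = y - y0 + z by rewrite zE addrA subrK.
move: (y - y0) => d.
rewrite dotpZl dotpDl !dotpDr (dotpC d z) -(enorm_sqr z).
have -> : enorm z = e by rewrite zE.
set D := dotp z d; set N := `|d| => h1 h2 h3.
have P1 : L * enorm (d + z) <= L / (2 * e) * dotp d d + L / e * D + L * e.
  apply: le_trans (ler_wpM2l (ltW L0) h2) _; rewrite le_eqVlt; apply/orP; left.
  by apply/eqP; field; rewrite gt_eqF.
have P2 : L / (2 * e) * dotp d d <= L / (2 * e) * n%:R * N ^+ 2.
  rewrite -[leRHS]mulrA; apply: ler_wpM2l => //.
  by rewrite divr_ge0 ?mulr_ge0 ?ltW.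
by lra.
Qed.

End LipschitzSolution.

(** * Doubling of variables: the penalty and its test functions *)

Section Doubling.
Context {R : realType} {n : nat}.
Implicit Types (p q x y z d s h e m : 'rV[R]_n).

(** The square of the penalty, with d = x - z and s = x + z - 2 y. Its root is K |d|^2 on s = 0, the
    modulus of semiconcavity sought, and N |s| on d = 0, strong enough against the linear part of
    v. *)
Definition doubling_gauge (K N : R) d s : R :=
  K ^+ 2 * dotp d d ^+ 2 + N ^+ 2 * dotp s s.

Lemma doubling_gauge_ge0 K N d s : 0 <= doubling_gauge K N d s.
Proof. by rewrite addr_ge0// mulr_ge0 ?sqr_ge0 ?dotp_ge0. Qed.

(** The sign k = 1 describes a displacement of x and k = -1 one of z; both move s by h. The bound on
    |h| absorbs the cubic and quartic terms. *)
Lemma doubling_gauge_expand K N d s : exists2 C, 0 <= C &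
  forall h k, `|h| < 1 -> k ^+ 2 = 1 ->
    doubling_gauge K N (d + k *: h) (s + h) - doubling_gauge K N d s <=
    2 * dotp ((2 * K ^+ 2 * dotp d d * k) *: d + N ^+ 2 *: s) h + C * `|h| ^+ 2.
Proof.
(* With D = <d, d>, B = <d, h>, H = <h, h>, the four terms in parentheses bound 2 D H, 4 (k B)^2, 4
   k B H and H^2 in the expansion of (D + 2 k B + H)^2; the last summand bounds N^2 H. *)
pose C := K ^+ 2 * (2 * dotp d d * n%:R + 4 * (dotp d d * n%:R)
  + 4 * (n%:R * `|d| * n%:R) + n%:R ^+ 2) + N ^+ 2 * n%:R.
have C0 : 0 <= C.
  by have := dotp_ge0 d; rewrite /C => ?; nonneg.
exists C => // h k h1 k1.
have hh := dotp_le_sqr_norm h; have hh0 := dotp_ge0 h.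
have dh := sqr_dotp_le d h; have dh1 := ler_dotp d h.
have r1 : `|h| ^+ 2 <= 1 by rewrite expr_le1// ltW.
have dd0 := dotp_ge0 d.
rewrite /doubling_gauge !dotpDl !dotpDr !dotpZl !dotpZr (dotpC h d) (dotpC h s).
have E1 : k * (k * dotp h h) = dotp h h by rewrite mulrA -expr2 k1 mul1r.
rewrite E1.
set D := dotp d d in dh dd0 C C0 *; set H := dotp h h in hh hh0 dh E1 *.
set B := dotp d h in dh dh1 *; set r := `|h| in h1 hh dh1 r1 *.
have r0 : 0 <= r by rewrite /r.
have nB : `|B| <= n%:R * `|d|.
  by apply: le_trans dh1 _; apply: ler_piMr; [nonneg|exact: ltW].
have kB : k * B <= `|B|.
  have k1' : `|k| = 1.
    by move/eqP: k1; rewrite sqrf_eq1 => /orP[]/eqP->; rewrite ?normrN normr1.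
  by rewrite -[leRHS]mul1r -k1' -normrM ler_norm.
have HH : H ^+ 2 <= n%:R ^+ 2 * r ^+ 2.
  have : H ^+ 2 <= (n%:R * r ^+ 2) ^+ 2 by rewrite lerXn2r ?nnegrE ?mulr_ge0 ?sqr_ge0.
  rewrite exprMn => /le_trans; apply; rewrite ler_wpM2l ?sqr_ge0//.
  by rewrite -[leRHS]mulr1 expr2 ler_wpM2l ?sqr_ge0.
have T1 : 2 * D * H <= 2 * D * n%:R * r ^+ 2.
  by rewrite -[leRHS]mulrA ler_wpM2l// mulr_ge0.
have T2 : 4 * (k * B) ^+ 2 <= 4 * (D * n%:R) * r ^+ 2.
  rewrite exprMn k1 mul1r -mulrA ler_wpM2l//; apply: le_trans dh _.
  by rewrite -mulrA ler_wpM2l.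
have T3 : 4 * (k * B) * H <= 4 * (n%:R * `|d| * n%:R) * r ^+ 2.
  rewrite -!mulrA ler_wpM2l//; apply: (@le_trans _ _ (n%:R * `|d| * H)).
    by rewrite mulrA ler_wpM2r//; exact: le_trans kB nB.
  by rewrite -mulrA ler_wpM2l// ler_wpM2l.
have T4 : N ^+ 2 * H <= N ^+ 2 * n%:R * r ^+ 2.
  by rewrite -mulrA ler_wpM2l ?sqr_ge0.
have T5 : K ^+ 2 * (2 * D * H + 4 * (k * B) ^+ 2 + 4 * (k * B) * H + H ^+ 2) <=
   K ^+ 2 * ((2 * D * n%:R + 4 * (D * n%:R)
  + 4 * (n%:R * `|d| * n%:R) + n%:R ^+ 2) * r ^+ 2).
  by rewrite ler_wpM2l ?sqr_ge0//; lra.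
rewrite -subr_ge0.
move: T4 T5; rewrite -subr_ge0 => T4; rewrite -subr_ge0 => T5.
apply: le_trans (addr_ge0 T4 T5) _.
rewrite le_eqVlt; apply/orP; left; apply/eqP; rewrite /C; ring.
Qed.

End Doubling.

Section Semiconcavity.
Context {R : realType} {n : nat}.
Context (A : 'rV[R]_n -> 'M[R]_n) (V : 'rV[R]_n -> R) (lam B : R).
Context (B_ge0 : 0 <= B).
Context (A_sym : forall x, (A x)^T = A x).
Context (A_ell : forall x p, lam * `|p| ^+ 2 <= quad A x p).
Context (A_lip : forall x y, `|A x - A y| <= B * `|x - y|).
Context (A_sd : forall x y, `|A (x + y) + A (x - y) - 2 *: A x| <= B * `|y| ^+ 2).
Context (V_lip : forall x y, `|V x - V y| <= B * `|x - y|).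
Context (V_sd : forall x y, `|V (x + y) + V (x - y) - 2 * V x| <= B * `|y| ^+ 2).
Implicit Types (p q x y z d s h e m : 'rV[R]_n).

Lemma hamiltonianE x p : hamiltonian A V x p = 2^-1 * quad A x p + V x.
Proof. by []. Qed.

Lemma quadD x p q :
  quad A x (p + q) = quad A x p + 2 * dotp (p *m A x) q + quad A x q.
Proof.
rewrite /quad mulmxDl !dotpDl !dotpDr (dotpC (q *m A x)) .
by rewrite -[in dotp p _](A_sym x) -dotp_mulmxl; ring.
Qed.

Lemma quadZ k x p : quad A x (k *: p) = k ^+ 2 * quad A x p.
Proof. by rewrite /quad -scalemxAl dotpZl dotpZr expr2 mulrA. Qed.

Lemma ler_bilin (W : 'M[R]_n) p q :
  `|dotp (p *m W) q| <= n%:R ^+ 2 * `|p| * `|q| * `|W|.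
Proof.
apply: le_trans (ler_dotp _ _) _.
have := ler_norm_mulmx p W.
move/(ler_wpM2l (_ : 0 <= n%:R * `|q|)) => H.
have {}H := H (mulr_ge0 (ler0n _ _) (normr_ge0 _)).
by move: H; rewrite !expr2; lra.
Qed.

(** Adding the inequalities at x and z and subtracting twice the one at y leaves <A e, e> at x and
    z. What remains is a second difference of A and of V, and a cross term in A x - A z. *)
Lemma doubling_estimate (L a : R) x y z m e d s : 0 <= L ->
  d = x - z -> s = x + z - 2 *: y -> `|m| <= L ->
  hamiltonian A V x (m + e) <= a -> hamiltonian A V z (m - e) <= a ->
  a <= hamiltonian A V y m ->
  2 * lam * `|e| ^+ 2 <= (n%:R ^+ 2 * L ^+ 2 * B + 2 * B) * (`|d| ^+ 2 + `|s|)
     + 2 * n%:R ^+ 2 * L * B * (`|d| * `|e|).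
Proof.
move=> L0 dE sE mL; rewrite !hamiltonianE !quadD => Hx Hz Hy.
(* w is the midpoint of x and z, and h half their difference. The second difference around y is the
   one around w plus twice an increment from y to w, and 2 |w - y| = |s|. *)
have [w wE] : exists w, w = y + 2^-1 *: s by eexists.
have [h hE] : exists h, h = 2^-1 *: d by eexists.
have wyE : w - y = 2^-1 *: s by rewrite wE addrC addKr.
have xE : x = w + h.
  rewrite wE hE sE dE -addrA -scalerDr.
  have -> : x + z - 2 *: y + (x - z) = 2 *: (x - y) by apply/rowP => i; rewrite !mxE; ring.
  by rewrite scalerA mulVf// scale1r addrC subrK.
have zE : z = w - h.
  have -> : z = x - d by rewrite dE opprB addrC subrK.
  have {1}-> : d = h + h by rewrite hE -scalerDl (_ : 2^-1 + 2^-1 = 1 :> R) ?scale1r//; lra.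
  by rewrite xE opprD addrA addrK.
have hd : `|h| ^+ 2 <= `|d| ^+ 2.
  rewrite lerXn2r ?nnegrE// hE normrZ ger0_norm ?invr_ge0// ler_piMl//; lra.
have ws : 2 * `|w - y| = `|s|.
  by rewrite wyE normrZ ger0_norm ?invr_ge0// mulrA divff// mul1r.
have Bws : 2 * (B * `|w - y|) = B * `|s| by rewrite -ws; ring.
have mA : `|dotp (m *m (A x + A z - 2 *: A y)) m| <=
    n%:R ^+ 2 * L ^+ 2 * (B * (`|d| ^+ 2 + `|s|)).
  apply: le_trans (ler_bilin _ _ _) _; apply: ler_pM => //.
  - by rewrite -mulrA ler_wpM2l ?sqr_ge0// -expr2 lerXn2r ?nnegrE.
  - rewrite xE zE.
    have -> : A (w + h) + A (w - h) - 2 *: A y =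
        (A (w + h) + A (w - h) - 2 *: A w) + 2 *: (A w - A y).
      by apply/matrixP => i j; rewrite !mxE; ring.
    apply: le_trans (ler_normD _ _) _; rewrite normrZ ger0_norm//.
    have := A_sd w h; have := A_lip w y; have := ler_wpM2l B_ge0 hd.
    by move: Bws; lra.
have Vb : `|V x + V z - 2 * V y| <= B * (`|d| ^+ 2 + `|s|).
  rewrite xE zE.
  have -> : V (w + h) + V (w - h) - 2 * V y =
      (V (w + h) + V (w - h) - 2 * V w) + 2 * (V w - V y) by ring.
  apply: le_trans (ler_normD _ _) _; rewrite normrM ger0_norm//.
  have := V_sd w h; have := V_lip w y; have := ler_wpM2l B_ge0 hd.
  by move: Bws; lra.
have xz : `|dotp (m *m (A x - A z)) e| <= n%:R ^+ 2 * L * B * (`|d| * `|e|).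
  apply: le_trans (ler_bilin _ _ _) _.
  have -> : n%:R ^+ 2 * L * B * (`|d| * `|e|) = n%:R ^+ 2 * L * `|e| * (B * `|d|) by ring.
  apply: ler_pM => //; last by rewrite dE; exact: A_lip.
  by rewrite ler_wpM2r// ler_wpM2l ?sqr_ge0.
have ex := A_ell x e; have ez := A_ell z e.
move: mA xz; rewrite !mulmxDr !mulmxN -scalemxAr !dotpDl !dotpNl dotpZl !ler_norml.
have E1 : dotp (m *m A x) m = quad A x m by [].
have E2 : dotp (m *m A y) m = quad A y m by [].
have E3 : dotp (m *m A z) m = quad A z m by [].
rewrite {}E1 {}E2 {}E3 => /andP[mA1 mA2] /andP[xz1 xz2].
move: Vb; rewrite ler_norml => /andP[Vb1 Vb2].
have qN : quad A z (- e) = quad A z e by rewrite -scaleN1r quadZ sqrrN expr1n mul1r.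
move: Hz; rewrite dotpNr qN => Hz.
by move: mA1 xz1 Vb1 Hx Hz Hy ex ez; lra.
Qed.

End Semiconcavity.

Section DoublingMaximum.
Context {R : realType} {n : nat}.
Implicit Types (p q x y z d s h e m : 'rV[R]_n).

Lemma continuous_doubling_gauge (T : topologicalType) (f g : T -> 'rV[R]_n) (K N : R) :
  continuous f -> continuous g ->
  continuous (fun t => doubling_gauge K N (f t) (g t)).
Proof.
move=> cf cg t; have cff := continuous_dotp cf cf; have cgg := continuous_dotp cg cg.
apply: (@continuousD _ _ _ (fun t => K ^+ 2 * dotp (f t) (f t) ^+ 2)
  (fun t => N ^+ 2 * dotp (g t) (g t))).
  apply: (@continuousM _ _ (fun=> K ^+ 2) (fun t => dotp (f t) (f t) ^+ 2)).
    exact: cst_continuous.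
  by apply: (@continuousM _ _ (fun t => dotp (f t) (f t)) (fun t => dotp (f t) (f t))); exact: cff.
apply: (@continuousM _ _ (fun=> N ^+ 2) (fun t => dotp (g t) (g t))).
  exact: cst_continuous.
exact: cgg.
Qed.

(** In the variables (y, s, d) the doubled function is periodic in y, and it is positive only for
    bounded s and d, so a positive value can be maximized over a compact set. *)
Lemma doubling_maximum (u : 'rV[R]_n -> R) (c : 'rV[R]_n) (U K N : R) :
  let v := fun y => u y + dotp c y in
  continuous u -> Zn_periodic u -> (forall x, `|u x| <= U) ->
  1 <= K -> 1 <= N -> 2 * enorm c <= N ->
  (exists x y z, Num.sqrt (doubling_gauge K N (x - z) (x + z - 2 *: y)) <
                 v x + v z - 2 * v y) ->
  exists x0 y0 z0,
    let G x y z := v x + v z - 2 * v y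
       - Num.sqrt (doubling_gauge K N (x - z) (x + z - 2 *: y)) in
    0 < G x0 y0 z0 /\ forall x y z, G x y z <= G x0 y0 z0.
Proof.
move=> v cu pu uU K1 N1 cN [x1 [y1 [z1 H1]]].
(* For t = (y, (s, d)), [X] and [Z] recover x = y + (s + d) / 2 and z = y + (s - d) / 2. *)
pose X (t : 'rV[R]_n * ('rV[R]_n * 'rV[R]_n)) := t.1 + 2^-1 *: (t.2.1 + t.2.2).
pose Z (t : 'rV[R]_n * ('rV[R]_n * 'rV[R]_n)) := t.1 + 2^-1 *: (t.2.1 - t.2.2).
pose F t := u (X t) + u (Z t) - 2 * u t.1 + dotp c t.2.1
  - Num.sqrt (doubling_gauge K N t.2.2 t.2.1).
have c1 : continuous (fun t : 'rV[R]_n * ('rV[R]_n * 'rV[R]_n) => t.1).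
  by move=> t; exact: cvg_fst.
have c2 : continuous (fun t : 'rV[R]_n * ('rV[R]_n * 'rV[R]_n) => t.2.1).
  move=> t; apply: (@continuous_comp _ _ _ snd fst); [exact: cvg_snd|exact: cvg_fst].
have c3 : continuous (fun t : 'rV[R]_n * ('rV[R]_n * 'rV[R]_n) => t.2.2).
  move=> t; apply: (@continuous_comp _ _ _ snd snd); [exact: cvg_snd|exact: cvg_snd].
have cX : continuous X.
  move=> t; apply: (@continuousD _ _ _ fst (fun t => 2^-1 *: (t.2.1 + t.2.2))); first exact: c1.
  apply: (@continuousZ _ _ _ (fun=> 2^-1) (fun t => (t.2.1 + t.2.2))).
    exact: cst_continuous.
  by apply: (@continuousD _ _ _ (fun t => t.2.1) (fun t => t.2.2)); [exact: c2|exact: c3].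
have cZ : continuous Z.
  move=> t; apply: (@continuousD _ _ _ fst (fun t => 2^-1 *: (t.2.1 - t.2.2))); first exact: c1.
  apply: (@continuousZ _ _ _ (fun=> 2^-1) (fun t => (t.2.1 - t.2.2))).
    exact: cst_continuous.
  by apply: (@continuousB _ _ _ (fun t => t.2.1) (fun t => t.2.2)); [exact: c2|exact: c3].
have cg := continuous_doubling_gauge (K := K) (N := N) c3 c2.
have cdc := continuous_dotp (cst_continuous (x := c)) c2.
have cF : continuous F.
  move=> t; apply: (@continuousB _ _ _
    (fun t => u (X t) + u (Z t) - 2 * u t.1 + dotp c t.2.1)
    (fun t => Num.sqrt (doubling_gauge K N t.2.2 t.2.1))); last first.
    apply: (@continuous_comp _ _ _ (fun t => doubling_gauge K N t.2.2 t.2.1) Num.sqrt).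
      exact: (cg t).
    exact: sqrt_continuous.
  apply: (@continuousD _ _ _ (fun t => u (X t) + u (Z t) - 2 * u t.1) (fun t => dotp c t.2.1)).
    apply: (@continuousB _ _ _ (fun t => u (X t) + u (Z t)) (fun t => 2 * u t.1)).
      apply: (@continuousD _ _ _ (fun t => u (X t)) (fun t => u (Z t))).
        by apply: (@continuous_comp _ _ _ X u); [exact: cX|exact: cu].
      by apply: (@continuous_comp _ _ _ Z u); [exact: cZ|exact: cu].
    apply: (@continuousM _ _ (fun=> 2) (fun t => u t.1)); first exact: cst_continuous.
    by apply: (@continuous_comp _ _ _ fst u); [exact: c1|exact: cu].
  exact: (cdc t).
have FE x y z : F (y, (x + z - 2 *: y, x - z)) = v x + v z - 2 * v y
       - Num.sqrt (doubling_gauge K N (x - z) (x + z - 2 *: y)).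
  rewrite /F /X /Z /=; congr (_ - _).
  have -> : y + 2^-1 *: (x + z - 2 *: y + (x - z)) = x by apply/rowP => i; rewrite !mxE; lra.
  have -> : y + 2^-1 *: (x + z - 2 *: y - (x - z)) = z by apply/rowP => i; rewrite !mxE; lra.
  by rewrite /v !dotpDr dotpNr dotpZr; ring.
have Fper y k w : F (y + map_mx intr k, w) = F (y, w).
  have XE : X (y + map_mx intr k, w) = X (y, w) + map_mx intr k by exact: addrAC.
  have ZE : Z (y + map_mx intr k, w) = Z (y, w) + map_mx intr k by exact: addrAC.
  by rewrite /F XE ZE !pu.
(* Positivity gives sqrt g < 4 U + <c, s>, and N >= 2 |c| gives <c, s> <= sqrt g / 2; hence sqrt g
   <= 8 U. *)
have Fco t : 0 < F t -> `|t.2.1| <= 8 * U + 1 /\ `|t.2.2| <= 8 * U + 1.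
  rewrite /F; set g := doubling_gauge _ _ _ _ => Ft.
  have g0 : 0 <= g by exact: doubling_gauge_ge0.
  have := uU (X t); have := uU (Z t); have := uU t.1; rewrite !ler_norml.
  move=> /andP[u1 _] /andP[_ u2] /andP[_ u3].
  have cs : 2 * dotp c t.2.1 <= Num.sqrt g.
    apply: (@le_trans _ _ (N * enorm t.2.1)).
      apply: le_trans (ler_wpM2l (ler0n _ 2) (dotp_le_enorm _ _)) _.
      by rewrite mulrA ler_wpM2r ?enorm_ge0.
    rewrite -(@ler_pXn2r _ 2) ?nnegrE ?sqrtr_ge0 ?mulr_ge0 ?enorm_ge0//; last by lra.
    by rewrite sqr_sqrtr// exprMn enorm_sqr /g /doubling_gauge lerDr mulr_ge0 ?sqr_ge0.
  have U0 : 0 <= U by exact: le_trans (uU 0).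
  have sg : Num.sqrt g <= 8 * U by lra.
  have g8 : g <= (8 * U) ^+ 2.
    by rewrite -[leLHS]sqr_sqrtr// lerXn2r ?nnegrE ?sqrtr_ge0// mulr_ge0.
  have N2 : 1 <= N ^+ 2 by rewrite expr_ge1//; lra.
  have K2 : 1 <= K ^+ 2 by rewrite expr_ge1//; lra.
  have ss := dotp_ge0 t.2.1; have dd := dotp_ge0 t.2.2.
  have s8 : dotp t.2.1 t.2.1 <= (8 * U) ^+ 2.
    apply: le_trans g8; rewrite /g /doubling_gauge.
    have := ler_wpM2r ss N2; have := mulr_ge0 (sqr_ge0 K) (sqr_ge0 (dotp t.2.2 t.2.2)).
    by lra.
  have d8 : dotp t.2.2 t.2.2 <= 8 * U.
    rewrite -(@ler_pXn2r _ 2) ?nnegrE ?mulr_ge0//.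
    apply: le_trans g8; rewrite /g /doubling_gauge.
    have := ler_wpM2r (sqr_ge0 (dotp t.2.2 t.2.2)) K2; have := mulr_ge0 (sqr_ge0 N) ss.
    by lra.
  split.
    rewrite -(@ler_pXn2r _ 2) ?nnegrE ?addr_ge0 ?mulr_ge0//.
    apply: le_trans (sqr_norm_le_dotp _) _; apply: le_trans s8 _.
    by rewrite lerXn2r ?nnegrE ?addr_ge0 ?mulr_ge0// lerDl.
  rewrite -(@ler_pXn2r _ 2) ?nnegrE ?addr_ge0 ?mulr_ge0//.
  apply: le_trans (sqr_norm_le_dotp _) _; apply: le_trans d8 _.
  rewrite sqrrD expr1n mulr1; have := sqr_ge0 (8 * U); lra.
pose Bl := [set p : 'rV[R]_n | `|p| <= 8 * U + 1].
have cBl : compact Bl by exact: compact_norm_le.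
pose KK := @unit_cube R n `*` (Bl `*` Bl).
have inKK y w : 0 < F (y, w) -> exists k, KK (y + map_mx intr k, w).
  move=> /Fco[/= B1 B2]; have [k Hk] := unit_cube_shift y.
  by exists k; split.
have F1 : 0 < F (y1, (x1 + z1 - 2 *: y1, x1 - z1)) by rewrite FE subr_gt0.
have [k1 Hk1] := inKK _ _ F1.
have cKK : compact KK by apply: compact_setX; [exact: compact_unit_cube|exact: compact_setX].
have [||[y0 [s0 d0]] _ Hmax] := @compact_EVT_max _ _ F KK _ cKK.
- by exists (y1 + map_mx intr k1, (x1 + z1 - 2 *: y1, x1 - z1)).
- exact: continuous_subspaceT.
pose x0 := y0 + 2^-1 *: (s0 + d0); pose z0 := y0 + 2^-1 *: (s0 - d0).
have E0 : F (y0, (x0 + z0 - 2 *: y0, x0 - z0)) = F (y0, (s0, d0)).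
  have -> : x0 + z0 - 2 *: y0 = s0 by rewrite /x0 /z0; apply/rowP => i; rewrite !mxE; lra.
  by have -> : x0 - z0 = d0 by rewrite /x0 /z0; apply/rowP => i; rewrite !mxE; lra.
have F0 : 0 < F (y0, (s0, d0)).
  by apply: lt_le_trans F1 _; rewrite -(Fper _ k1); apply: Hmax; rewrite inE.
exists x0, y0, z0 => /=; rewrite -FE E0; split=> // x y z.
rewrite -FE; have [Fle|/inKK[k Hk]] := leP (F (y, (x + z - 2 *: y, x - z))) 0.
  exact: le_trans Fle (ltW F0).
by rewrite -(Fper _ k); apply: Hmax; rewrite inE.
Qed.

End DoublingMaximum.

Section Semiconcave.
Context {R : realType} {n : nat}.
Implicit Types (p q x y z d s h e m : 'rV[R]_n).

Lemma sqrt_le_quad (g e : R) : 0 < e -> 0 <= g -> Num.sqrt g <= (g + e ^+ 2) / (2 * e).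
Proof.
move=> e0 g0; rewrite ler_pdivlMr ?mulr_gt0// -[in leRHS](sqr_sqrtr g0) -subr_ge0.
by have := sqr_ge0 (Num.sqrt g - e); congr (_ <= _); ring.
Qed.

(* At a maximum of v x + v z - 2 v y - sqrt S, replacing sqrt S by its tangent
   upper bound (S / r + r) / 2, r = sqrt S0, keeps the maximum and makes the
   test functions polynomial. *)
Lemma doubling_touch (v : 'rV[R]_n -> R) (K N : R) x0 y0 z0 (r : R) d s :
  0 < r -> d = x0 - z0 -> s = x0 + z0 - 2 *: y0 -> r ^+ 2 = doubling_gauge K N d s ->
  (forall x y z, v x + v z - 2 * v y
       - Num.sqrt (doubling_gauge K N (x - z) (x + z - 2 *: y)) <=
       v x0 + v z0 - 2 * v y0 - r) ->
  let m := (N ^+ 2 / r) *: s in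
  let e := (2 * K ^+ 2 * dotp d d / r) *: d in
  [/\ superdiff v x0 (m + e), superdiff v z0 (m - e) & subdiff v y0 m].
Proof.
move=> r0 dE sE rE Hmax m e.
(* The polynomial penalty g / (2 r) has gradients m + e, m - e and - 2 m in x, z and y; the
   coefficient -2 of v y turns the last one into m. *)
have Hm x y z : v x + v z - 2 * v y <= v x0 + v z0 - 2 * v y0
    + (doubling_gauge K N (x - z) (x + z - 2 *: y) - r ^+ 2) / (2 * r).
  have := sqrt_le_quad r0 (doubling_gauge_ge0 K N (x - z) (x + z - 2 *: y)).
  have := Hmax x y z; set g := doubling_gauge _ _ _ _.
  have -> : (g - r ^+ 2) / (2 * r) = (g + r ^+ 2) / (2 * r) - r.
    by field; rewrite gt_eqF.
  by lra.
have [C C0 HC] := doubling_gauge_expand K N d s.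
have r20 : 0 < 2 * r by rewrite mulr_gt0.
split.
- apply: (@superdiff_quad _ _ _ _ _ (C / (2 * r)) 1) => // x x1.
  have := Hm x y0 z0; have := HC (x - x0) 1 x1 (expr1n _ _); rewrite scale1r.
  have -> : d + (x - x0) = x - z0 by rewrite dE; apply/rowP => i; rewrite !mxE; ring.
  have -> : s + (x - x0) = x + z0 - 2 *: y0 by rewrite sE; apply/rowP => i; rewrite !mxE; ring.
  rewrite rE; set g := doubling_gauge _ _ _ _; set g0 := doubling_gauge _ _ _ _.
  rewrite mulr1 => h1 h2; apply: le_trans (_ : v x0 + (g - g0) / (2 * r) <= _).
    by move: h2; lra.
  rewrite -[leRHS]addrA lerD2l ler_pdivrMr//; apply: le_trans h1 _.
  rewrite le_eqVlt; apply/orP; left; apply/eqP.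
  by rewrite /m /e !dotpDl !dotpZl; field; rewrite gt_eqF.
- apply: (@superdiff_quad _ _ _ _ _ (C / (2 * r)) 1) => // z z1.
  have N1 : (-1 : R) ^+ 2 = 1 by rewrite sqrrN expr1n.
  have := Hm x0 y0 z; have := HC (z - z0) (-1) z1 N1; rewrite scaleN1r.
  have -> : d - (z - z0) = x0 - z by rewrite dE; apply/rowP => i; rewrite !mxE; ring.
  have -> : s + (z - z0) = x0 + z - 2 *: y0 by rewrite sE; apply/rowP => i; rewrite !mxE; ring.
  rewrite rE; set g := doubling_gauge _ _ _ _; set g0 := doubling_gauge _ _ _ _.
  move=> h1 h2; apply: le_trans (_ : v z0 + (g - g0) / (2 * r) <= _).
    by move: h2; lra.
  rewrite -[leRHS]addrA lerD2l ler_pdivrMr//; apply: le_trans h1 _.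
  rewrite le_eqVlt; apply/orP; left; apply/eqP.
  by rewrite /m /e !dotpDl dotpNl !dotpZl; field; rewrite gt_eqF.
- apply: (@subdiff_quad _ _ _ _ _ (N ^+ 2 / r * n%:R) 1) => // y _.
  have := Hm x0 y z0; rewrite -dE.
  have -> : x0 + z0 - 2 *: y = s - 2 *: (y - y0) by rewrite sE; apply/rowP => i; rewrite !mxE; ring.
  rewrite rE /doubling_gauge; move: (y - y0) => h H.
  have hh := dotp_le_sqr_norm h.
  have {}hh : N ^+ 2 / r * dotp h h <= N ^+ 2 / r * n%:R * `|h| ^+ 2.
    by rewrite -[leRHS]mulrA ler_wpM2l// divr_ge0 ?sqr_ge0 ?ltW.
  have E : dotp (s - 2 *: h) (s - 2 *: h) = dotp s s - 4 * dotp s h + 4 * dotp h h.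
    by rewrite !dotpL (dotpC h s); ring.
  move: H; rewrite E.
  set t := (_ / (2 * r)); have -> : t = - (2 * (N ^+ 2 / r * dotp s h)) + 2 * (N ^+ 2 / r * dotp h h).
    by rewrite /t; field; rewrite gt_eqF.
  by rewrite /m dotpZl; lra.
Qed.

(** If the penalty with these K and N were exceeded, the slopes at a positive maximum would satisfy
    K |d| <= |e| and |s| <= n K |d|^2. Then the errors in [doubling_estimate] are O(|e|^2 / K),
    which ellipticity does not allow for large K. *)
Lemma semiconcave_midpoint (A : 'rV[R]_n -> 'M[R]_n) (V : 'rV[R]_n -> R)
  (lam B : R) (u : 'rV[R]_n -> R) (c : 'rV[R]_n) (a L U : R) :
  let v := fun y => u y + dotp c y in
  0 < lam -> 0 <= B -> (forall x, (A x)^T = A x) ->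
  (forall x p, lam * `|p| ^+ 2 <= quad A x p) ->
  (forall x y, `|A x - A y| <= B * `|x - y|) ->
  (forall x y, `|A (x + y) + A (x - y) - 2 *: A x| <= B * `|y| ^+ 2) ->
  (forall x y, `|V x - V y| <= B * `|x - y|) ->
  (forall x y, `|V (x + y) + V (x - y) - 2 * V x| <= B * `|y| ^+ 2) ->
  continuous u -> Zn_periodic u -> (forall x, `|u x| <= U) ->
  enorm c + 1 <= L ->
  (forall x p, superdiff v x p -> dotp p p < L ^+ 2) ->
  (forall x p, superdiff v x p -> hamiltonian A V x p <= a) ->
  (forall x p, subdiff v x p -> a <= hamiltonian A V x p) ->
  exists2 C, 0 < C & forall y h, v (y + h) + v (y - h) - 2 * v y <= C * `|h| ^+ 2.
Proof.
move=> v lam0 B0 A_sym A_ell A_lip A_sd V_lip V_sd cu pu uU cL bd sub sup.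
pose C1 := n%:R ^+ 2 * L ^+ 2 * B + 2 * B.
pose C2 := 2 * n%:R ^+ 2 * L * B.
have L1 : 1 <= L by have := enorm_ge0 c; lra.
have C10 : 0 <= C1 by rewrite /C1; nonneg.
have L0 : 0 <= L by lra.
have C20 : 0 <= C2 by rewrite /C2; nonneg.
(* Chosen so that lam K = lam + C1 (1 + n) + C2, which leaves a margin lam |e|^2 in the final
   comparison. *)
have [K KE] : exists K, K = 1 + (C1 * (1 + n%:R) + C2) / lam by eexists.
have K1 : 1 <= K by rewrite KE lerDl; apply: divr_ge0; nonneg.
(* Large enough for [doubling_maximum], and twice the bound on |m|: the s-part of the penalty then
   has at most half the size of the whole. *)
pose N := 2 * L.
(* Taking x = y + h and z = y - h gives s = 0 and d = 2 h, hence the factor 4. *)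
suff H x y z : v x + v z - 2 * v y <= Num.sqrt (doubling_gauge K N (x - z) (x + z - 2 *: y)).
  exists (4 * K * n%:R + 1) => [|y h].
    by rewrite ltr_wpDl// !mulr_ge0//; lra.
  apply: le_trans (H _ _ _) _.
  have -> : y + h - (y - h) = 2 *: h by apply/rowP => i; rewrite !mxE; ring.
  have -> : y + h + (y - h) - 2 *: y = 0 by apply/rowP => i; rewrite !mxE; ring.
  rewrite /doubling_gauge dotp0r mulr0 addr0 -exprMn sqrtr_sqr ger0_norm; last first.
    by rewrite mulr_ge0 ?dotp_ge0//; lra.
  rewrite dotpZl dotpZr.
  have h2 := sqr_ge0 `|h|; have K0 : 0 <= K by lra.
  by have := ler_wpM2l K0 (dotp_le_sqr_norm h); lra.
rewrite leNgt; apply/negP => Hgt.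
have N1 : 1 <= N by rewrite /N; lra.
have cN : 2 * enorm c <= N by rewrite /N; lra.
have [x0 [y0 [z0 /=]]] := @doubling_maximum _ n u c U K N cu pu uU K1 N1 cN
   (ex_intro _ x (ex_intro _ y (ex_intro _ z Hgt))).
rewrite -/v => -[F0 Hmax].
have [d dE] : exists d, d = x0 - z0 by eexists.
have [s sE] : exists s, s = x0 + z0 - 2 *: y0 by eexists.
rewrite -dE -sE in F0 Hmax.
have g0 := doubling_gauge_ge0 K N d s.
have [r rE] : exists r : R, r = Num.sqrt (doubling_gauge K N d s) by eexists.
have r2 : r ^+ 2 = doubling_gauge K N d s by rewrite rE sqr_sqrtr.
(* A vanishing penalty means x0 = y0 = z0, where the doubled function is 0 and not positive. *)
have r0 : 0 < r.
  rewrite lt_neqAle eq_sym {2}rE sqrtr_ge0 andbT; apply/eqP => rz.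
  move: r2; rewrite rz expr0n/= /doubling_gauge => /esym/eqP.
  rewrite paddr_eq0; first last.
  - by apply: mulr_ge0; [exact: sqr_ge0|exact: dotp_ge0].
  - by apply: mulr_ge0; exact: sqr_ge0.
  have K0 : K != 0 by rewrite gt_eqF//; lra.
  have N0 : N != 0 by rewrite gt_eqF//; lra.
  rewrite (mulf_eq0 (K ^+ 2)) (mulf_eq0 (N ^+ 2)) !sqrf_eq0 (negbTE K0) (negbTE N0)/= => /andP[/eqP/dotp_eq0 d0 /eqP/dotp_eq0 s0].
  have E1 : x0 = z0 by apply/eqP; rewrite -subr_eq0 -dE d0.
  have E2 : y0 = x0.
    move: sE; rewrite s0 -E1 => /rowP E; apply/rowP => i; move: (E i); rewrite !mxE; lra.
  by move: F0; rewrite -rE rz -E1 E2; lra.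
rewrite -rE in Hmax.
have [/=] := doubling_touch r0 dE sE r2 Hmax.
have [m mE] : exists m, m = (N ^+ 2 / r) *: s by eexists.
have [e eE] : exists e, e = (2 * K ^+ 2 * dotp d d / r) *: d by eexists.
rewrite -mE -eE => Sx Sz Sy.
(* By the parallelogram identity, the bounds on m + e and m - e control <m, m> + <e, e>. *)
have mm : dotp m m <= L ^+ 2.
  have := bd _ _ Sx; have := bd _ _ Sz; rewrite !dotpL (dotpC e m).
  by have := dotp_ge0 e; lra.
have mL : `|m| <= L.
  by rewrite -(@ler_pXn2r _ 2) ?nnegrE// (le_trans (sqr_norm_le_dotp _)).
have := doubling_estimate B0 A_sym A_ell A_lip A_sd V_lip V_sd L0 dE sE mL
  (sub _ _ Sx) (sub _ _ Sz) (sup _ _ Sy).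
rewrite -/C1 -/C2.
have dd := dotp_ge0 d; have ss := dotp_ge0 s.
(* N^2 |s|^2 <= r^2 / 4 since |m| <= L = N / 2 *)
have ss1 : 16 * L ^+ 2 * dotp s s <= r ^+ 2.
  have : (N ^+ 2 * N ^+ 2) * dotp s s <= L ^+ 2 * r ^+ 2.
    move: mm; rewrite mE dotpZl dotpZr.
    have -> : N ^+ 2 / r * (N ^+ 2 / r * dotp s s) = N ^+ 2 * N ^+ 2 * dotp s s / r ^+ 2.
      by field; rewrite gt_eqF.
    by rewrite ler_pdivrMr ?exprn_gt0.
  have -> : N ^+ 2 * N ^+ 2 * dotp s s = L ^+ 2 * (16 * L ^+ 2 * dotp s s) by rewrite /N; ring.
  by rewrite ler_pM2l// exprn_gt0//; lra.
(* The s-part accounts for at most a quarter of r^2, so the quartic part K^2 <d, d>^2 carries the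
   rest. *)
have Kd : r <= 2 * (K * dotp d d).
  rewrite -(@ler_pXn2r _ 2) ?nnegrE ?(ltW r0) ?mulr_ge0//; last by lra.
  have : r ^+ 2 = K ^+ 2 * dotp d d ^+ 2 + 4 * L ^+ 2 * dotp s s.
    by rewrite r2 /doubling_gauge /N; ring.
  have := mulr_ge0 (sqr_ge0 K) (sqr_ge0 (dotp d d)).
  have -> : (2 * (K * dotp d d)) ^+ 2 = 4 * (K ^+ 2 * dotp d d ^+ 2) by ring.
  by lra.
have K0 : 0 < K by lra.
have dd0 : 0 < dotp d d.
  rewrite lt_neqAle eq_sym dd andbT; apply/eqP => d0.
  by move: Kd; rewrite d0 !mulr0; lra.
have ne : K * `|d| <= `|e|.
  rewrite eE normrZ ger0_norm; last by rewrite divr_ge0 ?mulr_ge0 ?sqr_ge0// ltW.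
  rewrite ler_wpM2r// ler_pdivlMr//.
  have := ler_wpM2l (ltW K0) Kd; rewrite expr2; lra.
have sd : `|s| <= n%:R * K * `|d| ^+ 2.
  have s4 : 4 * `|s| <= r.
    rewrite -(@ler_pXn2r _ 2) ?nnegrE ?(ltW r0) ?mulr_ge0//.
    apply: le_trans ss1; rewrite exprMn.
    have L2 : 1 <= L ^+ 2 by rewrite expr_ge1.
    have := ler_wpM2r ss L2; have := sqr_norm_le_dotp s; lra.
  have := ler_wpM2l (ltW K0) (dotp_le_sqr_norm d); have := normr_ge0 s; lra.
have nd0 : 0 < `|d|.
  rewrite normr_gt0; apply/eqP => d0; by rewrite d0 dotp0r ltxx in dd0.
have ne0 : 0 < `|e| by apply: lt_le_trans ne; rewrite mulr_gt0.
move: K1 ne nd0 sd ne0; move: (`|d|) (`|s|) (`|e|) => D S E K1 ne nd0 sd ne0 H.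
have n0 : (0 : R) <= n%:R by [].
have T1 : K ^+ 2 * D ^+ 2 <= E ^+ 2.
  by rewrite -exprMn lerXn2r ?nnegrE ?mulr_ge0// ltW.
have {}H : K * (2 * lam * E ^+ 2) <= K * (C1 * (1 + n%:R * K) * D ^+ 2 + C2 * (D * E)).
  rewrite ler_wpM2l ?(ltW K0)//; apply: le_trans H _; rewrite lerD2r -mulrA ler_wpM2l//.
  by rewrite mulrDl mul1r lerD2l.
have T2 : K * (C2 * (D * E)) <= C2 * E ^+ 2.
  rewrite mulrCA ler_wpM2l// expr2 mulrA ler_wpM2r//; exact: ltW.
have T3 : K * (C1 * (1 + n%:R * K) * D ^+ 2) <= C1 * (1 + n%:R) * E ^+ 2.
  rewrite -!mulrA mulrCA ler_wpM2l//.
  apply: le_trans (_ : (1 + n%:R) * (K ^+ 2 * D ^+ 2) <= _).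
    have -> : (1 + n%:R) * (K ^+ 2 * D ^+ 2) = K * ((K + n%:R * K) * D ^+ 2) by ring.
    by rewrite ler_wpM2l ?(ltW K0)// ler_wpM2r ?sqr_ge0//; lra.
  by rewrite ler_wpM2l ?addr_ge0.
have KlE : lam * K * E ^+ 2 = lam * E ^+ 2 + (C1 * (1 + n%:R) + C2) * E ^+ 2.
  by rewrite KE; field; rewrite gt_eqF.
have : 0 < lam * E ^+ 2 by rewrite mulr_gt0// exprn_gt0.
have : 0 <= (C1 * (1 + n%:R) + C2) * E ^+ 2 by rewrite mulr_ge0 ?sqr_ge0//; nonneg.
by move: H T2 T3 KlE; lra.
Qed.

(** Halving repeatedly towards x compares the increment over h with 2^k times the increment over
    2^-k h, where p is a first-order bound. The errors form a geometric series. *)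
Lemma semiconcave_superdiff (v : 'rV[R]_n -> R) (C : R) : 0 <= C ->
  (forall y h, v (y + h) + v (y - h) - 2 * v y <= C * `|h| ^+ 2) ->
  forall x p, superdiff v x p ->
  forall y, v y <= v x + dotp p (y - x) + C * `|y - x| ^+ 2.
Proof.
move=> C0 Hv x p /superdiffP Sp y; set h := y - x.
have -> : y = x + h by rewrite /h addrC subrK.
(* with w t = v (x + t h) - v x - t <p, h>, w t <= 2 w (t/2) + C (t/2)^2 |h|^2 *)
have [w wE] : exists w : R -> R, forall t, w t = v (x + t *: h) - v x - t * dotp p h.
  by eexists => t; reflexivity.
have wS t : w t <= 2 * w (t / 2) + C * (t / 2) ^+ 2 * `|h| ^+ 2.
  have := Hv (x + (t / 2) *: h) ((t / 2) *: h).
  have -> : x + (t / 2) *: h + (t / 2) *: h = x + t *: h by rewrite -addrA -scalerDl -splitr.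
  rewrite addrK normrZ exprMn real_normK ?num_real//.
  by rewrite !wE; lra.
have wk k : w 1 <= 2 ^+ k * w (2 ^- k) + C * `|h| ^+ 2 * (1 - 2 ^- k).
  elim: k => [|k IH]; first by rewrite expr0 invr1 mul1r subrr mulr0 addr0.
  apply: le_trans IH _.
  have k0 : (0 : R) < 2 ^+ k by rewrite exprn_gt0.
  have le1 := ler_wpM2l (ltW k0) (wS (2 ^- k)).
  have i0 : (0 : R) < 2 ^- k by rewrite invr_gt0.
  have E : 2 ^- k.+1 = 2 ^- k / 2 :> R by rewrite exprS invfM mulrC.
  have E2 : 2 ^+ k * (C * (2 ^- k.+1) ^+ 2 * `|h| ^+ 2) = C * `|h| ^+ 2 * (2 ^- k / 4).
    by rewrite E; field; rewrite gt_eqF.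
  rewrite -E mulrDr E2 mulrA -exprSr in le1.
  have : 0 <= C * `|h| ^+ 2 * 2 ^- k by nonneg; exact: ltW.
  by rewrite E in le1 *; lra.
suff : w 1 <= C * `|h| ^+ 2.
  by rewrite wE scale1r mul1r; lra.
apply/ler_addgt0Pr => e e0.
have e1 : 0 < e / (`|h| + 1) by rewrite divr_gt0// ltr_wpDl.
have /near_norm[r r0 Hr] := Sp _ e1.
have [k kr] : exists k, 2 ^- k * `|h| < r.
  have : 2 ^- k * `|h| @[k --> \oo] --> (0 : R).
    rewrite -[X in _ --> X](mul0r `|h|); apply: cvgMr_tmp.
    rewrite (_ : (fun k => 2 ^- k) = GRing.exp (2^-1 : R)); last first.
      by apply/funext => k; rewrite exprVn.
    by apply: cvg_expr; rewrite ger0_norm ?invr_ge0// invf_lt1// ltr1n.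
  move=> /cvgrPdist_lt/(_ r r0)[k _ /(_ k (leqnn k))] /=.
  by rewrite sub0r normrN ger0_norm ?mulr_ge0 ?invr_ge0 ?exprn_ge0// => ?; exists k.
apply: le_trans (wk k) _.
have k0 : (0 : R) < 2 ^+ k by rewrite exprn_gt0.
have i0 : (0 : R) < 2 ^- k by rewrite invr_gt0.
have nk : `|x + 2 ^- k *: h - x| = 2 ^- k * `|h|.
  by rewrite addrC addKr normrZ gtr0_norm.
have := Hr (x + 2 ^- k *: h); rewrite nk => /(_ kr).
have -> : x + 2 ^- k *: h - x = 2 ^- k *: h by rewrite addrC addKr.
rewrite dotpZr -wE => /(ler_wpM2l (ltW k0)).
have -> : 2 ^+ k * (e / (`|h| + 1) * (2 ^- k * `|h|)) = e * (`|h| / (`|h| + 1)).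
  by field; rewrite !gt_eqF// ltr_wpDl.
have : e * (`|h| / (`|h| + 1)) <= e.
  by rewrite ler_piMr ?(ltW e0)// ler_pdivrMr ?ltr_wpDl// mul1r lerDl.
have : 0 <= C * `|h| ^+ 2 * 2 ^- k by nonneg; exact: ltW.
by lra.
Qed.

End Semiconcave.

(** * The superdifferential of a semiconcave function *)

Section SuperdifferentialMap.
Context {R : realType} {n : nat}.
Context (v : 'rV[R]_n -> R) (C L : R).
Context (C_ge0 : 0 <= C) (L_ge0 : 0 <= L).
Context (v_lip : forall x y, `|v x - v y| <= L * `|x - y|).
Context (sd_bd : forall x p, superdiff v x p -> `|p| <= L).
Context (v_sc : forall x p, superdiff v x p ->
  forall y, v y <= v x + dotp p (y - x) + C * `|y - x| ^+ 2).
Implicit Types (p q x y z : 'rV[R]_n).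

(** The converse of [v_sc]. Together they describe D+v by a global inequality, which passes to
    limits and to convex combinations. *)
Lemma superdiff_sc x p :
  (forall y, v y <= v x + dotp p (y - x) + C * `|y - x| ^+ 2) -> superdiff v x p.
Proof. by move=> H; apply: (@superdiff_quad _ _ _ _ _ C 1) => // y _. Qed.

Lemma superdiff_closed x p :
  (forall e, 0 < e -> exists x' p', [/\ `|x' - x| < e, `|p' - p| < e & superdiff v x' p']) ->
  superdiff v x p.
Proof.
move=> H; apply: superdiff_sc => y; apply/ler_addgt0Pr => e e0.
pose D := `|y - x| + 1.
have D1 : 1 <= D by rewrite /D lerDr.
(* The sum of the rates at which the terms of the inequality change with (x', p'); D bounds |y - x'|
   since |x' - x| < 1. *)
pose T := L + n%:R * D + n%:R * `|p| + 2 * C * D + 1.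
have T0 : 0 < T by rewrite /T ltr_wpDl//; nonneg; lra.
have [|x' [p' [xx pp /v_sc/(_ y) Hy]]] := H (Num.min 1 (e / T)).
  by rewrite lt_min ltr01 divr_gt0.
move: xx pp; rewrite !lt_min => /andP[xx1 xx] /andP[pp1 pp].
apply: le_trans Hy _.
have := v_lip x' x; rewrite ler_norml => /andP[_ h1].
have h2 : dotp p' (y - x') - dotp p (y - x) <= n%:R * `|p' - p| * D + n%:R * `|p| * `|x' - x|.
  have -> : dotp p' (y - x') - dotp p (y - x) = dotp (p' - p) (y - x') + dotp p (x - x').
    by rewrite !dotpL; ring.
  apply: lerD; last by rewrite [`|x' - x|]distrC ler_dotp_norm.
  apply: le_trans (ler_dotp_norm _ _) _; rewrite ler_wpM2l//.
  rewrite /D; have := ler_normD (y - x) (x - x'); rewrite addrA subrK [`|x - x'|]distrC; lra.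
have h3 : `|y - x'| ^+ 2 <= `|y - x| ^+ 2 + 2 * D * `|x' - x|.
  have := ler_normD (y - x) (x - x'); rewrite addrA subrK [`|x - x'|]distrC => h.
  apply: le_trans (_ : (`|y - x| + `|x' - x|) ^+ 2 <= _).
    by rewrite lerXn2r ?nnegrE ?addr_ge0.
  rewrite sqrrD -addrA lerD2l /D; have := normr_ge0 (x' - x) => h0.
  have := ler_wpM2l h0 (ltW xx1); rewrite -expr2; lra.
have {}h3 := ler_wpM2l C_ge0 h3.
have n0 : (0 : R) <= n%:R by [].
have h4 : n%:R * `|p' - p| * D <= n%:R * D * (e / T).
  rewrite [leLHS]mulrAC ler_wpM2l ?(ltW pp)//; nonneg; lra.
have h5 : n%:R * `|p| * `|x' - x| <= n%:R * `|p| * (e / T).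
  by rewrite ler_wpM2l ?(ltW xx)//; nonneg.
have h6 : L * `|x' - x| <= L * (e / T) by rewrite ler_wpM2l ?(ltW xx).
have h7 : C * (2 * D * `|x' - x|) <= 2 * C * D * (e / T).
  have -> : C * (2 * D * `|x' - x|) = 2 * C * D * `|x' - x| by ring.
  by rewrite ler_wpM2l ?(ltW xx)//; nonneg; lra.
have h8 : e = L * (e / T) + n%:R * D * (e / T) + n%:R * `|p| * (e / T) + 2 * C * D * (e / T) + e / T.
  transitivity (T * (e / T)); first by rewrite mulrC divfK// gt_eqF.
  by rewrite {1}/T; ring.
have h9 : 0 < e / T by rewrite divr_gt0.
by lra.
Qed.

Lemma superdiff_cluster x (xs ps : nat -> 'rV[R]_n) :
  (forall k, `|xs k - x| < k.+1%:R^-1) -> (forall k, superdiff v (xs k) (ps k)) ->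
  exists2 p, superdiff v x p & forall e N, 0 < e -> exists2 k, (N <= k)%N & `|ps k - p| < e.
Proof.
move=> Hx Hp.
have [p Hcl] := bounded_seq_cluster (fun k => sd_bd (Hp k)).
exists p => //; apply: superdiff_closed => e e0.
have [N _ HN] : \forall k \near \oo, k.+1%:R^-1 < e by exact: near_infty_natSinv_lt (PosNum e0).
have [k /HN/= Nk kp] := Hcl e N e0.
by exists (xs k), (ps k); split => //; apply: lt_trans Nk.
Qed.

(** At a maximum of v - M |. - x|^2 the slope of the paraboloid lies in D+v. Maxima approach x as M
    grows, and the slopes, being bounded, cluster in D+v(x). *)
Lemma superdiff_nonempty x : exists p, superdiff v x p.
Proof.
have L0 := L_ge0.
have H k : exists z : 'rV[R]_n * 'rV[R]_n, `|z.1 - x| < k.+1%:R^-1 /\ superdiff v z.1 z.2.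
  (* The maximum is within L / M of x, and this choice makes L / M smaller than 1 / (k + 1). *)
  pose M : R := (L + 1) * k.+1%:R.
  have M0 : 0 < M by apply: mulr_gt0; [rewrite ltr_wpDl|exact: ltr0Sn].
  have cv := lipschitz_rV_continuous L_ge0 v_lip.
  have cx : continuous (fun y : 'rV[R]_n => y - x).
    by move=> y; apply: (@continuousB _ _ _ id (fun=> x)) => //; exact: cst_continuous.
  have cd := continuous_dotp cx cx.
  have ge y : v y - M * dotp (y - x) (y - x) - v x <= L * `|y - x| - M * `|y - x| ^+ 2.
    have := v_lip y x; rewrite ler_norml => /andP[_].
    by have := ler_wpM2l (ltW M0) (sqr_norm_le_dotp (y - x)); lra.
  have dxx : dotp (x - x) (x - x) = 0 by rewrite subrr dotp0l.
  have [||y Hy] := @coercive_max _ _ (fun y => v y - M * dotp (y - x) (y - x)) (L / M) x.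
  - move=> y; apply: (@continuousB _ _ _ v (fun y => M * dotp (y - x) (y - x))); first exact: cv.
    apply: (@continuousM _ _ (fun=> M) (fun y => dotp (y - x) (y - x))); first exact: cst_continuous.
    exact: cd.
  - move=> y; rewrite ltr_pdivrMr// => yL; rewrite dxx mulr0 subr0.
    have := ge y; have := ler_wpM2r (normr_ge0 (y - x)) (ltW yL); rewrite expr2; lra.
  have yx : `|y - x| <= L / M.
    rewrite leNgt; apply/negP; rewrite ltr_pdivrMr// => yL.
    have := Hy x; rewrite dxx mulr0 subr0 => h; have := ge y.
    have y0 : 0 < `|y - x|.
      rewrite lt_neqAle normr_ge0 andbT eq_sym; apply/eqP => y0.
      by move: yL; rewrite y0 mul0r ltNge L_ge0.
    have := yL; rewrite -(ltr_pM2r y0); rewrite expr2; lra.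
  exists (y, (2 * M) *: (y - x)); split => /=.
    apply: le_lt_trans yx _; rewrite /M invfM mulrA gtr_pMl ?invr_gt0//.
    by rewrite ltr_pdivrMr; lra.
  apply: (@superdiff_quad _ _ _ _ _ (M * n%:R) 1) => // z _.
  have := Hy z; have -> : z - x = (z - y) + (y - x) by rewrite addrA subrK.
  move: (z - y) (y - x) => d e.
  have := ler_wpM2l (ltW M0) (dotp_le_sqr_norm d).
  rewrite !dotpDl !dotpDr dotpZl (dotpC e d); lra.
have /choice[z Hz] := H.
by have [p] := @superdiff_cluster x (fst \o z) (snd \o z) (fun k => (Hz k).1) (fun k => (Hz k).2); exists p.
Qed.

(** Upper semicontinuity: counterexamples z_k tending to y would have momenta clustering at an
    element of D+v(y). *)
Lemma superdiff_usc y e : 0 < e ->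
  exists2 r, 0 < r & forall z p, `|z - y| < r -> superdiff v z p ->
    exists2 q, superdiff v y q & `|p - q| < e.
Proof.
move=> e0; apply: contrapT => H.
have {}H k : exists z : 'rV[R]_n * 'rV[R]_n, [/\ `|z.1 - y| < k.+1%:R^-1, superdiff v z.1 z.2 &
    forall q, superdiff v y q -> e <= `|z.2 - q|].
  apply: contrapT => Hk; apply: H; exists (k.+1%:R^-1) => // z p zy zp.
  apply: contrapT => Hq; apply: Hk; exists (z, p); split => // q yq.
  by rewrite leNgt; apply/negP => pq; apply: Hq; exists q.
have /choice[z Hz] := H.
have [||p yp Hp] := @superdiff_cluster y (fst \o z) (snd \o z).
- by move=> k; have [] := Hz k.
- by move=> k; have [] := Hz k.
have [k _ kp] := Hp e 0%N e0.
by have [_ _ /(_ p yp)] := Hz k; rewrite leNgt kp.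
Qed.

(** The sum of the two inequalities [v_sc] between x and y. It is what makes the implicit scheme
    almost dissipative. *)
Lemma superdiff_monotone x y p q : superdiff v x p -> superdiff v y q ->
  dotp (p - q) (x - y) <= 2 * C * `|x - y| ^+ 2.
Proof.
move=> /v_sc/(_ y) + /v_sc/(_ x); rewrite [`|y - x|]distrC.
have -> : y - x = - (x - y) by rewrite opprB.
by rewrite dotpNr dotpDl dotpNl; lra.
Qed.

Lemma superdiff_convex x p q t : 0 <= t -> t <= 1 -> superdiff v x p -> superdiff v x q ->
  superdiff v x (p + t *: (q - p)).
Proof.
move=> t0 t1 /v_sc Hp /v_sc Hq; apply: superdiff_sc => y.
have := Hp y; have := Hq y; rewrite dotpDl dotpZl dotpDl dotpNl => h1 h2.
have t1' : 0 <= 1 - t by lra.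
have := ler_wpM2l t0 h1; have := ler_wpM2l t1' h2; lra.
Qed.

(** Near x every q in D+v(z) is close to the only element p, and [v_sc] at z evaluated at x is a
    lower bound for v z. *)
Lemma superdiff_singleton_subdiff x p : superdiff v x = [set p] -> subdiff v x p.
Proof.
have C0 := C_ge0.
move=> E; apply/subdiffP => e e0; apply/near_norm.
have e2 : 0 < e / (2 * (n%:R + 1)) by rewrite divr_gt0// mulr_gt0// ltr_wpDl.
have [r r0 Hr] := superdiff_usc x e2.
exists (Num.min r (e / (2 * (C + 1)))).
  by rewrite lt_min r0 divr_gt0// mulr_gt0//; lra.
move=> z; rewrite lt_min => /andP[zr]; rewrite ltr_pdivlMr; last by lra.
move=> ze; have [q zq] := superdiff_nonempty z.
have [p' + /ltW qp] := Hr z q zr zq; rewrite E => /= p'E; rewrite {}p'E in qp.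
have := v_sc zq x; have -> : x - z = - (z - x) by rewrite opprB.
rewrite dotpNr normrN.
have := ler_dotp_norm (q - p) (- (z - x)); rewrite dotpNr dotpDl dotpNl normrN.
have d0 := normr_ge0 (z - x); move: d0 ze qp; move: `|z - x| `|q - p| => d w d0 ze qp.
have h1 : C * d ^+ 2 <= e / 2 * d.
  rewrite expr2 mulrA ler_wpM2r//; lra.
have h2 : n%:R * w * d <= e / 2 * d.
  rewrite ler_wpM2r//; have n0 : (0 : R) <= n%:R by [].
  apply: le_trans (ler_wpM2l n0 qp) _.
  rewrite mulrA ler_pdivrMr ?mulr_gt0 ?ltr_wpDl//; lra.
by lra.
Qed.

End SuperdifferentialMap.

(** * The quadratic form and the gradient of the Hamiltonian *)

Section QuadraticForm.
Context {R : realType} {n : nat}.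
Context (A : 'rV[R]_n -> 'M[R]_n) (lam B : R).
Context (lam_gt0 : 0 < lam) (A_sym : forall x, (A x)^T = A x).
Context (A_ell : forall x p, lam * `|p| ^+ 2 <= quad A x p).
Context (A_bd : forall x, `|A x| <= B).
Implicit Types (p q x y z : 'rV[R]_n).

Lemma quad_ge0 x p : 0 <= quad A x p.
Proof. by apply: le_trans (A_ell x p); rewrite mulr_ge0 ?sqr_ge0// ltW. Qed.

Lemma quad_le x p : quad A x p <= n%:R ^+ 2 * B * `|p| ^+ 2.
Proof.
apply: le_trans (ler_norm _) _; apply: le_trans (ler_bilin _ _ _) _.
rewrite -[X in X * _]mulrA -expr2 mulrAC ler_wpM2r ?sqr_ge0//.
by rewrite ler_wpM2l ?sqr_ge0.
Qed.

Lemma dotp_mulA x p q : dotp (p *m A x) q = dotp p (q *m A x).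
Proof. by rewrite dotp_mulmxl A_sym. Qed.

Lemma quadB x p q :
  quad A x (p - q) = quad A x p - 2 * dotp (p *m A x) q + quad A x q.
Proof. by rewrite (quadD A_sym) -scaleN1r dotpZr quadZ sqrrN expr1n; ring. Qed.

Lemma A_unit x : A x \in unitmx.
Proof.
rewrite -row_free_unit -kermx_eq0; apply/eqP/row_matrixP => i.
rewrite row0; set k := row i _.
have kA : k *m A x = 0 by rewrite /k -row_mul mulmx_ker row0.
have := A_ell x k; rewrite /quad kA dotp0l pmulr_rle0// => h.
by apply/eqP; rewrite -normr_eq0 -sqrf_eq0 eq_le h sqr_ge0.
Qed.

Lemma continuous_mulmx (M : 'M[R]_n) : continuous (fun p : 'rV[R]_n => p *m M).
Proof.
move=> p; apply/(@cvgrPdist_lt _ _ _ _ (nbhs_filter p)) => /= e e0; apply/near_norm.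
have d0 : 0 < n%:R * `|M| + 1 by rewrite ltr_wpDl.
exists (e / (n%:R * `|M| + 1)); first by rewrite divr_gt0.
move=> q; rewrite ltr_pdivlMr// => qp.
rewrite -mulmxBl; apply: le_lt_trans (ler_norm_mulmx _ _) _.
rewrite distrC; apply: le_lt_trans qp; have := normr_ge0 (q - p); lra.
Qed.

Lemma continuous_quad x : continuous (quad A x).
Proof.
apply: (@continuous_dotp _ _ _ (fun p => p *m A x) id); first exact: continuous_mulmx.
by move=> p; exact: cvg_id.
Qed.

Lemma grad_hamiltonian (V : 'rV[R]_n -> R) x p :
  grad_p (hamiltonian A V) x p = p *m A x.
Proof.
apply/rowP => i; rewrite !mxE; set e : 'rV[R]_n := delta_mx 0 i.
have eE j : e 0 j = (j == i)%:R by rewrite mxE eqxx.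
have -> : \sum_j p 0 j * A x j i = dotp (p *m A x) e.
  rewrite dotpE [RHS](bigD1 i)//= [X in _ + X]big1 => [|j ji]; rewrite eE.
    by rewrite eqxx mulr1 addr0 mxE.
  by rewrite (negbTE ji) mulr0.
apply: cvg_lim => //=; apply/cvgrPdist_le => /= eps eps0.
pose K := quad A x e.
have K0 : 0 <= K by exact: quad_ge0.
near=> h.
have h0 : h != 0 by near: h; exact: nbhs_dnbhs_neq.
have hK : `|h| * (K + 1) <= eps.
  rewrite -ler_pdivlMr ?ltr_wpDl//; near: h.
  by apply: dnbhs0_le; rewrite divr_gt0// ltr_wpDl.
have -> : h^-1 *: (hamiltonian A V x (h *: e + p) - hamiltonian A V x p)
   = dotp (p *m A x) e + 2^-1 * h * K.
  rewrite !hamiltonianE addrC [h *: e + p]addrC (quadD A_sym) dotpZr quadZ -/K.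
  rewrite /GRing.scale/=; by field.
rewrite opprD addNKr normrN !normrM ger0_norm ?invr_ge0// [`|K|]ger0_norm//.
have := mulr_ge0 (normr_ge0 h) K0; have := normr_ge0 h; lra.
Unshelve. all: by end_near. Qed.

End QuadraticForm.

(** * Energy on the superdifferential: minimal elements and singular points *)

Section MinimalVelocity.
Context {R : realType} {n : nat}.
Context (A : 'rV[R]_n -> 'M[R]_n) (V : 'rV[R]_n -> R) (lam B : R).
Context (lam_gt0 : 0 < lam) (A_sym : forall x, (A x)^T = A x).
Context (A_ell : forall x p, lam * `|p| ^+ 2 <= quad A x p).
Context (A_bd : forall x, `|A x| <= B).
Context (v : 'rV[R]_n -> R) (C L : R).
Context (C_ge0 : 0 <= C) (L_ge0 : 0 <= L).
Context (v_lip : forall x y, `|v x - v y| <= L * `|x - y|).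
Context (sd_bd : forall x p, superdiff v x p -> `|p| <= L).
Context (v_sc : forall x p, superdiff v x p ->
  forall y, v y <= v x + dotp p (y - x) + C * `|y - x| ^+ 2).
Implicit Types (p q x y z : 'rV[R]_n).

(** The variational inequality of a minimizer of <A q, q> over D+v(y), a nonempty compact convex
    set. *)
Lemma superdiff_minimal y : exists2 q, superdiff v y q &
  forall p, superdiff v y p -> 0 <= dotp (q *m A y) (p - q).
Proof.
have cS : compact (superdiff v y).
  apply: bounded_closed_compact.
    exists L; split; first exact: num_real.
    by move=> r Lr p /sd_bd /le_trans; apply; exact: ltW.
  move=> p Hp; apply: (superdiff_closed C_ge0 L_ge0 v_lip v_sc) => e e0.
  have [|q [Sq qp]] := Hp [set q | `|q - p| < e]; first by apply/near_norm; exists e.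
  by exists y, q; split => //; rewrite subrr normr0.
have [|q] := EVT_min_rV _ cS (continuous_subspaceT (@continuous_quad _ _ A y)).
  exact: (superdiff_nonempty C_ge0 L_ge0 v_lip sd_bd v_sc y).
rewrite inE => Sq Hmin; exists q => // p Sp.
rewrite leNgt; apply/negP => neg.
have [b bE] : exists b, b = - dotp (q *m A y) (p - q) by eexists.
have b0 : 0 < b by rewrite bE oppr_gt0.
have Q0 := quad_ge0 lam_gt0 A_ell y (p - q).
have [Q QE] : exists Q, Q = quad A y (p - q) by eexists.
rewrite -QE in Q0.
(* This t is at most 1 and satisfies t Q < 2 b, so moving by t towards p changes the energy by t (t
   Q - 2 b) < 0. *)
pose t := b / (Q + b).
have Qb : 0 < Q + b by rewrite ltr_wpDl.
have t0 : 0 < t by rewrite divr_gt0.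
have t1 : t <= 1 by rewrite ler_pdivrMr// mul1r lerDr.
have := Hmin (q + t *: (p - q)).
rewrite inE => /(_ (superdiff_convex v_sc (ltW t0) t1 Sq Sp)).
rewrite (quadD A_sym) dotpZr quadZ -QE.
have -> : dotp (q *m A y) (p - q) = - b by rewrite bE opprK.
have : t * Q < 2 * b.
  rewrite /t mulrAC ltr_pdivrMr// mulrDr.
  have := mulr_ge0 (ltW b0) Q0; have := mulr_gt0 b0 b0; lra.
by rewrite -(ltr_pM2l t0) expr2; lra.
Qed.

(** A strict energy inequality certifies singularity: a single element of D+v(y) would also lie in
    D-v(y), where the energy is at least a. *)
Lemma singular_of_hamiltonian_lt (a : R) y p :
  (forall x p, subdiff v x p -> a <= hamiltonian A V x p) ->
  superdiff v y p -> hamiltonian A V y p < a -> singular_set v y.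
Proof.
move=> sup Sp Hp [q E].
have pq : p = q by move: Sp; rewrite E.
have := sup _ _ (superdiff_singleton_subdiff C_ge0 L_ge0 v_lip sd_bd v_sc E).
by rewrite -pq leNgt Hp.
Qed.

(** Take the midpoint of two distinct elements: their energies are at most a, and the Hamiltonian is
    strictly convex in p. *)
Lemma hamiltonian_lt_of_singular (a : R) y :
  (forall x p, superdiff v x p -> hamiltonian A V x p <= a) ->
  singular_set v y -> exists2 p, superdiff v y p & hamiltonian A V y p < a.
Proof.
move=> sub Sy.
have [p Sp] := superdiff_nonempty C_ge0 L_ge0 v_lip sd_bd v_sc y.
have [q [Sq qp]] : exists q, superdiff v y q /\ q != p.
  apply: contrapT => H; apply: Sy; exists p; apply/seteqP; split => [q Sq|q /= ->//].
  by apply: contrapT => /eqP qp; apply: H; exists q.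
have i0 : (0 : R) <= 2^-1 by rewrite invr_ge0.
have i1 : (2^-1 : R) <= 1 by lra.
exists (p + 2^-1 *: (q - p)); first exact: (superdiff_convex v_sc i0 i1 Sp Sq).
have := sub _ _ Sp; have := sub _ _ Sq; rewrite !hamiltonianE.
have qp0 : 0 < quad A y (q - p).
  by apply: lt_le_trans (A_ell _ _); rewrite mulr_gt0// exprn_gt0// normr_gt0 subr_eq0.
have E : quad A y q = quad A y p + 2 * dotp (p *m A y) (q - p) + quad A y (q - p).
  by rewrite -(quadD A_sym) addrC subrK.
by rewrite (quadD A_sym) dotpZr quadZ E; lra.
Qed.

End MinimalVelocity.

(** * Generalized characteristics by the implicit Euler scheme *)

Section EulerScheme.
Context {R : realType} {n : nat}.
Context (A : 'rV[R]_n -> 'M[R]_n) (V : 'rV[R]_n -> R) (lam B : R).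
Context (lam_gt0 : 0 < lam) (B_ge0 : 0 <= B) (A_sym : forall x, (A x)^T = A x).
Context (A_ell : forall x p, lam * `|p| ^+ 2 <= quad A x p).
Context (A_bd : forall x, `|A x| <= B).
Context (A_lip : forall x y, `|A x - A y| <= B * `|x - y|).
Context (V_lip : forall x y, `|V x - V y| <= B * `|x - y|).
Context (v : 'rV[R]_n -> R) (C L : R).
Context (C_ge0 : 0 <= C) (L_ge0 : 0 <= L).
Context (v_lip : forall x y, `|v x - v y| <= L * `|x - y|).
Context (sd_bd : forall x p, superdiff v x p -> `|p| <= L).
Context (v_sc : forall x p, superdiff v x p ->
  forall y, v y <= v x + dotp p (y - x) + C * `|y - x| ^+ 2).
Implicit Types (p q x y z : 'rV[R]_n).

Lemma ler_mulA x p (M : R) : `|p| <= M -> `|p *m A x| <= n%:R * M * B.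
Proof.
move=> pM; apply: le_trans (ler_norm_mulmx _ _) _.
by apply: ler_pM => //; rewrite ler_wpM2l.
Qed.

(* One step of the implicit Euler scheme for x' = A(x) p, p in the
   superdifferential at x: p maximizes v(x + h A(x) q) - (h/2) <A(x) q, q>. *)
Lemma implicit_step h x : 0 < h -> exists p, superdiff v (x + h *: (p *m A x)) p.
Proof.
move=> h0.
pose f q := v (x + h *: (q *m A x)) - h / 2 * quad A x q.
have cv := lipschitz_rV_continuous L_ge0 v_lip.
have cf : continuous f.
  move=> q; apply: (@continuousB _ _ _ (fun q => v (x + h *: (q *m A x)))
    (fun q => h / 2 * quad A x q)); last first.
    apply: (@continuousM _ _ (fun=> h / 2) (quad A x)); first exact: cst_continuous.
    exact: continuous_quad.
  apply: (@continuous_comp _ _ _ (fun q => x + h *: (q *m A x)) v); last exact: cv.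
  apply: (@continuousD _ _ _ (fun=> x) (fun q => h *: (q *m A x))); first exact: cst_continuous.
  apply: (@continuousZ _ _ _ (fun=> h) (fun q => q *m A x)); first exact: cst_continuous.
  exact: continuous_mulmx.
(* Beyond this radius the cost (h / 2) lam |q|^2 exceeds L h n |q| B, the most that v can gain. *)
have [|q Hq] := @coercive_max _ _ f (2 * L * n%:R * B / lam) 0 cf.
  move=> q; rewrite subr0 ltr_pdivrMr// => qL.
  rewrite /f mul0mx scaler0 addr0 [quad A x 0]dotp0r mulr0 subr0.
  have e1 : x + h *: (q *m A x) - x = h *: (q *m A x) by rewrite addrC addKr.
  have := v_lip (x + h *: (q *m A x)) x; rewrite e1 normrZ gtr0_norm//.
  rewrite ler_norml => /andP[_ h1].
  have h2 : L * (h * `|q *m A x|) <= L * (h * (n%:R * `|q| * B)).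
    by rewrite ler_wpM2l// ler_wpM2l ?(ltW h0)//; exact: ler_mulA.
  have h3 := ler_wpM2l (ltW h0) (A_ell x q).
  have h4 := ler_wpM2l (mulr_ge0 (ltW h0) (normr_ge0 q)) (ltW qL).
  have E : h * `|q| * (`|q| * lam) = h * (lam * `|q| ^+ 2) by ring.
  rewrite E in h4.
  by lra.
exists q; have Au := A_unit lam_gt0 A_ell x.
pose K := n%:R * `|invmx (A x)| / h.
apply: (@superdiff_quad _ _ _ _ _ (h / 2 * (n%:R ^+ 2 * B * K ^+ 2)) 1) => // y _.
set y0 := x + h *: (q *m A x).
(* The change of q that moves the endpoint x + h A(x) q to y. Maximality against q + r is then a
   quadratic bound for v around the endpoint, with slope q. *)
have [r rE] : exists r, r = h^-1 *: ((y - y0) *m invmx (A x)) by eexists.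
have rA : h *: (r *m A x) = y - y0.
  by rewrite rE -scalemxAl mulmxKV// scalerA divff ?scale1r// gt_eqF.
have yE : y0 + (y - y0) = y by rewrite addrC subrK.
have := Hq (q + r); rewrite /f mulmxDl scalerDr [x + (_ + _)]addrA -/y0 rA yE.
rewrite (quadD A_sym).
have -> : h / 2 * (quad A x q + 2 * dotp (q *m A x) r + quad A x r) =
   h / 2 * quad A x q + dotp q (y - y0) + h / 2 * quad A x r.
  by rewrite -rA dotpZr -(dotp_mulA A_sym) ; field.
have h2 : 0 <= h / 2 by rewrite divr_ge0// ltW.
have rK : `|r| <= K * `|y - y0|.
  rewrite rE normrZ gtr0_norm ?invr_gt0//.
  have i0 : 0 <= h^-1 by rewrite invr_ge0 ltW.
  apply: le_trans (ler_wpM2l i0 (ler_norm_mulmx _ _)) _.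
  by rewrite /K le_eqVlt; apply/orP; left; apply/eqP; ring.
have := quad_le A_bd x r => qr.
have {qr} : quad A x r <= n%:R ^+ 2 * B * K ^+ 2 * `|y - y0| ^+ 2.
  apply: le_trans qr _; rewrite -[leRHS]mulrA -exprMn ler_wpM2l//.
    by rewrite mulr_ge0// sqr_ge0.
  by rewrite lerXn2r ?nnegrE// (le_trans _ rK).
by move/(ler_wpM2l h2); lra.
Qed.

Context (h : R) (h_gt0 : 0 < h) (G : 'rV[R]_n -> 'rV[R]_n).
Context (G_sd : forall x, superdiff v (x + h *: (G x *m A x)) (G x)).
Context (x0 p0 : 'rV[R]_n) (p0_sd : superdiff v x0 p0).

Definition euler k := iter k (fun x => x + h *: (G x *m A x)) x0.
(** Each later node carries the momentum of the step that reached it; node 0 carries the prescribed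
    p0, which enters the dynamics only through the energy comparison of the first step. *)
Definition euler_p k := if k is k'.+1 then G (euler k') else p0.

Let h_ge0 : 0 <= h. Proof. exact: ltW. Qed.
Let M1 := n%:R * L * B.
Let M1_ge0 : 0 <= M1. Proof. by rewrite /M1; nonneg. Qed.

Lemma eulerS k : euler k.+1 - euler k = h *: (euler_p k.+1 *m A (euler k)).
Proof. by rewrite /= addrC addKr. Qed.

Lemma euler_sd k : superdiff v (euler k) (euler_p k).
Proof. by case: k => [|k]; [exact: p0_sd|exact: G_sd]. Qed.

Lemma euler_p_bd k : `|euler_p k| <= L.
Proof. by apply: sd_bd (euler_sd k). Qed.

Lemma euler_step_bd k : `|euler k.+1 - euler k| <= h * M1.
Proof.
rewrite eulerS normrZ gtr0_norm// ler_wpM2l//.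
exact/ler_mulA/euler_p_bd.
Qed.

Lemma euler_lip j i : `|euler (j + i) - euler j| <= h * i%:R * M1.
Proof.
elim: i => [|i IH]; first by rewrite addn0 subrr normr0 mulr0 mul0r.
have := ler_normD (euler (j + i).+1 - euler (j + i)) (euler (j + i) - euler j).
rewrite addrA subrK addnS => /le_trans; apply.
have := euler_step_bd (j + i); rewrite -natr1; lra.
Qed.

(** The step is h A p', so monotonicity gives <p' - p, A p'> = O(h), and by convexity <A p', p'> -
    <A p, p> is at most twice that. Moving the base point costs O(h) by Lipschitz continuity of A
    and V. *)
Lemma euler_hamiltonian k : hamiltonian A V (euler k) (euler_p k) <=
  hamiltonian A V x0 p0 + k%:R * h * (2 * C * M1 ^+ 2 + (n%:R ^+ 2 * L ^+ 2 * B + B) * M1).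
Proof.
elim: k => [|k IH]; first by rewrite !mul0r addr0.
rewrite -natr1; apply: le_trans (_ : hamiltonian A V (euler k) (euler_p k) +
  h * (2 * C * M1 ^+ 2 + (n%:R ^+ 2 * L ^+ 2 * B + B) * M1) <= _); last by move: IH; lra.
have [X' X'E] : exists y, y = euler k.+1 by eexists.
have [X XE] : exists y, y = euler k by eexists.
have [P' P'E] : exists y, y = euler_p k.+1 by eexists.
have [P PE] : exists y, y = euler_p k by eexists.
have := superdiff_monotone v_sc (euler_sd k.+1) (euler_sd k).
have dX := eulerS k; have bX := euler_step_bd k.
have bP' := euler_p_bd k.+1; have bP := euler_p_bd k.
rewrite -X'E -XE -P'E -PE in dX bX bP bP' *.
rewrite {1}dX dotpZr => mono.
have bX2 : `|X' - X| ^+ 2 <= h * (h * M1 ^+ 2).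
  have -> : h * (h * M1 ^+ 2) = (h * M1) ^+ 2 by ring.
  by rewrite lerXn2r ?nnegrE ?mulr_ge0.
have {}mono : dotp (P' - P) (P' *m A X) <= 2 * C * (h * M1 ^+ 2).
  rewrite -(ler_pM2l h_gt0); apply: le_trans mono _.
  have -> : h * (2 * C * (h * M1 ^+ 2)) = 2 * C * (h * (h * M1 ^+ 2)) by ring.
  by rewrite ler_wpM2l// mulr_ge0.
have q1 : quad A X P' - quad A X P <= 2 * dotp (P' - P) (P' *m A X).
  have := quad_ge0 lam_gt0 A_ell X (P' - P); rewrite (quadB A_sym).
  by rewrite dotpDl dotpNl (dotpC P') (dotpC P) /quad; lra.
have q2 : quad A X' P' - quad A X P' <= n%:R ^+ 2 * L ^+ 2 * B * (h * M1).
  have -> : quad A X' P' - quad A X P' = dotp (P' *m (A X' - A X)) P'.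
    by rewrite mulmxBr dotpDl dotpNl.
  apply: le_trans (ler_norm _) _; apply: le_trans (ler_bilin _ _ _) _.
  rewrite -[leRHS]mulrA; apply: ler_pM => //.
    by rewrite -mulrA -expr2 ler_wpM2l ?sqr_ge0// lerXn2r ?nnegrE.
  by apply: le_trans (A_lip _ _) _; rewrite ler_wpM2l.
have q3 : V X' - V X <= B * (h * M1).
  apply: le_trans (ler_norm _) _; apply: le_trans (V_lip _ _) _.
  by rewrite ler_wpM2l.
have q4 : 0 <= n%:R ^+ 2 * L ^+ 2 * B * (h * M1) by rewrite !mulr_ge0// sqr_ge0.
rewrite !hamiltonianE; move: mono q1 q2 q3 q4; lra.
Qed.

(** [v_sc] at the new node, tested at the old one, yields a gain of h <A p', p'> up to O(h^2). Then
    2 <q, A p'> <= <A p', p'> + <A q, q> trades it for a term linear in the displacement, with A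
    frozen at y. *)
Lemma euler_gain j i y q (D Q : R) : `|q| <= Q ->
  (forall l, (l <= i)%N -> `|euler (j + l) - y| <= D) ->
  2 * dotp q (euler (j + i) - euler j) - i%:R * h * (quad A y q + n%:R ^+ 2 * Q ^+ 2 * B * D
     + C * h * M1 ^+ 2) <= v (euler (j + i)) - v (euler j).
Proof.
move=> qQ; elim: i => [|i IH] HD.
  by rewrite addn0 !subrr dotp0r mulr0 !mul0r subrr.
have {}IH := IH (fun l li => HD l (leqW li)).
have HDi := HD i (leqnSn i).
set k := (j + i)%N in IH HDi *; rewrite addnS -/k.
have [X' X'E] : exists y, y = euler k.+1 by eexists.
have [X XE] : exists y, y = euler k by eexists.
have [P' P'E] : exists y, y = euler_p k.+1 by eexists.
have sc := v_sc (euler_sd k.+1) (euler k).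
have dX := eulerS k; have bX := euler_step_bd k.
rewrite -X'E -XE -P'E in dX bX sc IH HDi *.
have -> : dotp q (X' - euler j) = dotp q (X' - X) + dotp q (X - euler j).
  by rewrite -dotpDr addrA subrK.
have eX : X - X' = - (X' - X) by rewrite opprB.
rewrite eX normrN dotpNr {1}dX dotpZr in sc.
rewrite {1}dX dotpZr.
have bX2 : C * `|X' - X| ^+ 2 <= C * (h * (h * M1 ^+ 2)).
  rewrite ler_wpM2l//; have -> : h * (h * M1 ^+ 2) = (h * M1) ^+ 2 by ring.
  by rewrite lerXn2r ?nnegrE ?mulr_ge0.
have q1 : 2 * dotp q (P' *m A X) <= quad A X P' + quad A X q.
  have := quad_ge0 lam_gt0 A_ell X (P' - q); rewrite (quadB A_sym) (dotpC q).
  by lra.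
have q2 : quad A X q - quad A y q <= n%:R ^+ 2 * Q ^+ 2 * B * D.
  have -> : quad A X q - quad A y q = dotp (q *m (A X - A y)) q.
    by rewrite mulmxBr dotpDl dotpNl.
  apply: le_trans (ler_norm _) _; apply: le_trans (ler_bilin _ _ _) _.
  rewrite -[leRHS]mulrA; apply: ler_pM => //.
    by rewrite -mulrA -expr2 ler_wpM2l ?sqr_ge0// lerXn2r ?nnegrE// (le_trans _ qQ).
  by apply: le_trans (A_lip _ _) _; rewrite ler_wpM2l.
have E : dotp P' (P' *m A X) = quad A X P' by rewrite dotpC.
rewrite E in sc.
have {q1 q2} := ler_wpM2l h_ge0 (lerD q1 q2).
by rewrite -natr1; move: IH sc bX2; lra.
Qed.

(** Each step moves by h <q, A p'> in direction q. With A frozen at y this is h <A q, p'>, which the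
    hypothesis on the momenta bounds below by h (<A q, q> - eps). *)
Lemma euler_progress j i y q (D eps : R) : `|q| <= L ->
  (forall l, (l <= i)%N -> `|euler (j + l) - y| <= D) ->
  (forall l, (l <= i)%N -> - eps <= dotp (q *m A y) (euler_p (j + l) - q)) ->
  i%:R * h * (quad A y q - eps - n%:R ^+ 2 * L ^+ 2 * B * D) <=
    dotp q (euler (j + i) - euler j).
Proof.
move=> qL; elim: i => [|i IH] HD Hp.
  by rewrite addn0 subrr dotp0r !mul0r.
have {}IH := IH (fun l li => HD l (leqW li)) (fun l li => Hp l (leqW li)).
have HDi := HD i (leqnSn i); have := Hp i.+1 (leqnn _).
set k := (j + i)%N in IH HDi *; rewrite addnS -/k => Hpk.
have [X' X'E] : exists y, y = euler k.+1 by eexists.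
have [X XE] : exists y, y = euler k by eexists.
have [P' P'E] : exists y, y = euler_p k.+1 by eexists.
have dX := eulerS k; have bP := euler_p_bd k.+1.
rewrite -X'E -XE -P'E in dX bP IH HDi Hpk *.
have -> : dotp q (X' - euler j) = dotp q (X' - X) + dotp q (X - euler j).
  by rewrite -dotpDr addrA subrK.
rewrite {1}dX dotpZr.
have q2 : dotp (q *m A y) P' - dotp q (P' *m A X) <= n%:R ^+ 2 * L ^+ 2 * B * D.
  rewrite -(dotp_mulA A_sym).
  have -> : dotp (q *m A y) P' - dotp (q *m A X) P' = dotp (q *m (A y - A X)) P'.
    by rewrite mulmxBr dotpDl dotpNl.
  apply: le_trans (ler_norm _) _; apply: le_trans (ler_bilin _ _ _) _.
  rewrite -[leRHS]mulrA; apply: ler_pM => //.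
    by rewrite -mulrA ler_wpM2l ?sqr_ge0// expr2 ler_pM.
  by apply: le_trans (A_lip _ _) _; rewrite distrC ler_wpM2l.
move: Hpk; rewrite dotpDr dotpNr -/(quad A y q) => Hpk.
have {q2 Hpk} := ler_wpM2l h_ge0 (lerD q2 Hpk).
by rewrite -natr1; move: IH; lra.
Qed.

End EulerScheme.

(** * Limits along an ultrafilter *)

Section UltraLimit.
Context {R : realType} {n : nat} (U : set_system nat) {UU : UltraFilter U}.

Lemma cvg_dominated (f g : nat -> R) (a K : R) :
  (forall N, `|f N - a| <= K * g N) -> g @ U --> (0 : R) -> f @ U --> a.
Proof.
move=> fg g0; apply/cvgrPdist_le => /= e e0.
have K0 : 0 < `|K| + 1 by rewrite ltr_wpDl.
have : \forall N \near U, `|0 - g N| <= e / (`|K| + 1).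
  by move/cvgrPdist_le : g0; apply; rewrite divr_gt0.
apply: filterS => N; rewrite sub0r normrN ler_pdivlMr// => gN.
rewrite distrC; apply: le_trans (fg N) _; apply: le_trans gN.
apply: le_trans (ler_norm _) _; rewrite normrM mulrC ler_wpM2l//.
by rewrite lerDl.
Qed.

Lemma ultra_limit (u : nat -> 'rV[R]_n) (M : R) : (forall N, `|u N| <= M) ->
  exists l, `|u N - l| @[N --> U] --> (0 : R).
Proof.
move=> uM; pose B := [set p : 'rV[R]_n | `|p| <= M].
have cB : compact B by exact: compact_norm_le.
have [|p [_ cp]] := @cB (u @ U) _.
  by apply: (@filterS _ U _ setT); [move=> N _; exact: uM|exact: filterT].
exists p; apply/cvgrPdist_lt => /= e e0.
have [H|H] := in_ultra_setVsetC [set N | `|u N - p| < e] UU.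
  by apply: filterS H => N /=; rewrite sub0r normrN normr_id.
have [||_ [[N HN <-]]] := cp (u @` (~` [set N | `|u N - p| < e])) [set q | `|q - p| < e].
- by apply: (@filterS _ U _ _ _ _ H) => N HN; exists N.
- by apply/near_norm; exists e.
- by move=> /=; move: HN => /=.
Qed.

End UltraLimit.

Section GradientFlow.
Context {R : realType} {n : nat}.
Context (A : 'rV[R]_n -> 'M[R]_n) (V : 'rV[R]_n -> R) (lam B : R).
Context (lam_gt0 : 0 < lam) (B_ge0 : 0 <= B) (A_sym : forall x, (A x)^T = A x).
Context (A_ell : forall x p, lam * `|p| ^+ 2 <= quad A x p).
Context (A_bd : forall x, `|A x| <= B).
Context (A_lip : forall x y, `|A x - A y| <= B * `|x - y|).
Context (V_lip : forall x y, `|V x - V y| <= B * `|x - y|).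
Context (v : 'rV[R]_n -> R) (C L : R).
Context (C_ge0 : 0 <= C) (L_ge0 : 0 <= L).
Context (v_lip : forall x y, `|v x - v y| <= L * `|x - y|).
Context (sd_bd : forall x p, superdiff v x p -> `|p| <= L).
Context (v_sc : forall x p, superdiff v x p ->
  forall y, v y <= v x + dotp p (y - x) + C * `|y - x| ^+ 2).
Implicit Types (p q x y z : 'rV[R]_n).

Let M1 := n%:R * L * B.

(* index of the grid point at or before time t, for the time step 1/(N+1)
   (0 when t < 0) *)
Definition grid_index (N : nat) (t : R) : nat := Num.truncn (t * N.+1%:R).

(** Rounding down costs at most one step at either end. For s < 0 the index is frozen at 0, so only
    the upper bound on the number of steps is claimed there. *)
Lemma grid_indexP N (s t : R) : s <= t -> exists i,
  [/\ grid_index N t = (grid_index N s + i)%N,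
      i%:R * N.+1%:R^-1 <= t - s + N.+1%:R^-1 &
      0 <= s -> t - s - N.+1%:R^-1 <= i%:R * N.+1%:R^-1].
Proof.
move=> st; have N0 : (0 : R) < N.+1%:R by [].
have stN : s * N.+1%:R <= t * N.+1%:R by rewrite ler_wpM2r.
have le_st : (grid_index N s <= grid_index N t)%N.
  rewrite /grid_index; exact: le_truncn.
exists (grid_index N t - grid_index N s)%N; rewrite subnKC//.
have b (r : R) : r * N.+1%:R < (grid_index N r).+1%:R by exact: truncnS_gt.
have c (r : R) : 0 <= r -> (grid_index N r)%:R <= r * N.+1%:R.
  by move=> r0; rewrite truncn_le mulr_ge0.
have c' (r : R) : r < 0 -> grid_index N r = 0%N.
  by move=> r0; apply/truncn0Pn; rewrite -ltNge (lt_trans _ ltr01)// pmulr_llt0.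
split => //.
- rewrite natrB// ler_pdivrMr// mulrDl mulVf ?gt_eqF// mulrBl.
  have := b s; rewrite -natr1 => bs.
  have [t0|t0] := leP 0 t; first by have := c t t0; lra.
  by rewrite c'// c' ?(le_lt_trans st)// subrr; lra.
- move=> s0; rewrite natrB// ler_pdivlMr// mulrBl mulVf ?gt_eqF// mulrBl.
  have := c s s0; have := b t; rewrite -natr1; lra.
Qed.

(** The discrete estimates, all stable under limits of the nodes. Before time 0 the approximations
    rest at x0, which lets the Lipschitz bound hold on the whole line. *)
Lemma gradient_flow x0 p0 : superdiff v x0 p0 ->
  exists X : R -> 'rV[R]_n, [/\ X 0 = x0,
    forall s t, `|X t - X s| <= M1 * `|t - s|,
    forall t, 0 <= t -> exists2 p, superdiff v (X t) p &
      hamiltonian A V (X t) p <= hamiltonian A V x0 p0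
        + t * (2 * C * M1 ^+ 2 + (n%:R ^+ 2 * L ^+ 2 * B + B) * M1),
    forall s t q Q, 0 <= s -> s <= t -> `|q| <= Q ->
      2 * dotp q (X t - X s) - (t - s) * (quad A (X s) q
        + n%:R ^+ 2 * Q ^+ 2 * B * (M1 * (t - s))) <= v (X t) - v (X s) &
    forall s t q r eps, 0 <= s -> s <= t -> `|q| <= L ->
      (forall z p, `|z - X s| < r -> superdiff v z p ->
         - eps <= dotp (q *m A (X s)) (p - q)) ->
      M1 * (t - s) < r ->
      (t - s) * (quad A (X s) q - eps - n%:R ^+ 2 * L ^+ 2 * B * (M1 * (t - s)))
        <= dotp q (X t - X s)].
Proof.
move=> p0_sd.
have M10 : 0 <= M1 by rewrite /M1; nonneg.
pose h N : R := N.+1%:R^-1.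
have h0 N : 0 < h N by rewrite invr_gt0.
have /choice[G HG] : forall N, exists G : 'rV[R]_n -> 'rV[R]_n,
    forall x, superdiff v (x + h N *: (G x *m A x)) (G x).
  move=> N; have [G HG] := choice (fun x => implicit_step lam_gt0 B_ge0 A_sym A_ell
    A_bd L_ge0 v_lip x (h0 N)).
  by exists G.
(* A single ultrafilter finer than [\oo] gives the limits at all times and of all momenta at once,
   with no extraction of subsequences. *)
have [U [UU sU]] := @ultraFilterLemma nat \oo _.
pose E N t := euler A (h N) (G N) x0 (grid_index N t).
pose P N t := euler_p A (h N) (G N) x0 p0 (grid_index N t).
have h_U : h @ U --> (0 : R).
  apply: cvg_trans (@cvg_harmonic R); exact: cvg_app sU.
have gi0 N : grid_index N 0 = 0%N by rewrite /grid_index mul0r truncn0.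
have lipE N j i : `|euler A (h N) (G N) x0 (j + i) - euler A (h N) (G N) x0 j| <= h N * i%:R * M1.
  exact: (euler_lip A_bd sd_bd (h0 N) (HG N) p0_sd).
have E_lip N s t : `|E N t - E N s| <= M1 * (`|t - s| + h N).
  wlog st : s t / s <= t.
    move=> W; have [|/ltW] := leP s t; first exact: W.
    by rewrite distrC [`|t - s|]distrC; exact: W.
  have [i [Ei i1 _]] := grid_indexP N st.
  rewrite /E Ei; apply: le_trans (lipE N _ _) _.
  rewrite mulrC ler_wpM2l// mulrC ger0_norm ?subr_ge0//.
have E0 N : E N 0 = x0 by rewrite /E gi0.
have /choice[X HX] : forall t, exists l, `|E N t - l| @[N --> U] --> (0 : R).
  move=> t; apply: (@ultra_limit _ _ _ UU _ (`|x0| + M1 * (`|t| + 1))) => N.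
  have := ler_normD (E N t - x0) x0; rewrite subrK => /le_trans; apply.
  rewrite addrC lerD2l -[in leLHS](E0 N); apply: le_trans (E_lip N 0 t) _.
  by rewrite subr0 ler_wpM2l// lerD2l invf_le1// ler1n.
have cdotp q t : dotp q (E N t) @[N --> U] --> dotp q (X t).
  apply: (cvg_dominated (K := n%:R * `|q|) _ (HX t)) => N.
  by rewrite -dotpNr -dotpDr; exact: ler_dotp.
have cdotpB q s t : dotp q (E N t - E N s) @[N --> U] --> dotp q (X t - X s).
  rewrite dotpDr dotpNr; under eq_fun do rewrite dotpDr dotpNr.
  by apply: cvgB; exact: cdotp.
have cv t : v (E N t) @[N --> U] --> v (X t).
  by apply: (cvg_dominated (K := L) _ (HX t)) => N; exact: v_lip.
have lim_le (f : nat -> R) a b : f @ U --> a -> (forall N, f N <= b) -> a <= b.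
  by move=> fa fb; apply: (ler_cvg_to fa (cvg_cst b)); near=> N; exact: fb.
exists X; split.
- apply/eqP; rewrite -subr_eq0 -normr_eq0 eq_le normr_ge0 andbT.
  have : (fun N => `|E N 0 - X 0|) @ U --> (0 : R) by exact: HX.
  under eq_fun do rewrite E0; move=> /(cvg_unique _ (cvg_cst _)).
  by rewrite distrC => ->//; exact: Rhausdorff.
- move=> s t.
  have H : `|E N t - X t| + M1 * (`|t - s| + h N) + `|E N s - X s| @[N --> U] -->
      0 + M1 * (`|t - s| + 0) + (0 : R).
    apply: cvgD (HX s); apply: cvgD (HX t) _; apply: cvgM; first exact: cvg_cst.
    by apply: cvgD; [exact: cvg_cst|].
  rewrite add0r !addr0 in H; apply: (ler_cvg_to (cvg_cst _) H).
  near=> N.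
  have -> : X t - X s = - (E N t - X t) + (E N t - E N s) + (E N s - X s).
    by apply/rowP => i; rewrite !mxE; ring.
  apply: le_trans (ler_normD _ _) _; rewrite lerD2r.
  by apply: le_trans (ler_normD _ _) _; rewrite normrN lerD2l.
- move=> t t0.
  have P_sd N : superdiff v (E N t) (P N t) by exact: (euler_sd (HG N) p0_sd).
  (* The momenta at time t converge along the same ultrafilter, and closedness of the graph of D+v
     places the limit over X t. *)
  have [p Hp] := @ultra_limit _ _ _ UU (fun N => P N t) L (fun N => sd_bd (P_sd N)).
  have pc : superdiff v (X t) p.
    apply: (superdiff_closed C_ge0 L_ge0 v_lip v_sc) => e e0.
    have [N [H1 H2]] : exists N, `|E N t - X t| < e /\ `|P N t - p| < e.
      apply: (@filter_ex _ U); near=> N; split.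
        by near: N; move/cvgrPdist_lt : (HX t) => /(_ e e0); apply: filterS => N;
          rewrite sub0r normrN normr_id.
      by near: N; move/cvgrPdist_lt : Hp => /(_ e e0); apply: filterS => N;
        rewrite sub0r normrN normr_id.
    exists (E N t), (P N t); split; [exact: H1|exact: H2|exact: P_sd].
  exists p => //.
  have cq : quad A (X t) (P N t) @[N --> U] --> quad A (X t) p.
    apply: (cvg_dominated (K := n%:R ^+ 2 * (2 * L) * B) _ Hp) => N.
    have -> : quad A (X t) (P N t) - quad A (X t) p =
        dotp ((P N t - p) *m A (X t)) (P N t + p).
      have E1 : dotp (p *m A (X t)) (P N t) = dotp (P N t *m A (X t)) p.
        by rewrite (dotp_mulA A_sym) dotpC.
      by rewrite mulmxBl !dotpDl !dotpNl !dotpDr E1 /quad; ring.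
    apply: le_trans (ler_bilin _ _ _) _.
    have b1 : `|P N t + p| <= 2 * L.
      apply: le_trans (ler_normD _ _) _.
      by have := sd_bd (P_sd N); have := sd_bd pc; lra.
    have -> : n%:R ^+ 2 * (2 * L) * B * `|P N t - p| =
              n%:R ^+ 2 * `|P N t - p| * (2 * L) * B by ring.
    by apply: ler_pM => //; rewrite ler_wpM2l.
  have cH : hamiltonian A V (E N t) (P N t) @[N --> U] --> hamiltonian A V (X t) p.
    rewrite hamiltonianE; under eq_fun do rewrite hamiltonianE.
    apply: cvgD; last first.
      by apply: (cvg_dominated (K := B) _ (HX t)) => N; exact: V_lip.
    apply: cvgM; first exact: cvg_cst.
    rewrite -[X in _ --> X]addr0.
    have -> : (fun N => quad A (E N t) (P N t)) = (fun N => quad A (X t) (P N t) +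
        (quad A (E N t) (P N t) - quad A (X t) (P N t))).
      by apply/funext => N; ring.
    apply: cvgD; first exact: cq.
    apply: (cvg_dominated (K := n%:R ^+ 2 * L * L * B) _ (HX t)) => N.
    have -> : quad A (E N t) (P N t) - quad A (X t) (P N t) - 0 =
        dotp (P N t *m (A (E N t) - A (X t))) (P N t).
      by rewrite subr0 mulmxBr dotpDl dotpNl.
    apply: le_trans (ler_bilin _ _ _) _.
    rewrite -[leRHS]mulrA; apply: ler_pM => //.
    by apply: ler_pM => //; [rewrite ler_wpM2l// |]; exact: sd_bd (P_sd N).
  apply: lim_le cH _ => N.
  have := euler_hamiltonian lam_gt0 B_ge0 A_sym A_ell A_bd A_lip V_lip C_ge0 L_ge0
    sd_bd v_sc (h0 N) (HG N) p0_sd (grid_index N t).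
  move=> /le_trans; apply; rewrite lerD2l ler_wpM2r//.
    by rewrite addr_ge0 ?mulr_ge0 ?sqr_ge0// addr_ge0// !mulr_ge0// sqr_ge0.
  by rewrite ler_pdivrMr// truncn_le mulr_ge0.
- move=> s t q Q s0 st qQ.
  have /choice[i Hi] := fun N => grid_indexP N st.
  have ci : (i N)%:R * h N @[N --> U] --> t - s.
    apply: (cvg_dominated (K := 1) _ h_U) => N; rewrite mul1r ler_norml.
    have [_ i1 /(_ s0) i2] := Hi N; rewrite -/(h N) in i1 i2; lra.
  have cL : 2 * dotp q (E N t - E N s) - (i N)%:R * h N * (quad A (X s) q
        + n%:R ^+ 2 * Q ^+ 2 * B * (M1 * ((i N)%:R * h N) + `|E N s - X s|) + C * h N * M1 ^+ 2)
     @[N --> U] --> 2 * dotp q (X t - X s) - (t - s) * (quad A (X s) q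
        + n%:R ^+ 2 * Q ^+ 2 * B * (M1 * (t - s) + 0) + C * 0 * M1 ^+ 2).
    apply: cvgB; first by apply: cvgM; [exact: cvg_cst|exact: cdotpB].
    apply: (cvgM ci); apply: cvgD; last first.
      apply: cvgM; last exact: cvg_cst.
      by apply: cvgM; [exact: cvg_cst|].
    apply: cvgD; first exact: cvg_cst.
    apply: cvgM; first exact: cvg_cst.
    apply: cvgD; last exact: HX.
    by apply: (cvgM (cvg_cst _) ci).
  rewrite mulr0 mul0r !addr0 in cL.
  have cvB : v (E N t) - v (E N s) @[N --> U] --> v (X t) - v (X s) by exact: cvgB.
  apply: (ler_cvg_to cL cvB); near=> N.
  have [Ei _ _] := Hi N; rewrite ![E N t]/E Ei.
  apply: (euler_gain lam_gt0 B_ge0 A_sym A_ell A_bd A_lip C_ge0 L_ge0 sd_bd v_sc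
    (h0 N) (HG N) p0_sd qQ) => l li.
  have := ler_normD (euler A (h N) (G N) x0 (grid_index N s + l) - E N s) (E N s - X s).
  rewrite addrA subrK => /le_trans; apply; rewrite lerD2r.
  apply: le_trans (lipE N _ _) _; rewrite mulrC ler_wpM2l// mulrC ler_wpM2r ?(ltW (h0 N))//.
  by rewrite ler_nat.
- move=> s t q r eps s0 st qL Hr tr.
  have /choice[i Hi] := fun N => grid_indexP N st.
  have ci : (i N)%:R * h N @[N --> U] --> t - s.
    apply: (cvg_dominated (K := 1) _ h_U) => N; rewrite mul1r ler_norml.
    have [_ i1 /(_ s0) i2] := Hi N; rewrite -/(h N) in i1 i2; lra.
  have cD : M1 * ((i N)%:R * h N) + `|E N s - X s| @[N --> U] --> M1 * (t - s) + 0.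
    apply: cvgD; last exact: HX.
    by apply: (cvgM (cvg_cst _) ci).
  have cL : (i N)%:R * h N * (quad A (X s) q - eps
        - n%:R ^+ 2 * L ^+ 2 * B * (M1 * ((i N)%:R * h N) + `|E N s - X s|))
     @[N --> U] --> (t - s) * (quad A (X s) q - eps - n%:R ^+ 2 * L ^+ 2 * B * (M1 * (t - s) + 0)).
    apply: (cvgM ci); apply: cvgB; first exact: cvg_cst.
    by apply: cvgM; [exact: cvg_cst|].
  rewrite addr0 in cL cD.
  apply: (ler_cvg_to cL (cdotpB q s t)); near=> N.
  have [Ei _ _] := Hi N; rewrite [E N t]/E Ei.
  (* For almost all N, all nodes used between s and t lie in the ball around X s on which [Hr]
     controls the momenta. *)
  have Dr : M1 * ((i N)%:R * h N) + `|E N s - X s| < r.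
    by near: N; apply: (cvgr_lt _ cD).
  have HD l : (l <= i N)%N -> `|euler A (h N) (G N) x0 (grid_index N s + l) - X s| <=
      M1 * ((i N)%:R * h N) + `|E N s - X s|.
    move=> li.
    have := ler_normD (euler A (h N) (G N) x0 (grid_index N s + l) - E N s) (E N s - X s).
    rewrite addrA subrK => /le_trans; apply; rewrite lerD2r.
    apply: le_trans (lipE N _ _) _; rewrite mulrC ler_wpM2l// mulrC ler_wpM2r ?(ltW (h0 N))//.
    by rewrite ler_nat.
  apply: (euler_progress B_ge0 A_sym A_lip sd_bd (h0 N) (HG N) p0_sd qL HD) => l li.
  apply: (Hr (euler A (h N) (G N) x0 (grid_index N s + l))).
    by apply: le_lt_trans Dr; exact: HD.
  exact: (euler_sd (HG N) p0_sd).
Unshelve. all: by end_near. Qed.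

End GradientFlow.

(** * Right derivatives of limit arcs *)

Section RightDerivative.
Context {R : realType} {n : nat}.
Context (A : 'rV[R]_n -> 'M[R]_n) (V : 'rV[R]_n -> R) (lam B : R).
Context (lam_gt0 : 0 < lam) (B_ge0 : 0 <= B) (A_sym : forall x, (A x)^T = A x).
Context (A_ell : forall x p, lam * `|p| ^+ 2 <= quad A x p).
Context (A_bd : forall x, `|A x| <= B).
Context (A_lip : forall x y, `|A x - A y| <= B * `|x - y|).
Context (V_lip : forall x y, `|V x - V y| <= B * `|x - y|).
Context (v : 'rV[R]_n -> R) (C L : R).
Context (C_ge0 : 0 <= C) (L_ge0 : 0 <= L).
Context (v_lip : forall x y, `|v x - v y| <= L * `|x - y|).
Context (sd_bd : forall x p, superdiff v x p -> `|p| <= L).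
Context (v_sc : forall x p, superdiff v x p ->
  forall y, v y <= v x + dotp p (y - x) + C * `|y - x| ^+ 2).
Implicit Types (p q x y z : 'rV[R]_n).

Lemma superdiff_minimal_usc y q eps : 0 < eps -> `|q| <= L ->
  (forall p, superdiff v y p -> 0 <= dotp (q *m A y) (p - q)) ->
  exists2 r, 0 < r & forall z p, `|z - y| < r -> superdiff v z p ->
    - eps <= dotp (q *m A y) (p - q).
Proof.
move=> eps0 qL Hq.
have K0 : 0 < n%:R * (n%:R * L * B) + 1 by rewrite ltr_wpDl//; nonneg.
have e0 : 0 < eps / (n%:R * (n%:R * L * B) + 1) by rewrite divr_gt0.
have [r r0 Hr] := superdiff_usc C_ge0 L_ge0 v_lip sd_bd v_sc y e0.
exists r => // z p zr Sp; have [p' Sp' pp] := Hr z p zr Sp.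
have -> : p - q = (p' - q) + (p - p') by apply/rowP => i; rewrite !mxE; ring.
rewrite dotpDr; have := Hq _ Sp'.
have : `|dotp (q *m A y) (p - p')| <= eps.
  apply: le_trans (ler_dotp _ _) _.
  apply: le_trans (_ : n%:R * (n%:R * L * B) * `|p - p'| <= _).
    by rewrite ler_wpM2r// ler_wpM2l//; exact: ler_mulA.
  move: pp; rewrite ltr_pdivlMr// => /ltW pp; apply: le_trans pp.
  by rewrite mulrC ler_wpM2l// lerDl.
by rewrite ler_norml; lra.
Qed.

(** Let r be the momentum of the mean velocity on [s, t]. Up to O(t - s), the gain bounds <A r, r>
    by <A q, r>, since q in D+v(X s) bounds the increment of v; progress bounds <A q, q> by <A q, r>
    plus eps. Hence <A(r - q), r - q> is small. *)
Lemma gradient_flow_right_derivative x0 p0 : superdiff v x0 p0 ->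
  exists (X : R -> 'rV[R]_n) (K : R), [/\ X 0 = x0, 0 <= K,
    forall s t, `|X t - X s| <= K * `|t - s|,
    forall t, 0 <= t -> exists2 p, superdiff v (X t) p &
      hamiltonian A V (X t) p <= hamiltonian A V x0 p0 + K * t &
    forall s, 0 <= s -> exists2 q, superdiff v (X s) q &
      (t - s)^-1 *: (X t - X s) @[t --> s^'+] --> q *m A (X s)].
Proof.
move=> p0_sd.
have [X [X0 X_lip X_H X_gain X_prog]] := gradient_flow lam_gt0 B_ge0 A_sym A_ell
  A_bd A_lip V_lip C_ge0 L_ge0 v_lip sd_bd v_sc p0_sd.
have [M1 M1E] : exists M, M = n%:R * L * B by eexists.
rewrite -M1E in X_lip X_H X_gain X_prog.
have M10 : 0 <= M1 by rewrite M1E; nonneg.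
have [K2 K2E] : exists K, K = 2 * C * M1 ^+ 2 + (n%:R ^+ 2 * L ^+ 2 * B + B) * M1 by eexists.
have K20 : 0 <= K2.
  by rewrite K2E addr_ge0 ?mulr_ge0 ?sqr_ge0// addr_ge0// !mulr_ge0// sqr_ge0.
exists X, (M1 + K2); split => //; first exact: addr_ge0.
- move=> s t; apply: le_trans (X_lip s t) _; rewrite ler_wpM2r//.
  by rewrite lerDl.
- move=> t t0; have [p Sp Hp] := X_H t t0; exists p => //.
  apply: le_trans Hp _; rewrite lerD2l -K2E mulrC ler_wpM2r//.
  by rewrite lerDr.
move=> s s0; have [q Sq Hq] := superdiff_minimal lam_gt0 A_sym A_ell C_ge0 L_ge0
  v_lip sd_bd v_sc (X s).
exists q => //.
have qL := sd_bd Sq.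
(* Q bounds the momentum of any mean velocity, whose norm is at most M1. *)
pose y := X s; pose Q := n%:R * M1 * `|invmx (A y)|.
have Q0 : 0 <= Q by rewrite /Q; nonneg.
(* c1 collects the errors of gain and semiconcavity, c2 that of progress, each per squared unit of
   time. *)
pose c1 := n%:R ^+ 2 * Q ^+ 2 * B * M1 + C * M1 ^+ 2.
pose c2 := n%:R ^+ 2 * L ^+ 2 * B * M1.
have c10 : 0 <= c1 by rewrite /c1 addr_ge0// !mulr_ge0// sqr_ge0.
have c20 : 0 <= c2 by rewrite /c2 !mulr_ge0// sqr_ge0.
apply/cvgrPdist_le => /= eps eps0.
have nB : 0 < n%:R * B + 1 by rewrite ltr_wpDl// mulr_ge0.
pose eta := eps / (n%:R * B + 1).
have eta0 : 0 < eta by rewrite divr_gt0.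
have le0 : 0 < lam * eta ^+ 2 / 2 by rewrite divr_gt0// mulr_gt0// exprn_gt0.
(* Half of lam eta^2 is granted to the failure of minimality near y, the other half to (c1 + c2) (t
   - s). *)
have [r r0 Hr] := superdiff_minimal_usc le0 qL Hq.
have q1 : 0 < M1 + 1 by rewrite ltr_wpDl.
have q2 : 0 < c1 + c2 + 1 by rewrite ltr_wpDl// addr_ge0.
have d0 : 0 < Num.min (r / (M1 + 1)) (lam * eta ^+ 2 / 2 / (c1 + c2 + 1)).
  by rewrite lt_min; apply/andP; split; exact: divr_gt0.
near=> t.
have st : s < t by near: t; exact: nbhs_right_gt.
have [d dE] : exists d, d = t - s by eexists.
have dp : 0 < d by rewrite dE subr_gt0.
have : d < Num.min (r / (M1 + 1)) (lam * eta ^+ 2 / 2 / (c1 + c2 + 1)).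
  rewrite dE ltrBlDl; near: t; apply: nbhs_right_lt; by rewrite ltrDl.
rewrite lt_min => /andP[dr dl].
have Mr : M1 * d < r.
  by move: dr; rewrite ltr_pdivlMr//; lra.
have cd : (c1 + c2) * d <= lam * eta ^+ 2 / 2.
  by move: dl; rewrite ltr_pdivlMr// => /ltW; apply: le_trans; rewrite mulrC ler_wpM2l ?(ltW dp)// lerDl.
have Au := A_unit lam_gt0 A_ell y.
have [w wE] : exists w, w = d^-1 *: (X t - X s) by eexists.
have [rr rrE] : exists rr, rr = w *m invmx (A y) by eexists.
have wA : w = rr *m A y by rewrite rrE mulmxKV.
have XE : X t - X s = d *: (rr *m A y) by rewrite -wA wE scalerA divff ?scale1r// gt_eqF.
have wM : `|w| <= M1.
  rewrite wE normrZ gtr0_norm ?invr_gt0// mulrC ler_pdivrMr// dE.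
  by have := X_lip s t; rewrite (gtr0_norm (_ : 0 < t - s)) ?subr_gt0.
have rQ : `|rr| <= Q.
  rewrite rrE; apply: le_trans (ler_norm_mulmx _ _) _.
  by rewrite /Q ler_wpM2r// ler_wpM2l.
have gain := X_gain s t rr Q s0 (ltW st) rQ.
have prog := X_prog s t q r _ s0 (ltW st) qL Hr.
rewrite -dE in gain prog; have {}prog := prog Mr.
have sc := v_sc Sq (X t).
rewrite XE !dotpZr -/y in gain prog sc.
have E1 : dotp rr (rr *m A y) = quad A y rr by rewrite dotpC.
rewrite E1 in gain.
have nX : C * `|d *: (rr *m A y)| ^+ 2 <= C * M1 ^+ 2 * d ^+ 2.
  rewrite -mulrA ler_wpM2l// -exprMn lerXn2r ?nnegrE ?mulr_ge0 ?(ltW dp)//.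
  by rewrite normrZ gtr0_norm// -wA mulrC ler_wpM2r// ltW.
have key : quad A y (rr - q) <= lam * eta ^+ 2.
  rewrite (quadB A_sym) (dotpC _ q) -(ler_pM2l dp).
  have := ler_wpM2l (ltW dp) cd.
  have e1 : d * ((c1 + c2) * d) = n%:R ^+ 2 * Q ^+ 2 * B * (M1 * d) * d + C * M1 ^+ 2 * d ^+ 2
    + n%:R ^+ 2 * L ^+ 2 * B * (M1 * d) * d by rewrite /c1 /c2; ring.
  rewrite e1; lra.
have rq : `|rr - q| <= eta.
  rewrite -(@ler_pXn2r _ 2) ?nnegrE ?(ltW eta0)//.
  by rewrite -(ler_pM2l lam_gt0); apply: le_trans (A_ell _ _) key.
rewrite -dE -wE wA -mulmxBl; apply: le_trans (ler_norm_mulmx _ _) _.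
rewrite distrC; apply: le_trans (_ : n%:R * eta * B <= _).
  by apply: ler_pM => //; rewrite ler_wpM2l.
rewrite /eta mulrAC mulrA ler_pdivrMr// mulrC ler_wpM2l ?(ltW eps0)//.
by rewrite lerDl.
Unshelve. all: by end_near. Qed.

End RightDerivative.

(** * Lipschitz functions of one variable *)

Section LipschitzDerivable.
Context {R : realType}.
Implicit Types (f g : R -> R) (a b s t x : R).
Notation mu := (@lebesgue_measure R).

Lemma lipschitz_continuous f (K : R) :
  (forall s t, `|f t - f s| <= K * `|t - s|) -> continuous f.
Proof.
move=> fK x; apply/cvgrPdist_lt => /= e e0.
have K1 : 0 < `|K| + 1 by rewrite ltr_wpDl.
near=> t.
apply: le_lt_trans (fK t x) _.
apply: le_lt_trans (_ : (`|K| + 1) * `|x - t| < e).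
  by rewrite ler_wpM2r// (le_trans (ler_norm K))// lerDl.
rewrite mulrC -ltr_pdivlMr//; near: t; apply: (@cvgr_dist_lt _ _ _ (nbhs x)) => //.
by rewrite divr_gt0.
Unshelve. all: by end_near. Qed.

Lemma right_derivative_seq f s (l : R) :
  (t - s)^-1 * (f t - f s) @[t --> s^'+] --> l ->
  N.+1%:R * (f (s + N.+1%:R^-1) - f s) @[N --> \oo] --> l.
Proof.
move=> /cvg_at_rightP/(_ (fun N => s + N.+1%:R^-1)) H.
have : (fun t => (t - s)^-1 * (f t - f s)) (s + N.+1%:R^-1) @[N --> \oo] --> l.
  apply: H; split=> [N|]; first by rewrite ltrDl invr_gt0.
  rewrite -[X in _ --> X]addr0; apply: cvgD; first exact: cvg_cst.
  exact: cvg_harmonic.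
apply: cvg_trans; apply: near_eq_cvg; apply: nearW => N /=.
by rewrite addrC addKr invrK.
Qed.

(* With Phi a primitive of f, the integral over [a, b] of the difference quotient
   (f (t + h) - f t) / h is a difference of difference quotients of Phi; dominated
   convergence as h -> 0 gives f b - f a = \int_[a, b] g. *)
Lemma integral_right_derivative f g (K a b : R) : a < b ->
  (forall s t, `|f t - f s| <= K * `|t - s|) ->
  (forall s, (t - s)^-1 * (f t - f s) @[t --> s^'+] --> g s) ->
  mu.-integrable `[a, b] (EFin \o g) /\
  (\int[mu]_(t in `[a, b]) (g t)%:E = (f b - f a)%:E)%E.
Proof.
move=> ab fK fg; have cf := lipschitz_continuous fK.
(* Starting the primitive to the left of a makes it differentiable on both sides at a. *)
pose a0 := a - 1.
pose Phi x := (\int[mu]_(t in `[a0, x]) f t)%R.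
have dPhi x : a0 < x -> is_derive x 1 Phi (f x).
  move=> ax; have xu : x < x + 1 by rewrite ltrDl.
  have [] := @continuous_FTC1_closed R f a0 x (x + 1) xu _ ax (cf x).
    apply: continuous_compact_integrable; first exact: segment_compact.
    exact: continuous_subspaceT.
  by rewrite derive1E => d1 d2; constructor.
pose g_ N t := N.+1%:R * (f (t + N.+1%:R^-1) - f t).
pose Psi N t := N.+1%:R * (Phi (t + N.+1%:R^-1) - Phi t).
have dPsi N t : a0 < t -> is_derive t 1 (Psi N) (g_ N t).
  move=> at0; have at1 : a0 < t + N.+1%:R^-1 by rewrite (lt_trans at0)// ltrDl invr_gt0.
  have d1 := dPhi _ at0; have d2 := dPhi _ at1.
  have d3 : is_derive t 1 (fun t => Phi (t + N.+1%:R^-1)) (f (t + N.+1%:R^-1)).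
    have d4 : is_derive t 1 (fun t : R => t + N.+1%:R^-1) 1 by exact: is_derive_shift.
    have d5 := @is_derive1_comp R Phi (fun t : R => t + N.+1%:R^-1) t _ _ d2 d4.
    by rewrite mulr1 in d5.
  have d6 := is_deriveB d3 d1.
  by have := @is_deriveZ _ _ _ _ N.+1%:R _ _ _ d6.
have cg N : continuous (g_ N).
  move=> t; apply: (@cvgM _ _ (nbhs t) _ (fun=> N.+1%:R)); first exact: cvg_cst.
  apply: cvgB; last exact: cf.
  apply: (@cvg_comp _ _ _ (fun t => t + N.+1%:R^-1) f _ (nbhs (t + N.+1%:R^-1))); last exact: cf.
  by apply: cvgD; [exact: cvg_id|exact: cvg_cst].
have intg N : (\int[mu]_(t in `[a, b]) (g_ N t)%:E = (Psi N b - Psi N a)%:E)%E.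
  have cPsi x : a0 < x -> {for x, continuous (Psi N)}.
    move=> ax; apply/differentiable_continuous/derivable1_diffP.
    by have [] := dPsi N x ax.
  have a0a : a0 < a by rewrite /a0 ltrBlDr ltrDl.
  rewrite (@continuous_FTC2 R (g_ N) (Psi N) a b ab)//.
  - by apply: continuous_subspaceT.
  - split.
    + move=> x; rewrite in_itv/= => /andP[ax _].
      by have [] := dPsi N x (lt_trans a0a ax).
    + exact: cvg_at_right_filter (cPsi _ a0a).
    + exact: cvg_at_left_filter (cPsi _ (lt_trans a0a ab)).
  - move=> x; rewrite in_itv/= => /andP[ax _]; rewrite derive1E.
    by have [] := dPsi N x (lt_trans a0a ax).
have cvPsi x : a0 < x -> Psi N x @[N --> \oo] --> f x.
  move=> ax; apply: right_derivative_seq.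
  have [dx <-] := dPhi _ ax.
  have : (fun h => h^-1 *: (Phi (h *: 1 + x) - Phi x)) @ 0^' --> 'D_1 Phi x by exact: dx.
  move=> /cvg_dnbhs_at_right H.
  have : (fun h => h^-1 *: (Phi (h *: 1 + x) - Phi x)) (t - x) @[t --> x^'+] --> 'D_1 Phi x.
    apply: cvg_comp H.
    move=> P /nbhs_ballP[e /= e0 He]; apply/nbhs_ballP; exists e => //= t xt tx.
    apply: He; last by rewrite subr_gt0.
    by move: xt; rewrite /ball/= sub0r normrN distrC.
  apply: cvg_trans; apply: near_eq_cvg; apply: nearW => t /=.
  by rewrite [(t - x) *: 1]mulr1 subrK.
have gK t N : `|g_ N t| <= K.
  rewrite /g_ normrM gtr0_norm// mulrC -ler_pdivlMr//.
  by apply: le_trans (fK _ _) _; rewrite addrC addKr gtr0_norm ?invr_gt0.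
have gg t : g_ N t @[N --> \oo] --> g t by exact: right_derivative_seq.
have mg : measurable_fun `[a, b] g.
  apply: (@measurable_realfun.measurable_fun_cvg _ _ _ _ (fun N => g_ N)) => // N.
  by apply: measurable_funTS; apply: continuous_measurable_fun; exact: cg.
have mg_ N : measurable_fun `[a, b] (EFin \o g_ N).
  by apply/measurable_EFinP; apply: measurable_funTS; apply: continuous_measurable_fun; exact: cg.
have iK : mu.-integrable `[a, b] (cst K%:E).
  apply: (@measurable_bounded_integrable _ _ _ mu (cst K)) => //.
    by rewrite /= lebesgue_measure_itv/= lte_fin ab -EFinB ltry.
  by exists `|K|; split; [exact: num_real|move=> r Kr x _ /=; exact: ltW].
have mEg : measurable_fun `[a, b] (EFin \o g) by apply/measurable_EFinP.
have [||intg' _ cvint] := @dominated_convergence _ _ R mu `[a, b] (measurable_itv _)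
  (fun N => EFin \o g_ N) (EFin \o g) (cst K%:E) mg_ mEg _ iK.
- by apply: aeW => x _; apply: cvg_EFin; [exact: nearW|exact: gg].
- by apply: aeW => x N _; rewrite /= lee_fin.
split => //.
have cvfab : (Psi N b - Psi N a)%:E @[N --> \oo] --> (f b - f a)%:E.
  apply: cvg_EFin; first by near=> N.
  by apply: cvgB; apply: cvPsi; rewrite /a0; move: ab; lra.
have E : (fun N => \int[mu]_(x in `[a, b]) (EFin \o g_ N) x)%E =
    (fun N => (Psi N b - Psi N a)%:E) by apply/funext => N; exact: intg.
rewrite /= E in cvint.
exact: (cvg_unique _ cvint cvfab).
Unshelve. all: by end_near. Qed.

(** f is, up to a constant, the integral of g from a. As a pointwise limit of bounded continuous
    quotients g is measurable and bounded, so Lebesgue differentiation applies. *)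
Lemma lipschitz_right_derivative_ae f g (K : R) :
  (forall s t, `|f t - f s| <= K * `|t - s|) ->
  (forall s, (t - s)^-1 * (f t - f s) @[t --> s^'+] --> g s) ->
  forall a, {ae mu, forall s, a < s -> derivable f s 1}.
Proof.
move=> fK fg a.
have gK t : `|g t| <= K.
  have : `|N.+1%:R * (f (t + N.+1%:R^-1) - f t)| @[N --> \oo] --> `|g t|.
    by apply: cvg_norm; exact: right_derivative_seq.
  move=> H; apply: (ler_cvg_to H (cvg_cst K)); apply: nearW => N.
  rewrite normrM gtr0_norm// mulrC -ler_pdivlMr//.
  by apply: le_trans (fK _ _) _; rewrite addrC addKr gtr0_norm ?invr_gt0.
have cf := lipschitz_continuous fK.
have mg : measurable_fun setT g.
  apply: (@measurable_realfun.measurable_fun_cvg _ _ _ _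
    (fun N t => N.+1%:R * (f (t + N.+1%:R^-1) - f t))) => [N|t _].
    apply: continuous_measurable_fun => t.
    apply: (@cvgM _ _ (nbhs t) _ (fun=> N.+1%:R)); first exact: cvg_cst.
    apply: cvgB; last exact: cf.
    apply: (@cvg_comp _ _ _ (fun t => t + N.+1%:R^-1) f _ (nbhs (t + N.+1%:R^-1))); last exact: cf.
    by apply: cvgD; [exact: cvg_id|exact: cvg_cst].
  exact: right_derivative_seq.
have bg (D : set R) : [bounded g t | t in D].
  exists K; split; first exact: num_real.
  by move=> r Kr t _ /=; apply: le_trans (gK t) (ltW Kr).
have lg : locally_integrable setT g.
  split => //; first exact: openT.
  move=> D _ cD.
  have /integrableP[_] : mu.-integrable D (EFin \o g).
    apply: measurable_bounded_integrable => //.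
    - exact: compact_measurable.
    - exact: compact_finite_measure.
    - exact: measurable_funTS.
  by [].
have ig y : mu.-integrable [set` Interval (BLeft a) (BRight y)] (EFin \o g).
  apply: measurable_bounded_integrable => //.
  - by rewrite /= lebesgue_measure_itv/=; case: ifPn => // _; rewrite -EFinB ltry.
  - exact: measurable_funTS.
have := FTC1 ig lg; apply: filterS; first exact: (ae_filter_ringOfSetsType mu).
move=> s /= H s_a.
have [|dF _] := H; first by rewrite lte_fin.
have df : derivable (fun x => f a + (\int[mu]_(t in `[a, x]) g t)%R) s 1.
  by apply: derivableD; [exact: derivable_cst|exact: dF].
apply: near_eq_derivable df; near=> t.
have at' : a < t by near: t; exact: lt_nbhsr.
have [_ ] := integral_right_derivative at' fK fg.
by rewrite /Rintegral => -> /=; rewrite addrC subrK.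
Unshelve. all: by end_near. Qed.

End LipschitzDerivable.

Section VectorDerivable.
Context {R : realType} {n : nat}.
Notation mu := (@lebesgue_measure R).

Lemma arc_derivable_ae (X : R -> 'rV[R]_n) (K : R) :
  (forall s t, `|X t - X s| <= K * `|t - s|) ->
  (forall s, 0 <= s -> exists d : 'rV[R]_n, (t - s)^-1 *: (X t - X s) @[t --> s^'+] --> d) ->
  {ae mu, forall s, 0 < s -> derivable X s 1}.
Proof.
move=> XK Xd.
have K0 : 0 <= K.
  by have := XK 0 1; rewrite subr0 normr1 mulr1; apply: le_trans.
(* Freezing the arc before time 0 gives every coordinate a right derivative on the whole line. *)
pose f i t := X (Num.max 0 t) 0 i.
have fK i s t : `|f i t - f i s| <= K * `|t - s|.
  have := ler_coord (X (Num.max 0 t) - X (Num.max 0 s)) i; rewrite !mxE => /le_trans; apply.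
  apply: le_trans (XK _ _) _; rewrite ler_wpM2l//.
  have [t0|t0] := leP t 0; have [s0|s0] := leP s 0.
  - by rewrite subrr normr0.
  - by rewrite sub0r normrN [leRHS]distrC !ger0_norm; lra.
  - by rewrite subr0 !ger0_norm; lra.
  - by [].
have /choice[g Hg] : forall i, exists g : R -> R, forall s, (t - s)^-1 * (f i t - f i s) @[t --> s^'+] --> g s.
  move=> i.
  suff /choice[g Hg] : forall s, exists l : R, (t - s)^-1 * (f i t - f i s) @[t --> s^'+] --> l.
    by exists g.
  move=> s.
  have [s0|s0] := leP 0 s.
    have [d Hd] := Xd s s0; exists (d 0 i).
    have := cvg_comp _ _ Hd (@coord_continuous _ _ _ 0 i d).
    apply: cvg_trans; apply: near_eq_cvg; near=> t.
    have st : s < t by near: t; exact: nbhs_right_gt.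
    rewrite /= !mxE /f (max_r (ltW (le_lt_trans s0 st))) (max_r s0).
    by [].
  exists 0; apply: cvg_near_cst; near=> t.
  have t0 : t < 0 by near: t; exact: nbhs_right_lt.
  by rewrite /f (max_l (ltW t0)) (max_l (ltW s0)) subrr mulr0.
have H i := lipschitz_right_derivative_ae (fK i) (Hg i) 0.
have := @filter_forall _ _ (fun i => [set s | 0 < s -> derivable (f i) s 1]) _
  (ae_filter_ringOfSetsType mu) H.
apply: filterS; first exact: (ae_filter_ringOfSetsType mu).
move=> s /= Hs s0; apply/derivable_mxP => j i; rewrite (ord1 j).
apply: near_eq_derivable (Hs i s0); near=> t.
have t0 : 0 < t by near: t; exact: lt_nbhsr.
by rewrite /f (max_r (ltW t0)).
Unshelve. all: by end_near. Qed.

End VectorDerivable.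

(** * Monotonicity from an almost everywhere left condition *)

Section Monotonicity.
Context {R : realType}.
Implicit Types (f : R -> R) (a b s t x : R).
Notation mu := (@lebesgue_measure R).

(* The exceptional null set is covered by an open U of measure < eta; adding
   K mu(U /\ ]a, t]) to f makes the left Dini condition hold everywhere. *)
Lemma le_of_ae_left_dini f (K a b : R) : 0 <= K -> a <= b ->
  (forall s t, s \in `[a, b] -> t \in `[a, b] -> `|f t - f s| <= K * `|t - s|) ->
  {ae mu, forall t, a < t < b -> exists2 e, 0 < e &
     forall s, t - e < s -> s < t -> f s <= f t} ->
  f a <= f b.
Proof.
move=> K0 ab fK [N [mN N0 HN]].
have good t : ~ N t -> a < t < b -> exists2 e, 0 < e & forall s, t - e < s -> s < t -> f s <= f t.
  by move=> Nt; apply: contrapT => H; apply: Nt; apply: HN.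
apply/ler_addgt0Pr => eps eps0.
pose eta := eps / (K + 1).
have eta0 : 0 < eta by rewrite divr_gt0// ltr_wpDl.
(* The endpoint b is covered as well, since the left condition is available only at interior
   times. *)
pose D := N `|` [set b].
have mD : measurable D by apply: measurableU.
have D0 : (mu D = 0)%E by apply: null_set_setU => //; exact: lebesgue_measure_set1.
have [|U [oU DU muUD]] := lebesgue_regularity_outer mD _ eta0.
  by apply: (@le_lt_trans _ _ 0%E); [rewrite le_eqVlt; apply/orP; left; apply/eqP; exact: D0|rewrite ltry].
have mU : measurable U by exact: open_measurable.
have muU : (mu U < eta%:E)%E.
  have -> : U = (U `\` D) `|` D by rewrite setUC setDUK.
  apply: le_lt_trans (_ : mu (U `\` D) + mu D < _)%E.
    by apply: measureU2 => //; exact: measurableD.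
  by rewrite D0 adde0.
have mI t : measurable (U `&` `]a, t]) by apply: measurableI.
have fI t : (mu (U `&` `]a, t]) \is a fin_num)%E.
  rewrite ge0_fin_numE//; apply: le_lt_trans (_ : mu U < +oo)%E.
    by apply: le_measure; rewrite ?inE; [exact: mI|exact: mU|exact: subIsetl].
  by apply: lt_trans muU _; rewrite ltry.
pose g t := fine (mu (U `&` `]a, t])).
have g_nd s t : s <= t -> g s <= g t.
  move=> st; apply: fine_le => //; apply: le_measure; rewrite ?inE; [exact: mI|exact: mI|].
  by apply: setIS; apply: subset_itvl; rewrite bnd_simp.
have g_eta t : g t <= eta.
  rewrite -lee_fin fineK//; apply: le_trans (ltW muU).
  by apply: le_measure; rewrite ?inE; [exact: mI|exact: mU|exact: subIsetl].
have g_ge0 t : 0 <= g t by apply: fine_ge0.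
have g_U s t : a <= s -> s <= t -> `]s, t] `<=` U -> g t - g s = t - s.
  move=> as_ st stU.
  have E : U `&` `]a, t] = (U `&` `]a, s]) `|` `]s, t].
    apply/seteqP; split => [x [Ux]|x []].
    - rewrite /= !in_itv/= => /andP[ax xt]; have [xs|sx] := leP x s.
        by left; split => //; rewrite /= ?in_itv/= ax ?xs.
      by right; rewrite /= ?in_itv/= ?sx ?xt.
    - move=> [Ux]; rewrite /= !in_itv/= => /andP[ax xs]; split => //.
      by rewrite /= ?in_itv/= ax (le_trans xs).
    - move=> sxt; split; first exact: stU.
      by move: sxt; rewrite /= !in_itv/= => /andP[sx ->]; rewrite (le_lt_trans as_ sx).
  have : (mu (U `&` `]a, t]) = mu (U `&` `]a, s]) + (t - s)%:E)%E.
    rewrite E measureU; [|exact: mI|exact: measurable_itv|]; last first.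
      rewrite -subset0 => x [[_ /=]]; rewrite !in_itv/= => /andP[_ xs] /andP[sx _].
      by move: (lt_le_trans sx xs); rewrite ltxx.
    suff L : (mu `]s, t] = (t - s)%:E)%E by exact: (congr1 (adde (mu (U `&` `]a, s]))) L).
    rewrite lebesgue_measure_itv/= lte_fin.
    by case: ltP => [_|ts]; [rewrite EFinB|rewrite (@le_anti _ _ s t) ?st ?ts// subrr].
  move=> /(congr1 fine); rewrite fineD// -/(g t) -/(g s) => ->.
  by rewrite addrAC subrr add0r.
pose F t := f t + K * g t.
(* The infimum of these times is shown to be a; otherwise a slightly earlier time would still belong
   to the set. *)
pose S := [set s | s \in `[a, b] /\ F s <= F b].
have Sb : S b by split => //; rewrite in_itv/= ab lexx.
have lS : has_inf S.
  split; first by exists b.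
  by exists a => s [+ _]; rewrite in_itv/= => /andP[].
pose c := inf S.
have ac : a <= c by apply: lb_le_inf; [exists b|move=> s [+ _]; rewrite in_itv/= => /andP[]].
have cb : c <= b by apply: ge_inf => //; case: lS.
have cI : c \in `[a, b] by rewrite in_itv/= ac cb.
(* The infimum is attained: g is nondecreasing and f is K-Lipschitz, so F c <= F s + K (s - c) for s
   slightly above c. *)
have Fc : F c <= F b.
  apply/ler_addgt0Pr => e e0.
  have K1 : 0 < K + 1 by rewrite ltr_wpDl.
  have [s [sI Fs] sc] := inf_adherent (divr_gt0 e0 K1) lS.
  have cs : c <= s by apply: ge_inf; [case: lS|].
  apply: le_trans (_ : F s + K * (s - c) <= _).
    have := fK c s cI sI; rewrite ler_norml [`|s - c|]ger0_norm ?subr_ge0// => /andP[h _].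
    have := ler_wpM2l K0 (g_nd _ _ cs); rewrite /F; lra.
  rewrite lerD//; rewrite -ltrBlDl -/c in sc.
  move: sc; rewrite ltr_pdivlMr// => /ltW; apply: le_trans.
  by rewrite mulrC ler_wpM2l ?subr_ge0// lerDl.
have [ca|ac'] := leP c a.
  have ca' : c = a by apply/le_anti; rewrite ca ac.
  rewrite ca' /F in Fc; have := g_ge0 a; have := ler_wpM2l K0 (g_eta b).
  have := mulr_ge0 K0 (g_ge0 a).
  have : K * eta <= eps.
    by rewrite /eta mulrA ler_pdivrMr ?ltr_wpDl// mulrC ler_wpM2l ?(ltW eps0)// lerDl.
  by lra.
exfalso.
suff [s [as_ sc Fs]] : exists s, [/\ a <= s, s < c & F s <= F c].
  have : S s by split; [rewrite in_itv/= as_ (le_trans (ltW sc))|exact: le_trans Fc].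
  by move=> /(ge_inf lS.2); rewrite leNgt sc.
have [Uc|Uc] := pselect (U c).
  (* Inside the open set, g grows at unit rate, and K g pays for any decrease of the K-Lipschitz
     f. *)
  have /nbhs_ballP[e /= e0 He] : nbhs c U by exact: open_nbhs_nbhs.
  exists (Num.max a (c - e / 2)).
  have sc : Num.max a (c - e / 2) < c by rewrite gt_max ac'/= ltrBlDr ltrDl divr_gt0.
  have as_ : a <= Num.max a (c - e / 2) by rewrite le_max lexx.
  have es : c - e / 2 <= Num.max a (c - e / 2) by rewrite le_max lexx orbT.
  move: (Num.max a (c - e / 2)) sc as_ es => s sc as_ es.
  split => //.
  have gE : g c - g s = c - s.
    apply: g_U => //; first exact: ltW.
    move=> x /=; rewrite in_itv/= => /andP[sx xc]; apply: He.
    by rewrite /ball/= ger0_norm ?subr_ge0//; lra.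
  have sI : s \in `[a, b] by rewrite in_itv/= as_ (le_trans (ltW sc)).
  have := fK c s cI sI; rewrite ler_norml distrC ger0_norm ?subr_ge0 ?(ltW sc)// => /andP[_].
  by rewrite -gE /F mulrBr; lra.
have [||e e0 He] := good c.
- by move=> Nc; apply: Uc; apply: DU; left.
- rewrite ac' lt_neqAle cb andbT; apply/eqP => cb'; apply: Uc; apply: DU; right.
  exact: cb'.
exists (Num.max a (c - e / 2)).
have sc : Num.max a (c - e / 2) < c by rewrite gt_max ac'/= ltrBlDr ltrDl divr_gt0.
have as_ : a <= Num.max a (c - e / 2) by rewrite le_max lexx.
have es : c - e / 2 <= Num.max a (c - e / 2) by rewrite le_max lexx orbT.
move: (Num.max a (c - e / 2)) sc as_ es => s sc as_ es.
split => //; rewrite /F lerD//; last by rewrite ler_wpM2l// g_nd// ltW.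
by apply: He => //; lra.
Qed.

(** The weak version already makes f nondecreasing. Equal values at s1 < s2 would make f constant
    between them, against the strict condition at a good point, which exists because a null set
    contains no interval. *)
Lemma lt_of_ae_left_dini f (K a b : R) : 0 <= K ->
  (forall s t, s \in `[a, b] -> t \in `[a, b] -> `|f t - f s| <= K * `|t - s|) ->
  {ae mu, forall t, a < t < b -> exists2 e, 0 < e &
     forall s, t - e < s -> s < t -> f s < f t} ->
  forall s1 s2, a <= s1 -> s1 < s2 -> s2 <= b -> f s1 < f s2.
Proof.
move=> K0 fK Hae.
have mono x y : a <= x -> x <= y -> y <= b -> f x <= f y.
  move=> ax xy yb; apply: (@le_of_ae_left_dini f K x y K0 xy).
    move=> s t; rewrite !in_itv/= => /andP[xs sy] /andP[xt ty].
    by apply: fK; rewrite in_itv/=; apply/andP; split; lra.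
  apply: filterS Hae; first exact: (ae_filter_ringOfSetsType mu).
  move=> t Ht /andP[xt ty]; have [|e e0 He] := Ht; first by apply/andP; split; lra.
  by exists e => // s ts st; exact/ltW/He.
move=> s1 s2 as1 s12 s2b; rewrite lt_neqAle mono ?(ltW s12)// andbT.
apply/eqP => E.
have [N [mN N0 HN]] := Hae.
have [t [s1t ts2 Nt]] : exists t, [/\ s1 < t, t < s2 & ~ N t].
  apply: contrapT => H.
  have sub : `]s1, s2[ `<=` N.
    move=> t /=; rewrite in_itv/= => /andP[t1 t2]; apply: contrapT => Nt.
    by apply: H; exists t.
  have : (mu `]s1, s2[ <= mu N)%E.
    by apply: le_measure; rewrite ?inE//; exact: measurable_itv.
  by rewrite N0 lebesgue_measure_itv/= lte_fin s12 -EFinB lee_fin; lra.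
have [e e0 He] : exists2 e, 0 < e & forall s, t - e < s -> s < t -> f s < f t.
  apply: contrapT => H; apply: Nt; apply: HN => /= Ht; apply: H; apply: Ht.
  by apply/andP; split; lra.
pose s := Num.max s1 (t - e / 2).
have s_s1 : s1 <= s by rewrite le_max lexx.
have st : s < t by rewrite gt_max s1t/= ltrBlDr ltrDl divr_gt0.
have es : t - e / 2 <= s by rewrite le_max lexx orbT.
have := He s ltac:(lra) st.
have h1 := mono s1 s as1 s_s1 ltac:(lra).
have h2 := mono t s2 ltac:(lra) (ltW ts2) s2b.
by lra.
Qed.

End Monotonicity.

(** * Level hypersurfaces and critical points *)

Section LevelHypersurface.
Context {R : realType} {n : nat}.
Implicit Types (p q x y z : 'rV[R]_n) (v : 'rV[R]_n -> R).

Lemma linear_bounded (W : normedModType R) (f : {linear 'rV[R]_n -> W}) :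
  exists2 B, 0 <= B & forall z, `|f z| <= B * `|z|.
Proof.
exists (\sum_i `|f (delta_mx 0 i)|) => [|z]; first exact: sumr_ge0.
rewrite {1}(row_sum_delta z) linear_sum; apply: le_trans (ler_norm_sum _ _ _) _.
rewrite mulr_suml; apply: ler_sum => i _.
by rewrite linearZ normrZ mulrC ler_wpM2l// ler_coord.
Qed.

(** An interior minimum of v + k |. - y|^2 on the ball would be a point with a subgradient shorter
    than m. So the minimum lies on the sphere, and comparing it with the centre gives the increment
    k r^2. *)
Lemma ball_ascent v (m : R) y (r v0 : R) : (0 < n)%N -> 0 < m -> 0 < r -> continuous v ->
  (forall x p, subdiff v x p -> m ^+ 2 <= dotp p p) ->
  (forall z, `|z - y| <= r -> v0 <= v z) -> v0 + m * r / (4 * n%:R) <= v y.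
Proof.
move=> n0 m0 r0 cv Hm Hv0.
have n0' : (0 : R) < n%:R by rewrite ltr0n.
(* With this k the paraboloid has squared slope at most m^2 / (4 n) < m^2 inside, and k r^2 is the
   announced increment. *)
pose k := m / (4 * n%:R * r).
have k0 : 0 < k by rewrite divr_gt0// !mulr_gt0.
pose f z := v z + k * dotp (z - y) (z - y).
have cf : continuous f.
  have cy : continuous (fun z : 'rV[R]_n => z - y).
    by move=> z; apply: (@continuousB _ _ _ id (fun=> y)) => //; exact: cst_continuous.
  have cd := continuous_dotp cy cy.
  move=> z; apply: (@continuousD _ _ _ v (fun z => k * dotp (z - y) (z - y))); first exact: cv.
  apply: (@continuousM _ _ (fun=> k) (fun z => dotp (z - y) (z - y))); first exact: cst_continuous.
  exact: cd.
pose S := [set z : 'rV[R]_n | `|z - y| <= r].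
have cS : compact S.
  apply: bounded_closed_compact.
    exists (r + `|y|); split; first exact: num_real.
    by move=> s rs z; rewrite /S /= => zr; have := ler_normD (z - y) y; rewrite subrK; lra.
  apply: (@preimage_closed _ _ (fun z : 'rV[R]_n => `|z - y|) [set s | s <= r]).
    move=> z _; apply: (@continuous_comp _ _ _ (fun z : 'rV[R]_n => z - y) Num.norm).
      by apply: (@continuousB _ _ _ id (fun=> y)) => //; exact: cst_continuous.
    exact: norm_continuous.
  exact: closed_le.
have Sy : S y by rewrite /S/= subrr normr0 ltW.
have [|z] := EVT_min_rV _ cS (continuous_subspaceT cf); first by exists y.
rewrite inE => Sz Hmin.
have fy : f z <= v y.
  by have := Hmin y; rewrite inE => /(_ Sy); rewrite /f subrr dotp0r mulr0 addr0.
have [zr|rz] := ltP `|z - y| r.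
  exfalso.
  have Sd : subdiff v z (- (2 * k) *: (z - y)).
    apply: (@subdiff_quad _ _ _ _ _ (k * n%:R) (r - `|z - y|)); first by rewrite subr_gt0.
    move=> w wz; have := Hmin w; rewrite inE => /(_ _).
    have Sw : S w.
      rewrite /S/=; have := ler_normD (w - z) (z - y); rewrite addrA subrK; lra.
    move=> /(_ Sw); rewrite /f.
    have -> : w - y = (w - z) + (z - y) by rewrite addrA subrK.
    have := ler_wpM2l (ltW k0) (dotp_le_sqr_norm (w - z)).
    move: (w - z) (z - y) => d e.
    rewrite !dotpDl !dotpDr dotpZl (dotpC e d); lra.
  have := Hm _ _ Sd; rewrite dotpZl dotpZr mulrA -expr2 sqrrN leNgt => /negP; apply.
  apply: le_lt_trans (_ : (2 * k) ^+ 2 * (n%:R * r ^+ 2) < _).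
    rewrite ler_wpM2l ?sqr_ge0//; apply: le_trans (dotp_le_sqr_norm _) _.
    by rewrite ler_wpM2l// lerXn2r ?nnegrE// ltW.
  have -> : (2 * k) ^+ 2 * (n%:R * r ^+ 2) = m ^+ 2 / (4 * n%:R).
    by rewrite /k; field; rewrite !gt_eqF.
  rewrite ltr_pdivrMr ?mulr_gt0// ltr_pMr ?exprn_gt0//.
  have : (1 : R) <= n%:R by rewrite ler1n.
  lra.
apply: le_trans fy; rewrite /f lerD ?Hv0//.
apply: le_trans (_ : k * r ^+ 2 <= _).
  by rewrite le_eqVlt; apply/orP; left; apply/eqP; rewrite /k; field; rewrite !gt_eqF.
rewrite ler_wpM2l ?(ltW k0)//; apply: le_trans (sqr_norm_le_dotp _).
by rewrite lerXn2r ?nnegrE// ltW.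
Qed.

(** Near x, v differs from v x off the graph, so it stays above or below v x on each side. As x is
    not a local maximum, one side lies above, and a Lipschitz graph leaves room for a cone there. *)
Lemma hypersurface_cone v (L : R) x : 0 <= L ->
  (forall x y, `|v x - v y| <= L * `|x - y|) ->
  ~ (\forall y \near x, v y <= v x) ->
  lipschitz_hypersurface_near [set y | v y = v x] x ->
  exists e (k t0 : R), [/\ 0 < k, 0 < t0 & forall t, 0 < t -> t < t0 ->
    forall z, `|z - (x + t *: e)| <= k * t -> v x <= v z].
Proof.
move=> L0 vL notmax [Phi [f [k0 [[Psi PsiK PhiK] fk0]]]] /near_norm[d d0 Hd].
have {}fk0 a b : `|f a - f b| <= `|k0| * `|a - b|.
  have : `|f a - f b| <= k0 * `|a - b| by apply: (fk0 (a, b)).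
  by move=> /le_trans; apply; rewrite ler_wpM2r// ler_norm.
move: (`|k0|) (normr_ge0 k0) fk0 => k k_ge0 fk.
have [B B0 HB] := linear_bounded Phi.
have HB1 z : `|(Phi z).1| <= B * `|z|.
  by apply: le_trans (HB z); rewrite prod_normE le_max lexx.
have HB2 z : `|(Phi z).2| <= B * `|z|.
  by apply: le_trans (HB z); rewrite prod_normE le_max lexx orbT.
(* Bijectivity provides the inverse as a mere function; its values on the standard basis give its
   linear expression and a Lipschitz bound. *)
pose P2 (w : ('rV[R]_n.-1 * R^o)%type) :=
  \sum_i w.1 0 i *: Psi (delta_mx 0 i, 0) + w.2 *: Psi (0, 1).
have PsiE w : Psi w = P2 w.
  rewrite -[RHS]PsiK; congr (Psi _); rewrite /P2 linearD linear_sum linearZ/= PhiK.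
  under eq_bigr do rewrite linearZ/= PhiK.
  case: w => a b /=.
  have m1 : {morph (@fst 'rV[R]_n.-1 R^o) : x y / x + y} by [].
  have m2 : {morph (@snd 'rV[R]_n.-1 R^o) : x y / x + y} by [].
  have -> : \sum_(i < n.-1) a 0 i *: ((delta_mx 0 i, 0) : ('rV[R]_n.-1 * R^o)%type) = (a, 0).
    rewrite [LHS]surjective_pairing; congr pair.
      rewrite (big_morph _ m1 (erefl _)) /=.
      by rewrite -row_sum_delta.
    rewrite (big_morph _ m2 (erefl _)) /=.
    by rewrite big1 // => i _; rewrite scaler0.
  have -> : b *: ((0, 1) : ('rV[R]_n.-1 * R^o)%type) = (0, b).
    by congr pair; rewrite /= ?scaler0// /GRing.scale/= mulr1.
  by congr pair; rewrite /= ?addr0 ?add0r.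
pose B' := \sum_i `|Psi (delta_mx 0 i, 0)| + `|Psi (0, 1)|.
have B'0 : 0 <= B' by apply: addr_ge0 => //; apply: sumr_ge0.
have HP (w w' : ('rV[R]_n.-1 * R^o)%type) :
    `|Psi w - Psi w'| <= B' * (`|w.1 - w'.1| + `|w.2 - w'.2|).
  have -> : Psi w - Psi w' = \sum_i (w.1 - w'.1) 0 i *: Psi (delta_mx 0 i, 0)
      + (w.2 - w'.2) *: Psi (0, 1).
    rewrite (PsiE w) (PsiE w') /P2 opprD addrACA -sumrB scalerBl; congr (_ + _).
    by apply: eq_bigr => i _; rewrite !mxE scalerBl.
  apply: le_trans (ler_normD _ _) _; rewrite /B' mulrDl; apply: lerD; last first.
    by rewrite normrZ mulrC ler_wpM2l// lerDr.
  apply: le_trans (ler_norm_sum _ _ _) _; rewrite mulr_suml; apply: ler_sum => i _.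
  rewrite normrZ mulrC ler_wpM2l//; apply: le_trans (ler_coord _ _) _.
  by rewrite lerDl.
have Lx : (Phi x).2 = f (Phi x).1.
  by apply/(Hd x) => //; rewrite subrr normr0.
have [a0 a0E] : exists a0, a0 = (Phi x).1 by eexists.
have PhixE : Phi x = (a0, f a0) by rewrite a0E -Lx; case: (Phi x).
have xE : x = Psi (a0, f a0) by rewrite -PhixE PsiK.
(* The point over the base point a at signed height s above the graph. *)
pose Pt a s := Psi (a, f a + s).
have Pt_lip a s a' s' : `|Pt a s - Pt a' s'| <= B' * ((1 + k) * `|a - a'| + `|s - s'|).
  apply: le_trans (HP _ _) _; rewrite ler_wpM2l//=.
  have -> : f a + s - (f a' + s') = (f a - f a') + (s - s') by ring.
  by have := ler_normD (f a - f a') (s - s'); have := fk a a'; lra.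
have Ptx : x = Pt a0 0 by rewrite /Pt addr0.
(* For |a - a0| and |s| at most rho, [Pt a s] stays within d of x, where the graph describes the
   level set. *)
pose rho := d / (2 * ((B' + 1) * (2 + k))).
have Bp : 0 < B' + 1 by rewrite ltr_wpDl.
have kp : 0 < 2 + k by rewrite ltr_wpDr.
have rho0 : 0 < rho by rewrite divr_gt0// !mulr_gt0.
have Pt_near a s : `|a - a0| <= rho -> `|s| <= rho -> `|Pt a s - x| < d.
  move=> ar sr; rewrite Ptx; apply: le_lt_trans (Pt_lip _ _ _ _) _; rewrite subr0.
  apply: le_lt_trans (_ : (B' + 1) * ((2 + k) * rho) < _).
    apply: ler_pM => //; [by rewrite addr_ge0// mulr_ge0// addr_ge0|by rewrite lerDl|].
    have k1 : 0 <= 1 + k by rewrite addr_ge0.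
    by have := ler_wpM2l k1 ar; lra.
  have -> : (B' + 1) * ((2 + k) * rho) = d / 2.
    by rewrite /rho; field; rewrite !gt_eqF.
  by rewrite ltr_pdivrMr//; lra.
have PhiPt a s : Phi (Pt a s) = (a, f a + s) by exact: PhiK.
have Pt_neq a s : `|a - a0| <= rho -> `|s| <= rho -> s != 0 -> v (Pt a s) != v x.
  move=> ar sr s0; apply/eqP => /(Hd _ (Pt_near _ _ ar sr)).
  by rewrite PhiPt /= => /eqP; rewrite -subr_eq0 addrAC subrr add0r (negbTE s0).
have Pt_sign a1 s1 a s : `|a1 - a0| <= rho -> `|s1| <= rho -> `|a - a0| <= rho -> `|s| <= rho ->
    0 < s1 * s -> v x < v (Pt a1 s1) -> v x < v (Pt a s).
  move=> ar1 sr1 ar sr ss v1.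
  rewrite ltNge; apply/negP => v2.
  (* The segment in the coordinates (a, s) keeps the height nonzero, so the value v x which the
     intermediate value theorem would produce is excluded. *)
  pose phi (t : R) := v (Pt (a1 + t *: (a - a1)) (s1 + t * (s - s1))).
  have cphi : continuous phi.
    apply: (@lipschitz_continuous _ _ (L * (B' * ((1 + k) * `|a - a1| + `|s - s1|)))) => t t'.
    apply: le_trans (vL _ _) _; rewrite -[leRHS]mulrA; apply: ler_wpM2l => //.
    apply: le_trans (Pt_lip _ _ _ _) _; rewrite -[leRHS]mulrA; apply: ler_wpM2l => //.
    rewrite [leRHS]mulrDl; apply: lerD.
      rewrite -mulrA ler_wpM2l ?addr_ge0//.
      have -> : a1 + t' *: (a - a1) - (a1 + t *: (a - a1)) = (t' - t) *: (a - a1).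
        by rewrite opprD addrACA subrr add0r -scalerBl.
      by rewrite normrZ mulrC.
    have -> : s1 + t' * (s - s1) - (s1 + t * (s - s1)) = (t' - t) * (s - s1) by ring.
    by rewrite normrM mulrC.
  have [|t] := @IVT R phi 0 1 (v x) ler01 (continuous_subspaceT cphi).
    rewrite /phi scale0r addr0 mul0r addr0 scale1r mul1r !(addrC _ (_ - _)) !subrK.
    by rewrite ge_min le_max v2 (ltW v1) orbT.
  rewrite in_itv/= => /andP[t0 t1] /eqP; apply/negP; apply: Pt_neq.
  - have -> : a1 + t *: (a - a1) - a0 = (1 - t) *: (a1 - a0) + t *: (a - a0).
      by apply/rowP => i; rewrite !mxE; ring.
    apply: le_trans (ler_normD _ _) _; rewrite !normrZ !ger0_norm ?subr_ge0//.
    have t1' : 0 <= 1 - t by lra.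
    by have := ler_wpM2l t1' ar1; have := ler_wpM2l t0 ar; lra.
  - have -> : s1 + t * (s - s1) = (1 - t) * s1 + t * s by ring.
    have t1' : 0 <= 1 - t by lra.
    apply: le_trans (ler_normD _ _) _; rewrite !normrM (ger0_norm t0) (ger0_norm t1').
    by have := ler_wpM2l t1' sr1; have := ler_wpM2l t0 sr; lra.
  - have s10 : s1 != 0 by apply/eqP => s10; rewrite s10 mul0r ltxx in ss.
    suff : 0 < s1 * (s1 + t * (s - s1)) by move=> h; apply/eqP => E; rewrite E mulr0 ltxx in h.
    have -> : s1 * (s1 + t * (s - s1)) = (1 - t) * s1 ^+ 2 + t * (s1 * s) by ring.
    have s2 : 0 < s1 ^+ 2 by rewrite exprn_even_gt0.
    move: t0; rewrite le_eqVlt => /predU1P[<-|t0]; first by rewrite subr0 mul1r mul0r addr0.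
    apply: ltr_wpDl; last exact: mulr_gt0.
    by apply: mulr_ge0; [rewrite subr_ge0|exact: ltW].
have B1k : 0 < (B + 1) * (1 + k).
  by apply: mulr_gt0; [rewrite ltr_wpDl|rewrite ltr_wpDr].
have [y1 [y1x vy1]] : exists y1, `|y1 - x| < Num.min d (rho / ((B + 1) * (1 + k))) /\ v x < v y1.
  apply: contrapT => H; apply: notmax; apply/near_norm.
  exists (Num.min d (rho / ((B + 1) * (1 + k)))); first by rewrite lt_min d0 divr_gt0.
  by move=> y yx; rewrite leNgt; apply/negP => vy; apply: H; exists y.
move: y1x; rewrite lt_min => /andP[y1d]; rewrite ltr_pdivlMr// => y1r.
have [a1 a1E] : exists a1, a1 = (Phi y1).1 by eexists.
have [s1 s1E] : exists s1, s1 = (Phi y1).2 - f a1 by eexists.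
have y1E : y1 = Pt a1 s1.
  by rewrite /Pt s1E [f a1 + _]addrC subrK a1E -[LHS]PsiK; case: (Phi y1).
have PhiB z z' : Phi z - Phi z' = Phi (z - z') by rewrite linearB.
have da1 : `|a1 - a0| <= B * `|y1 - x|.
  by have := HB1 (y1 - x); rewrite -PhiB a0E a1E.
have ds1 : `|s1| <= B * (1 + k) * `|y1 - x|.
  have -> : s1 = ((Phi y1).2 - (Phi x).2) - (f a1 - f a0) by rewrite s1E Lx a0E; ring.
  apply: le_trans (ler_normB _ _) _.
  have := HB2 (y1 - x); rewrite -PhiB /= => h1.
  by have := fk a1 a0; have := ler_wpM2l k_ge0 da1; lra.
have [ar1 sr1] : `|a1 - a0| <= rho /\ `|s1| <= rho.
  have y0 := normr_ge0 (y1 - x); have ky : 0 <= k * `|y1 - x| by rewrite mulr_ge0.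
  have By : 0 <= B * (k * `|y1 - x|) by rewrite mulr_ge0.
  by split; move: y1r da1 ds1; lra.
have s10 : s1 != 0.
  apply/eqP => s10; have : v y1 = v x.
    by apply/(Hd y1 y1d); rewrite y1E PhiPt s10 addr0.
  by move=> E; rewrite E ltxx in vy1.
have sg1 : Num.sg s1 * s1 = `|s1| by rewrite -normrEsg.
(* The axis is vertical, on the side of a point y1 with v y1 > v x. The opening is such that a
   deviation changes the height by at most t / 2, so it keeps its sign; t < rho / 2 keeps the height
   below rho. *)
exists (Psi (0, Num.sg s1)), (2 * ((B + 1) * (1 + k)))^-1, (rho / 2).
split; [by rewrite invr_gt0 mulr_gt0|by rewrite divr_gt0|].
move=> t t0 tr z zt.
pose eta := z - (x + t *: Psi (0, Num.sg s1)).
have zE : z = x + t *: Psi (0, Num.sg s1) + eta by rewrite /eta addrC subrK.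
have PhizE : Phi z = Phi x + t *: (0, Num.sg s1) + Phi eta.
  by rewrite zE !linearD linearZ/= PhiK.
have [a aE] : exists a, a = (Phi z).1 by eexists.
have [s sE] : exists s, s = (Phi z).2 - f a by eexists.
have zPt : z = Pt a s by rewrite /Pt sE [f a + _]addrC subrK aE -[LHS]PsiK; case: (Phi z).
have Be : (1 + k) * (B * `|eta|) <= t / 2.
  have h1 : 0 <= (1 + k) * B by rewrite mulr_ge0// addr_ge0.
  rewrite mulrA; apply: le_trans (ler_wpM2l h1 zt) _.
  rewrite [(2 * _)^-1 * t]mulrC mulrA ler_pdivrMr; last exact: mulr_gt0.
  have -> : t / 2 * (2 * ((B + 1) * (1 + k))) = t * ((B + 1) * (1 + k)) by field.
  rewrite mulrC ler_wpM2l ?(ltW t0)//; lra.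
have daz : `|a - a0| <= B * `|eta|.
  have -> : a - a0 = (Phi eta).1.
    by rewrite aE PhizE a0E /= scaler0 addr0 addrC addKr.
  exact: HB1.
have sgs : `|Num.sg s1| = 1 by rewrite normr_sg s10.
have dsz : `|s - t * Num.sg s1| <= (1 + k) * (B * `|eta|).
  have -> : s - t * Num.sg s1 = (Phi eta).2 - (f a - f a0).
    rewrite sE PhizE /= Lx -a0E /GRing.scale/=; ring.
  apply: le_trans (ler_normB _ _) _.
  by have := HB2 eta; have := fk a a0; have := ler_wpM2l k_ge0 daz; lra.
have Be0 : 0 <= B * `|eta| by rewrite mulr_ge0.
have kBe0 : 0 <= k * (B * `|eta|) by rewrite mulr_ge0.
rewrite zPt; apply/ltW; apply: (Pt_sign a1 s1) => //.
- by lra.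
- have := ler_normD (s - t * Num.sg s1) (t * Num.sg s1).
  by rewrite subrK normrM sgs (gtr0_norm t0) mulr1; lra.
- have -> : s1 * s = t * `|s1| + s1 * (s - t * Num.sg s1) by rewrite -sg1; ring.
  have s1p : 0 < `|s1| by rewrite normr_gt0.
  have : - (`|s1| * (t / 2)) <= s1 * (s - t * Num.sg s1).
    rewrite lerNl -mulrN; apply: le_trans (ler_norm _) _; rewrite normrM normrN ler_wpM2l//.
    by apply: le_trans dsz Be.
  by have := mulr_gt0 s1p t0; lra.
- by rewrite -y1E.
Qed.

(** [ball_ascent] on the balls of radius k t inside the cone gives v (x + t e) >= v x + c t, a
    linear growth that 0 in D+v(x) would forbid. *)
Lemma zero_notin_superdiff v (L m : R) x : (0 < n)%N -> 0 <= L -> 0 < m ->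
  (forall x y, `|v x - v y| <= L * `|x - y|) -> continuous v ->
  (forall x p, subdiff v x p -> m ^+ 2 <= dotp p p) ->
  ~ (\forall y \near x, v y <= v x) ->
  lipschitz_hypersurface_near [set y | v y = v x] x ->
  ~ superdiff v x 0.
Proof.
move=> n0 L0 m0 vL cv Hm notmax hyp /superdiffP S0.
have [e [k [t0 [k0 t00 H]]]] := hypersurface_cone L0 vL notmax hyp.
have n0' : (0 : R) < n%:R by rewrite ltr0n.
pose c := m * k / (4 * n%:R).
have c0 : 0 < c by rewrite divr_gt0// !mulr_gt0.
have e1 : 0 < `|e| + 1 by rewrite ltr_wpDl.
have c1 : 0 < c / 2 / (`|e| + 1) by apply: divr_gt0 => //; exact: divr_gt0.
have /near_norm[d d0 Hd] := S0 _ c1.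
pose t := Num.min (t0 / 2) (d / 2 / (`|e| + 1)).
have t_gt0 : 0 < t.
  rewrite lt_min; apply/andP; split; first exact: divr_gt0.
  by apply: divr_gt0 => //; exact: divr_gt0.
have tt0 : t < t0.
  by apply: le_lt_trans (_ : t0 / 2 < _); [rewrite ge_min lexx|rewrite ltr_pdivrMr//; lra].
have td : t * (`|e| + 1) <= d / 2 by rewrite -ler_pdivlMr// ge_min lexx orbT.
have := @ball_ascent v m (x + t *: e) (k * t) (v x) n0 m0 (mulr_gt0 k0 t_gt0) cv Hm (H t t_gt0 tt0).
have xe : x + t *: e - x = t *: e by rewrite addrC addKr.
have ne : `|t *: e| = t * `|e| by rewrite normrZ gtr0_norm.
have := Hd (x + t *: e); rewrite xe ne dotp0l subr0.
have te : t * `|e| < d by have := t_gt0; have := d0; lra.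
move=> /(_ te) h1.
have -> : m * (k * t) / (4 * n%:R) = c * t by rewrite /c; ring.
have : c / 2 / (`|e| + 1) * (t * `|e|) <= c / 2 * t.
  have -> : c / 2 / (`|e| + 1) * (t * `|e|) = c / 2 * t * (`|e| / (`|e| + 1)) by ring.
  apply: ler_piMr; first by apply/ltW; apply: mulr_gt0 => //; exact: divr_gt0.
  by rewrite ler_pdivrMr// mul1r lerDl.
by have := mulr_gt0 c0 t_gt0; lra.
Qed.

End LevelHypersurface.

(** * Proof of the theorem *)

Section DifferentialInclusion.
Context {R : realType} {n : nat}.
Notation mu := (@lebesgue_measure R).
Implicit Types (p q x y z : 'rV[R]_n).

Lemma derivable_cvg_dnbhs (V : normedModType R) (X : R -> V) s : derivable X s 1 ->
  (t - s)^-1 *: (X t - X s) @[t --> s^'] --> derive1 X s.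
Proof.
move=> dX; rewrite derive1E.
have H : (fun h => h^-1 *: (X (h *: 1 + s) - X s)) @ 0^' --> 'D_1 X s by exact: dX.
have : (fun h => h^-1 *: (X (h *: 1 + s) - X s)) (t - s) @[t --> s^'] --> 'D_1 X s.
  apply: cvg_comp H.
  move=> P /nbhs_ballP[e /= e0 He]; apply/nbhs_ballP; exists e => //= t st ts.
  apply: He; last by rewrite subr_eq0.
  by move: st; rewrite /ball/= sub0r normrN distrC.
apply: cvg_trans; apply: near_eq_cvg; apply: nearW => t /=.
by rewrite [(t - s) *: 1]mulr1 subrK.
Qed.

(** D+v(x) is closed and convex and A(x) is an invertible linear map, so the image is already closed
    and convex and the hull adds nothing. *)
Lemma closed_convex_hull_characteristic (A : 'rV[R]_n -> 'M[R]_n) V (v : 'rV[R]_n -> R)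
    (lam B C L : R) x w :
  0 < lam -> (forall x, (A x)^T = A x) -> (forall x p, lam * `|p| ^+ 2 <= quad A x p) ->
  (forall x, `|A x| <= B) -> 0 <= C -> 0 <= L ->
  (forall x y, `|v x - v y| <= L * `|x - y|) ->
  (forall x p, superdiff v x p ->
    forall y, v y <= v x + dotp p (y - x) + C * `|y - x| ^+ 2) ->
  closed_convex_hull (grad_p (hamiltonian A V) x @` superdiff v x) w <->
  exists2 q, superdiff v x q & w = q *m A x.
Proof.
move=> lam0 A_sym A_ell A_bd C0 L0 v_lip v_sc.
have gradE := grad_hamiltonian lam0 A_sym A_ell V.
split=> [|[q Sq ->]]; last first.
  by apply: sub_gen_smallest; exists q => //; exact: gradE.
have Au := A_unit lam0 A_ell x.
(* The image of D+v(x) under A(x), written as a preimage under the inverse so that closedness can be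
   read off. *)
pose K := [set w | superdiff v x (w *m invmx (A x))].
suff sub : closed_convex_hull (grad_p (hamiltonian A V) x @` superdiff v x) `<=` K.
  by move=> /sub Kw; exists (w *m invmx (A x)) => //; rewrite mulmxKV.
apply: smallest_sub; last by move=> _ [q Sq <-]; rewrite /K/= gradE mulmxK.
split.
- move=> z Hz; apply: (superdiff_closed C0 L0 v_lip v_sc) => e e0.
  pose N := n%:R * `|invmx (A x)| + 1.
  have N0 : 0 < N by rewrite ltr_wpDl// mulr_ge0.
  have [|y [Ky yz]] := Hz [set y | `|y - z| < e / N].
    by apply/near_norm; exists (e / N) => //; rewrite divr_gt0.
  exists x, (y *m invmx (A x)); split => //; first by rewrite subrr normr0.
  rewrite -mulmxBl; apply: le_lt_trans (ler_norm_mulmx _ _) _.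
  move: yz; rewrite /= ltr_pdivlMr// => yz; apply: le_lt_trans yz.
  by rewrite mulrAC mulrC ler_wpM2l// lerDl.
- move=> y z k /set_mem Ky /set_mem Kz; apply/mem_set.
  change (superdiff v x ((k%:num *: (y : 'rV[R]_n) + (1 - k%:num) *: (z : 'rV[R]_n))
    *m invmx (A x))).
  have -> : k%:num *: (y : 'rV[R]_n) + (1 - k%:num) *: (z : 'rV[R]_n)
      = (z : 'rV[R]_n) + k%:num *: ((y : 'rV[R]_n) - (z : 'rV[R]_n)).
    by apply/rowP => i; rewrite !mxE; ring.
  rewrite mulmxDl -scalemxAl mulmxBl.
  by apply: (superdiff_convex v_sc).
Qed.

(** Semiconcavity at X t bounds v at the earlier X s from above by v (X t) - (t - s) <A q, q> plus
    small errors. The nonzero right derivative excludes q = 0. *)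
Lemma characteristic_increasing (A : 'rV[R]_n -> 'M[R]_n) V (v : 'rV[R]_n -> R)
    (lam B C L : R) (tau : R) (X : R -> 'rV[R]_n) :
  0 < lam -> (forall x, (A x)^T = A x) -> (forall x p, lam * `|p| ^+ 2 <= quad A x p) ->
  (forall x, `|A x| <= B) -> 0 <= C -> 0 <= L ->
  (forall x y, `|v x - v y| <= L * `|x - y|) ->
  (forall x p, superdiff v x p ->
    forall y, v y <= v x + dotp p (y - x) + C * `|y - x| ^+ 2) ->
  generalized_characteristic (hamiltonian A V) v tau X ->
  (forall s, s \in `[0, tau[ -> right_derivative_neq0 X s) ->
  forall s1 s2 : R, 0 <= s1 -> s1 < s2 -> s2 <= tau -> v (X s1) < v (X s2).
Proof.
move=> lam0 A_sym A_ell A_bd C0 L0 v_lip v_sc [tau0 [k Xk] Xae] Xd.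
have {}Xk s t : s \in `[0, tau] -> t \in `[0, tau] -> `|X t - X s| <= `|k| * `|t - s|.
  move=> sI tI; have : `|X t - X s| <= k * `|t - s| by apply: (Xk (t, s)).
  by move=> /le_trans; apply; rewrite ler_wpM2r// ler_norm.
apply: (@lt_of_ae_left_dini _ (v \o X) (L * `|k|) 0 tau); first exact: mulr_ge0.
  move=> s t sI tI /=; apply: le_trans (v_lip _ _) _.
  by rewrite -mulrA ler_wpM2l//; exact: Xk.
apply: filterS Xae; first exact: (ae_filter_ringOfSetsType mu).
move=> t Ht /andP[t0 tt].
have tI : t \in `[0, tau] by rewrite in_itv/= !ltW.
have [dX] := Ht tI.
move=> /(closed_convex_hull_characteristic V _ _ lam0 A_sym A_ell A_bd C0 L0 v_lip v_sc)[q Sq wE].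
have dc := derivable_cvg_dnbhs dX.
have [|d Hd d0] := Xd t; first by rewrite in_itv/= (ltW t0).
have wd : derive1 X t = d.
  by apply: (cvg_unique _ (cvg_dnbhs_at_right dc) Hd).
have q0 : q != 0 by apply: contraNneq d0 => q0; rewrite -wd wE q0 mul0mx.
have [Q QE] : exists Q, Q = quad A (X t) q by eexists.
have Q0 : 0 < Q.
  by rewrite QE; apply: lt_le_trans (A_ell _ _); rewrite mulr_gt0// exprn_gt0// normr_gt0.
have nq : 0 < n%:R * `|q| + 1 by rewrite ltr_wpDl// mulr_ge0.
have eta0 : 0 < Q / 4 / (n%:R * `|q| + 1) by apply: divr_gt0 => //; exact: divr_gt0.
have Ck : 0 < C * `|k| ^+ 2 + 1 by rewrite ltr_wpDl// mulr_ge0// sqr_ge0.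
have /cvgrPdist_le/(_ _ eta0) := dc.
rewrite wE => /nbhs_ballP[e /= e0 He].
(* The bound t keeps s in the interval. The other two allow, per unit time, an error Q / 4 for
   linearizing the arc and Q / 4 for semiconcavity. *)
exists (Num.min e (Num.min t (Q / 4 / (C * `|k| ^+ 2 + 1)))).
  by rewrite !lt_min e0 t0/=; apply: divr_gt0 => //; exact: divr_gt0.
move=> s; rewrite ltrBlDr -ltrBlDl !lt_min => /andP[se /andP[st' sQ]] st.
have [dl dlE] : exists dl, dl = t - s by eexists.
rewrite -dlE in se st' sQ.
have dl0 : 0 < dl by rewrite dlE subr_gt0.
have sI : s \in `[0, tau].
  by rewrite in_itv/= (ltW (lt_trans st tt)) andbT; move: st'; rewrite dlE; lra.
have := He s; rewrite /ball/= -dlE gtr0_norm// => /(_ se).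
rewrite (lt_eqF st) => /(_ isT) Hs.
have E1 : X s - X t = (- dl) *: (q *m A (X t))
    + dl *: (q *m A (X t) - (s - t)^-1 *: (X s - X t)).
  have -> : s - t = - dl by rewrite dlE opprB.
  rewrite scalerBr scalerA invrN mulrN divff ?gt_eqF// scaleN1r opprK scaleNr.
  by rewrite addrA addNr add0r.
have sc := v_sc _ _ Sq (X s).
have b1 : dotp q (X s - X t) <= - dl * Q + dl * (Q / 4).
  rewrite E1 dotpDr !dotpZr (dotpC q (q *m _)) -/(quad A (X t) q) -QE lerD2l.
  rewrite ler_wpM2l ?(ltW dl0)//; apply: le_trans (ler_dotp_norm _ _) _.
  have n0 : 0 <= n%:R * `|q| by rewrite mulr_ge0.
  apply: le_trans (ler_wpM2l n0 Hs) _.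
  move: (n%:R * `|q|) nq n0 => N N1 N0.
  have -> : N * (Q / 4 / (N + 1)) = Q / 4 * (N / (N + 1)) by ring.
  apply: ler_piMr; first by rewrite divr_ge0// ltW.
  by rewrite ler_pdivrMr// mul1r lerDl.
have b2 : C * `|X s - X t| ^+ 2 <= dl * (Q / 4).
  apply: le_trans (_ : C * (`|k| * dl) ^+ 2 <= _).
    rewrite ler_wpM2l// lerXn2r ?nnegrE ?mulr_ge0 ?(ltW dl0)//.
    by have := Xk _ _ tI sI; rewrite [`|s - t|]distrC -dlE (gtr0_norm dl0).
  have -> : C * (`|k| * dl) ^+ 2 = dl * (C * `|k| ^+ 2 * dl) by ring.
  rewrite ler_wpM2l ?(ltW dl0)//.
  move: sQ; rewrite ltr_pdivlMr// => /ltW; apply: le_trans.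
  by rewrite mulrC ler_wpM2l ?(ltW dl0)// lerDl.
by have := mulr_gt0 dl0 Q0; rewrite /=; lra.
Qed.

End DifferentialInclusion.

Section MatrixBounds.
Context {R : realType} {n : nat}.
Implicit Types (p q x y z : 'rV[R]_n).

Lemma matrix_periodic_bounds (A : 'rV[R]_n -> 'M[R]_n) :
  (forall i j, smooth (fun x => A x i j)) -> Zn_periodic A ->
  exists2 B, 0 <= B & [/\ forall x, `|A x| <= B,
    forall x y, `|A x - A y| <= B * `|x - y| &
    forall x y, `|A (x + y) + A (x - y) - 2 *: A x| <= B * `|y| ^+ 2].
Proof.
move=> sA pA.
have /fin_all_exists[M HM] : forall ij : 'I_n * 'I_n, exists M : R, 0 < M /\
    [/\ forall x, `|A x ij.1 ij.2| <= M,
    forall x y, `|A x ij.1 ij.2 - A y ij.1 ij.2| <= M * `|x - y| &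
    forall x y, `|A (x + y) ij.1 ij.2 + A (x - y) ij.1 ij.2 - 2 * A x ij.1 ij.2|
      <= M * `|y| ^+ 2].
  move=> [i j] /=; have [|M M0 H] := smooth_periodic_bounds (sA i j).
    by move=> x z; rewrite pA.
  by exists M.
have M0 ij : 0 <= M ij by apply/ltW; have [] := HM ij.
have le_M i j : M (i, j) <= \sum_ij M ij.
  by rewrite (bigD1 (i, j))//= lerDl; apply: sumr_ge0.
exists (\sum_ij M ij) => [|]; first exact: sumr_ge0.
have S0 : 0 <= \sum_ij M ij by exact: sumr_ge0.
split=> [x|x y|x y].
- apply: mx_norm_le_coord => // i j.
  by have [_ [H _ _]] := HM (i, j); apply: le_trans (H x) _.
- apply: mx_norm_le_coord => [|i j]; first by rewrite mulr_ge0.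
  have [_ [_ H _]] := HM (i, j); rewrite !mxE; apply: le_trans (H x y) _.
  by rewrite ler_wpM2r.
- apply: mx_norm_le_coord => [|i j]; first by rewrite mulr_ge0// sqr_ge0.
  have [_ [_ _ H]] := HM (i, j); rewrite !mxE; apply: le_trans (H x y) _.
  by rewrite ler_wpM2r// sqr_ge0.
Qed.

End MatrixBounds.

Theorem theorem3p7 (R : realType) (n : nat) (n_gt0 : (0 < n)%N)
  (A : 'rV[R]_n -> 'M[R]_n) (V : 'rV[R]_n -> R)
  (A_sym : forall x, (A x)^T = A x)
  (A_posdef : forall x p, p != 0 -> 0 < dotp (p *m A x) p)
  (A_smooth : forall i j, smooth (fun x => A x i j))
  (A_periodic : Zn_periodic A)
  (V_smooth : smooth V) (V_periodic : Zn_periodic V)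
  (c : 'rV[R]_n)
  (alpha_gt_max : sup (range V) < mather_alpha (hamiltonian A V) c)
  (u : 'rV[R]_n -> R) (u_periodic : Zn_periodic u)
  (u_sol : viscosity_solution (hamiltonian A V) c
             (mather_alpha (hamiltonian A V) c) u) :
  let H := hamiltonian A V in
  let v := fun x => u x + dotp c x in
  (forall (tau : R) (X : R -> 'rV[R]_n),
     generalized_characteristic H v tau X ->
     (forall s, s \in `[0, tau[ -> right_derivative_neq0 X s) ->
     forall s1 s2 : R, 0 <= s1 -> s1 < s2 -> s2 <= tau ->
       v (X s1) < v (X s2))
  /\
  (forall x : 'rV[R]_n,
     singular_set v x ->
     ~ (\forall y \near x, v y <= v x) ->
     lipschitz_hypersurface_near [set y | v y = v x] x ->
     exists (tau' : R) (X : R -> 'rV[R]_n),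
       [/\ 0 < tau',
           singular_characteristic H v tau' X,
           X 0 = x,
           forall s, s \in `[0, tau'[ -> right_derivative_neq0 X s &
           exists2 s, s \in `[0, tau'] & X s != X 0]).
Proof.
(* From here on alpha(c) is any number a above the supremum of V for which the two viscosity
   inequalities hold. *)
move: alpha_gt_max u_sol; move: (mather_alpha _ _) => a a_gt [cu u_visc] H v.
have n_pos : (0 : R) < n%:R by rewrite ltr0n.
have n_ge1 : (1 : R) <= n%:R by rewrite ler1n.
have [B1 B1_ge0 [A_bd1 A_lip1 A_sd1]] := matrix_periodic_bounds A_smooth A_periodic.
have [B2 B2_gt0 [V_bd2 V_lip2 V_sd2]] := smooth_periodic_bounds V_smooth V_periodic.
have [B BE] : exists B, B = B1 + B2 by eexists.
have B_gt0 : 0 < B by rewrite BE ltr_wpDl.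
have B_ge0 := ltW B_gt0.
have leB1 : B1 <= B by rewrite BE lerDl ltW.
have leB2 : B2 <= B by rewrite BE lerDr.
have A_bd x : `|A x| <= B by exact: le_trans (A_bd1 x) leB1.
have A_lip x y : `|A x - A y| <= B * `|x - y|.
  by apply: le_trans (A_lip1 x y) _; rewrite ler_wpM2r.
have A_sd x y : `|A (x + y) + A (x - y) - 2 *: A x| <= B * `|y| ^+ 2.
  by apply: le_trans (A_sd1 x y) _; rewrite ler_wpM2r// sqr_ge0.
have V_lip x y : `|V x - V y| <= B * `|x - y|.
  by apply: le_trans (V_lip2 x y) _; rewrite ler_wpM2r.
have V_sd x y : `|V (x + y) + V (x - y) - 2 * V x| <= B * `|y| ^+ 2.
  by apply: le_trans (V_sd2 x y) _; rewrite ler_wpM2r// sqr_ge0.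
have V_sup x : V x <= sup (range V).
  apply: ub_le_sup; last by exists x.
  by exists B2 => _ [y _ <-]; apply: le_trans (ler_norm _) (V_bd2 y).
have [lam lam_gt0 A_ell] := quad_elliptic n_gt0 (fun i j => A_smooth i j 0%N)
  A_periodic A_posdef.
have [U U_gt0 u_bd] := periodic_bounded cu u_periodic.
have cE p : c + (p - c) = p by rewrite addrC subrK.
have sub x p : superdiff v x p -> hamiltonian A V x p <= a.
  move=> Sp; have := (u_visc x).1 (p - c); rewrite cE; apply.
  by apply/(superdiffD_dotp u c); rewrite cE.
have super x p : subdiff v x p -> a <= hamiltonian A V x p.
  move=> Sp; have := (u_visc x).2 (p - c); rewrite cE; apply.
  by apply/(subdiffD_dotp u c); rewrite cE.
(* Ellipticity and the subsolution inequality give lam |p|^2 <= 2 (a - V); the factor n passes to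
   the Euclidean norm. *)
have [S SE] : exists S, S = n%:R * (2 * (`|a| + B)) / lam by eexists.
have S_ge0 : 0 <= S by rewrite SE divr_ge0 ?mulr_ge0 ?addr_ge0// ltW.
(* Since L >= 1, L^2 >= L > S; and L >= |c| + 1, as coercivity requires. *)
have [L LE] : exists L, L = S + enorm c + 2 by eexists.
have ec := enorm_ge0 c.
have L_ge1 : 1 <= L by rewrite LE; lra.
have L_ge0 : 0 <= L by lra.
have cL : enorm c + 1 <= L by rewrite LE; lra.
have bd x p : superdiff v x p -> dotp p p < L ^+ 2.
  move=> /sub; rewrite hamiltonianE => Hp.
  apply: le_lt_trans (_ : S < _); last first.
    by apply: lt_le_trans (ler_wpM2l L_ge0 L_ge1); rewrite mulr1 LE; lra.
  apply: le_trans (dotp_le_sqr_norm p) _; rewrite SE -mulrA ler_wpM2l// ler_pdivlMr//.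
  rewrite mulrC; apply: le_trans (A_ell x p) _.
  have := V_bd2 x; rewrite ler_norml => /andP[h1 _].
  by have := ler_norm a; lra.
have v_le := le_of_superdiff_bound cu u_bd cL bd.
have [L' L'E] : exists L', L' = L * n%:R by eexists.
have L'_ge0 : 0 <= L' by rewrite L'E mulr_ge0.
have v_lip x y : `|v x - v y| <= L' * `|x - y|.
  have h (z w : 'rV[R]_n) : L * enorm (z - w) <= L' * `|z - w|.
    by rewrite L'E -mulrA ler_wpM2l// enorm_le_norm.
  have := v_le x y; have := v_le y x; have := h x y; have := h y x.
  by rewrite [`|y - x|]distrC ler_norml -/(v x) -/(v y); lra.
have sd_bd x p : superdiff v x p -> `|p| <= L'.
  move=> /bd pL; apply: le_trans (_ : L <= _); last by rewrite L'E ler_peMr.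
  rewrite -(@ler_pXn2r _ 2) ?nnegrE//.
  by apply: le_trans (sqr_norm_le_dotp p) (ltW pL).
have [C C_gt0 v_mid] := semiconcave_midpoint lam_gt0 B_ge0 A_sym A_ell A_lip A_sd
  V_lip V_sd cu u_periodic u_bd cL bd sub super.
have C_ge0 := ltW C_gt0.
have v_sc := semiconcave_superdiff C_ge0 v_mid.
have cv := lipschitz_rV_continuous L'_ge0 v_lip.
split.
  move=> tau X.
  exact: (characteristic_increasing lam_gt0 A_sym A_ell A_bd C_ge0 L'_ge0 v_lip v_sc).
move=> x Sx notmax hyp.
(* Here alpha(c) > max V enters: a subgradient satisfies <A p, p> >= 2 (a - sup V) > 0, while <A p,
   p> <= n^2 B |p|^2. *)
have [m m_gt0 mE] : exists2 m, 0 < m & m ^+ 2 = 2 * (a - sup (range V)) / (n%:R ^+ 2 * B).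
  have pos : 0 < 2 * (a - sup (range V)) / (n%:R ^+ 2 * B).
    by rewrite divr_gt0// mulr_gt0// ?subr_gt0// exprn_gt0.
  by exists (Num.sqrt (2 * (a - sup (range V)) / (n%:R ^+ 2 * B)));
    rewrite ?sqrtr_gt0// sqr_sqrtr// ltW.
have subdiff_m y p : subdiff v y p -> m ^+ 2 <= dotp p p.
  move=> /super; rewrite hamiltonianE mE => Hp.
  rewrite ler_pdivrMr; last by rewrite mulr_gt0// exprn_gt0.
  rewrite [leRHS]mulrC; apply: le_trans (_ : n%:R ^+ 2 * B * `|p| ^+ 2 <= _).
    by apply: le_trans (quad_le A_bd y p); have := V_sup y; lra.
  by rewrite ler_wpM2l ?sqr_norm_le_dotp// mulr_ge0// sqr_ge0.
have x_nz := zero_notin_superdiff n_gt0 L'_ge0 m_gt0 v_lip cv subdiff_m notmax hyp.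
have [p0 Sp0 Hp0] := hamiltonian_lt_of_singular lam_gt0 A_sym A_ell C_ge0 L'_ge0
  v_lip sd_bd v_sc sub Sx.
have [X [K [X0 K_ge0 X_lip X_H X_d]]] := gradient_flow_right_derivative lam_gt0 B_ge0
  A_sym A_ell A_bd A_lip V_lip C_ge0 L'_ge0 v_lip sd_bd v_sc Sp0.
(* Closedness of the graph of D+v keeps 0 out of the superdifferential on a whole ball around x. *)
have [r r_gt0 Hr] : exists2 r, 0 < r & forall z, `|z - x| < r -> ~ superdiff v z 0.
  apply: contrapT => Hn; apply: x_nz.
  apply: (superdiff_closed C_ge0 L'_ge0 v_lip v_sc) => e e0.
  apply: contrapT => Hz; apply: Hn; exists e => // z zx Sz.
  by apply: Hz; exists z, 0; split => //; rewrite subrr normr0.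
have [d dE] : exists d, d = a - hamiltonian A V x p0 by eexists.
have d_gt0 : 0 < d by rewrite dE subr_gt0.
have K1 : 0 < K + 1 by rewrite ltr_wpDl.
(* Up to this time the arc stays in that ball, so its velocity cannot vanish, and its energy stays
   below a, so its points are singular. *)
pose tau := Num.min (r / 2 / (K + 1)) (d / 2 / (K + 1)).
have tau_gt0 : 0 < tau.
  by rewrite lt_min; apply/andP; split; apply: divr_gt0 => //; exact: divr_gt0.
have tau_r t : t <= tau -> 0 <= t -> K * t < r.
  rewrite le_min => /andP[+ _]; rewrite ler_pdivlMr// => h t0; lra.
have tau_d t : t <= tau -> 0 <= t -> K * t < d.
  rewrite le_min => /andP[_]; rewrite ler_pdivlMr// => h t0; lra.
have X_near t : 0 <= t -> t <= tau -> `|X t - x| < r.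
  move=> t0 tt; rewrite -X0; apply: le_lt_trans (X_lip 0 t) _.
  by rewrite subr0 ger0_norm//; exact: tau_r.
have X_rd s : 0 <= s -> s <= tau -> right_derivative_neq0 X s.
  move=> s0 st; have [q Sq Hq] := X_d s s0; exists (q *m A (X s)); first exact: Hq.
  apply/eqP => qA; apply: (Hr (X s)); first exact: X_near.
  suff <- : q = 0 by [].
  by rewrite -(mulmxK (A_unit lam_gt0 A_ell (X s)) q) qA mul0mx.
exists tau, X; split; [exact: tau_gt0| |exact: X0| |].
- split; last first.
    move=> s; rewrite in_itv/= => /andP[s0 st].
    have [p Sp Hp] := X_H s s0.
    apply: (singular_of_hamiltonian_lt C_ge0 L'_ge0 v_lip sd_bd v_sc super Sp).
    by apply: le_lt_trans Hp _; have := tau_d s st s0; rewrite dE; lra.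
  split => //; first by exists K => -[s t] _; exact: X_lip.
  have Xd_ex s : 0 <= s -> exists d : 'rV[R]_n,
      (t - s)^-1 *: (X t - X s) @[t --> s^'+] --> d.
    by move=> /X_d[q _ Hq]; exists (q *m A (X s)).
  have H1 := arc_derivable_ae X_lip Xd_ex.
  (* The almost everywhere derivative is known for positive times only; time 0 joins the null
     set. *)
  have H2 : {ae (@lebesgue_measure R), forall s, s != 0}.
    exists [set 0]; split => //; first exact: lebesgue_measure_set1.
    by move=> s /= /negP; rewrite negbK => /eqP.
  apply: filterS2 H1 H2; first exact: (ae_filter_ringOfSetsType lebesgue_measure).
  move=> s Hs s_n0; rewrite in_itv/= => /andP[s0 st].
  have s_gt0 : 0 < s by rewrite lt_neqAle eq_sym s_n0.
  have dX := Hs s_gt0; split => //.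
  apply/(closed_convex_hull_characteristic V _ _ lam_gt0 A_sym A_ell A_bd C_ge0 L'_ge0 v_lip v_sc).
  have [q Sq Hq] := X_d s s0; exists q; first exact: Sq.
  exact: (cvg_unique _ (cvg_dnbhs_at_right (derivable_cvg_dnbhs dX)) Hq).
- by move=> s; rewrite in_itv/= => /andP[s0 st]; apply: X_rd => //; exact: ltW.
(* If X were constant on the interval, its right derivative at 0 would vanish. *)
have [d' Hd' d'_nz] := X_rd 0 (lexx 0) (ltW tau_gt0).
apply: contrapT => Hc; move/eqP : d'_nz; apply.
suff c0 : (t - 0)^-1 *: (X t - X 0) @[t --> 0^'+] --> (0 : 'rV[R]_n).
  exact: (cvg_unique _ Hd' c0).
apply: cvg_near_cst; near=> t.
have t0 : 0 < t by near: t; exact: nbhs_right_gt.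
have tt : t <= tau by near: t; exact: nbhs_right_le.
have -> : X t = X 0.
  apply: contrapT => /eqP XX; apply: Hc; exists t => //.
  by rewrite in_itv/= (ltW t0).
by rewrite subrr scaler0.
Unshelve. all: by end_near. Qed.
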